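(* Assume that $x_{10},\dots,x_{N0}$ are mutually independent with common mean $\bar x_0$, $\max_{1\le i\le N}\mathbb E\|x_{i0}\|^2<C_0$ with $C_0$ independent of $N$, $\{x_{i0}\}$ and $\{W_i\}$ are independent of each other, $Q\ge0$, and that the equation $$\rho\bar P=\dot{\bar P}+A^T\bar P+\bar P(A+G)-\bar PBR^{-1}B^T\bar P+Q-Q\Gamma,\quad\bar P(T)=0,$$ admits a solution $\bar P\in C([0,T],\mathbb R^{n\times n})$. Let $P$, $\hat s$, $\bar x$ be determined on $[0,T]$ by $$\begin{aligned} \rho P&=\dot P+A^TP+PA-PBR^{-1}B^TP+Q,\quad P(T)=0,\\ \rho\hat s&=\dot{\hat s}+(A^T-\bar PBR^{-1}B^T)\hat s+\bar Pf-Q\eta,\quad\hat s(T)=0,\\ \dot{\bar x}&=A\bar x-BR^{-1}B^T(\bar P\bar x+\hat s)+G\bar x+f,\quad\bar x(0)=\bar x_0, \end{aligned}$$ and let $$\hat u_i=-R^{-1}B^T[P\hat x_i+(\bar P-P)\bar x+\hat s],\quad i=1,\dots,N,$$ where $\hat x_i$ satisfies $$d\hat x_i=\big[(A-BR^{-1}B^TP)\hat x_i-BR^{-1}B^T[(\bar P-P)\bar x+\hat s]+G\hat x^{(N)}+f\big]dt+\sigma dW_i,\quad\hat x_i(0)=x_{i0},\quad \hat x^{(N)}=\tfrac1N\sum_{j=1}^N\hat x_j.$$ Then the set of decentralized strategies $\{\hat u_1,\dots,\hat u_N\}$ is an $\varepsilon$-Nash equilibrium, i.e., for each $i$, $$\inf_{u_i\in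 L^2_{\mathcal F_t}(0,T;\mathbb R^r)}J^{\rm F}_i(u_i,\hat u_{-i})\ge J^{\rm F}_i(\hat u_i,\hat u_{-i})-\varepsilon,$$ where $\varepsilon=O(1/\sqrt N)$ as $N\to\infty$.
   Context: $N$ is the number of agents, $T>0$ a finite horizon, $\rho>0$ a discount constant. $A,G,\Gamma,Q\in\mathbb R^{n\times n}$, $B\in\mathbb R^{n\times r}$, $R\in\mathbb R^{r\times r}$, $\eta\in\mathbb R^n$ are constant and do not depend on $N$, with $Q,R$ symmetric and $R>0$; $f,\sigma:[0,\infty)\to\mathbb R^n$ are continuous, independent of $N$, with $\int_0^\infty e^{-\rho t}(\|f\|^2+\|\sigma\|^2)dt<\infty$. $W_1,W_2,\dots$ are independent one-dimensional Brownian motions. Agent $i$ has dynamics $$dx_i=[Ax_i+Bu_i+Gx^{(N)}+f]dt+\sigma dW_i,\quad x_i(0)=x_{i0},\quad x^{(N)}=\tfrac1N\sum_{j=1}^Nx_j,$$ and cost (with $\|z\|_M^2=z^TMz$) $J^{\rm F}_i(u)=J^{\rm F}_i(u_i,u_{-i})=\mathbb E\int_0^Te^{-\rho t}\{\|x_i-\Gamma x^{(N)}-\eta\|_Q^2+\|u_i\|_R^2\}dt$, where $u_{-i}=(u_1,\dots,u_{i-1},u_{i+1},\dots,u_N)$. In $J_i^{\rm F}(u_i,\hat u_{-i})$ the processes $\hat u_j$, $j\neq i$, are the control processes defined in the claim (with $\hat x_j$ the states generated when all agents use $\hat u$). $\mathcal F_t=\sigma\big(\bigcup_{i=1}^N\mathcal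 F^i_t\big)$ with $\mathcal F^i_t=\sigma(x_{i0},W_i(s),0\le s\le t)$, and $L^2_{\mathcal F_t}(0,T;\mathbb R^r)$ is the space of $\mathcal F_t$-adapted $\mathbb R^r$-valued processes $z$ with $\mathbb E\int_0^T\|z(t)\|^2dt<\infty$. *)

(* Defs.v *)
From HB Require Import structures.
From mathcomp Require Import all_boot all_order all_algebra.
From mathcomp Require Import all_classical all_reals all_analysis.

Set Implicit Arguments.
Unset Strict Implicit.
Unset Printing Implicit Defensive.

Import Order.TTheory GRing.Theory Num.Theory.
Import numFieldNormedType.Exports.

Local Open Scope classical_set_scope.
Local Open Scope ring_scope.

Section Vectors.
Context {K : realType} {k : nat}.

Definition wsqnorm (M : 'M[K]_k) (z : 'cV[K]_k) : K := (z^T *m M *m z) 0 0.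

(* The Euclidean norm; the library norm on matrices is the max norm. *)
Definition sqnorm (z : 'cV[K]_k) : K := (z^T *m z) 0 0.

Definition mxsym (M : 'M[K]_k) := M^T = M.
Definition mxpsd (M : 'M[K]_k) := forall z, 0 <= wsqnorm M z.
Definition mxposdef (M : 'M[K]_k) := forall z, z != 0 -> 0 < wsqnorm M z.

End Vectors.

(* Regularity of a classical solution of an ODE on [0, T]: the equation is
   imposed on ]0, T[, boundary values are attained by continuity. *)
Definition ode_regular {K : realType} {k l : nat} (T : K)
    (X : K -> 'M[K]_(k, l)) :=
  {within `[0, T], continuous X} /\
  (forall t, 0 < t < T -> derivable X t 1).

Section Probability.
Context {d : measure_display} {Omega : measurableType d} {K : realType}.
Variable Pr : probability Omega K.

Definition sigma_gen (S : set (Omega -> K)) : set (set Omega) :=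
  <<s \bigcup_(X in S) preimage_set_system setT X measurable >>.

Definition coords {k : nat} (Y : Omega -> 'cV[K]_k) : set (Omega -> K) :=
  range (fun (j : 'I_k) (w : Omega) => Y w j 0).

Definition random_vector {k : nat} (Y : Omega -> 'cV[K]_k) :=
  forall j, measurable_fun setT (fun w => Y w j 0).

Definition indep (F H : set (set Omega)) :=
  forall E E', F E -> H E' -> Pr (E `&` E') = (Pr E * Pr E')%E.

Definition mutually_indep {I : eqType} (F : I -> set (set Omega)) :=
  forall (s : seq I) (E : I -> set Omega), uniq s ->
    (forall i, i \in s -> F i (E i)) ->
    Pr (\bigcap_(i in [set` s]) E i) = (\prod_(i <- s) Pr (E i))%E.

Definition brownian_motion (W : K -> Omega -> K) :=
  [/\ forall t, 0 <= t -> measurable_fun setT (W t),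
      \forall w \ae Pr, W 0 w = 0,
      forall s t, 0 <= s -> s < t -> forall E : set K, measurable E ->
        Pr ((W t \- W s) @^-1` E) = normal_prob 0 (Num.sqrt (t - s)) E,
      forall s t, 0 <= s -> s < t ->
        indep (sigma_gen [set W t \- W s]) (sigma_gen (W @` `[0, s])) &
      \forall w \ae Pr, {within `[0, +oo[, continuous (W ^~ w)}].

Definition process_sigma (W : K -> Omega -> K) : set (set Omega) :=
  sigma_gen (W @` `[0, +oo[).

Definition measurable_process {k : nat} (T : K) (X : K -> Omega -> 'cV[K]_k) :=
  forall j, measurable_fun (`[0, T] `*` [set: Omega])
    (fun p : measurableTypeR K * Omega => X p.1 p.2 j 0).

Definition wiener_sum {k : nat} (sigma : K -> 'cV[K]_k) (W : K -> Omega -> K)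
    (t : K) (m : nat) (w : Omega) : 'cV[K]_k :=
  \sum_(j < m) (W (t * (j.+1%:R / m%:R)) w - W (t * (j%:R / m%:R)) w)
                 *: sigma (t * (j%:R / m%:R)).

(* [I] is (a version of) the stochastic integral of [sigma] against [W] over
   [0, t].  The integrand is deterministic and continuous, so its step
   approximations on the uniform partitions converge to it uniformly, and the
   integral is the mean-square limit of the integrals of these. *)
Definition is_wiener_integral {k : nat} (sigma : K -> 'cV[K]_k)
    (W : K -> Omega -> K) (t : K) (I : Omega -> 'cV[K]_k) :=
  random_vector I /\
  (\int[Pr]_w (sqnorm (I w - wiener_sum sigma W t m w))%:E)%E
    @[m --> \oo] --> 0%E.

Definition time_integral {k : nat} (b : K -> 'cV[K]_k) (t : K) : 'cV[K]_k :=
  \col_j (\int[lebesgue_measure]_(s in `[0, t]) b s j 0)%R.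

(* [X] solves [dX = b dt + sigma dW], [X 0 = x0] on [0, T], in integral form;
   [b] is the drift already evaluated along the solution. *)
Definition sde_solution {k : nat} (T : K) (b : K -> Omega -> 'cV[K]_k)
    (sigma : K -> 'cV[K]_k) (W : K -> Omega -> K) (x0 : Omega -> 'cV[K]_k)
    (X : K -> Omega -> 'cV[K]_k) :=
  [/\ measurable_process T X,
      \forall w \ae Pr, {within `[0, T], continuous (X ^~ w)},
      \forall w \ae Pr, forall j, lebesgue_measure.-integrable `[0, T]
        (fun t : measurableTypeR K => (b t w j 0)%:E) &
      forall t, 0 <= t <= T ->
        is_wiener_integral sigma W t
          (fun w => X t w - x0 w - time_integral (b ^~ w) t)].

End Probability.

Section Game.
Context {d : measure_display} {Omega : measurableType d} {K : realType}.
Variable Pr : probability Omega K.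
Context {n r N : nat}.

Local Notation process k := (K -> Omega -> 'cV[K]_k).

Definition agent_filtration (x0 : nat -> Omega -> 'cV[K]_n)
    (W : nat -> K -> Omega -> K) (i : nat) (t : K) : set (set Omega) :=
  sigma_gen (coords (x0 i) `|` W i @` `[0, t]).

Definition filtration (x0 : nat -> Omega -> 'cV[K]_n)
    (W : nat -> K -> Omega -> K) (t : K) : set (set Omega) :=
  <<s \bigcup_(i in [set: 'I_N]) agent_filtration x0 W i t >>.

(* [F] is not completed, so adaptedness holds everywhere, not up to null sets;
   joint measurability gives the double integral its meaning. *)
Definition L2_adapted {k : nat} (T : K) (F : K -> set (set Omega))
    (z : process k) :=
  [/\ measurable_process T z,
      forall t, 0 <= t <= T -> sigma_gen (coords (z t)) `<=` F t &
      (\int[Pr]_w \int[lebesgue_measure]_(t in `[0%R, T])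
         (sqnorm (z t w))%:E < +oo)%E].

Definition avg (X : 'I_N -> process n) : process n :=
  fun t w => N%:R^-1 *: \sum_j X j t w.

(* [X] is the family of states generated by the control profile [u]. *)
Definition states (T : K) (A : 'M[K]_n) (B : 'M[K]_(n, r)) (G : 'M[K]_n)
    (f sigma : K -> 'cV[K]_n) (x0 : nat -> Omega -> 'cV[K]_n)
    (W : nat -> K -> Omega -> K)
    (u : 'I_N -> process r) (X : 'I_N -> process n) :=
  forall i : 'I_N,
    sde_solution Pr T
      (fun t w => A *m X i t w + B *m u i t w + G *m avg X t w + f t)
      sigma (W i) (x0 i) (X i).

(* Cost of agent [i] when [X] are the states generated by the profile [u]. *)
Definition cost (T rho : K) (Gamma Q : 'M[K]_n) (R : 'M[K]_r) (eta : 'cV[K]_n)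
    (i : 'I_N) (u : 'I_N -> process r) (X : 'I_N -> process n) : \bar K :=
  (\int[Pr]_w \int[lebesgue_measure]_(t in `[0%R, T])
     (expR (- (rho * t)) *
        (wsqnorm Q (X i t w - Gamma *m avg X t w - eta)
         + wsqnorm R (u i t w)))%:E)%E.

(* The profile [(v, u_{-i})]. *)
Definition deviate (u : 'I_N -> process r) (i : 'I_N) (v : process r)
  : 'I_N -> process r := fun j => if j == i then v else u j.

End Game.

Arguments filtration {d Omega K n} N x0 W t.

(* Main.v *)
(** A unilateral deviation does not touch the noise. If agent [i] plays [v] instead
    of [uh i], then, with [zeta = v - uh i], the differences [delta_j = X_j - xh_j]
    solve, path by path, a linear equation driven by [B zeta]; Gronwall gives
    |delta_i|^2 <= C |zeta|^2 and |delta^(N)|^2 <= C |zeta|^2 / N^2 in L^2(dt x dPr),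
    and the law of large numbers gives |xh^(N) - xbar|^2 <= C / N.

    Put pi = e^(-rho t) (P xh_i + (Pbar - P) xbar + shat), so that
    e^(-rho t) R uh_i = - B^T pi. The Riccati equations give an expression for the
    drift of pi, and the product rule for <pi, delta_i>, which vanishes at both ends,
    cancels the linear terms of J(v) - J(uh) up to products of delta_i with
    xh^(N) - xbar and products of delta^(N) with bounded processes. Young's
    inequality absorbs these into the coercive term of size |zeta|^2 at the price
    C / N; hence one may take eps = C / N, which is O(1 / sqrt N).

    Stochastic calculus enters only through second moments: the increments of the
    noise after time s are orthogonal to F_s, this orthogonality propagates through
    linear Volterra equations, and it makes the martingale part of the product rule
    vanish in expectation. *)

Require Import Defs.
From HB Require Import structures.
From mathcomp Require Import all_boot all_order all_algebra.
From mathcomp Require Import all_classical all_reals all_analysis.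
From mathcomp Require Import measurable_realfun ring lra.

Set Implicit Arguments.
Unset Strict Implicit.
Unset Printing Implicit Defensive.

Import Order.TTheory GRing.Theory Num.Theory.
Import numFieldNormedType.Exports.

Local Open Scope classical_set_scope.
Local Open Scope ring_scope.

(** * Square-integrable functions *)

(** Two features of the definitions shape the probabilistic half. [is_wiener_integral] is imposed at
    each time separately, through uniform partitions of [0, t], and these are unrelated for
    different t, so increments are not directly accessible. If s / t is rational the two families
    have common refinements; continuity of the paths then reaches every s. Moreover [filtration] is
    not completed and [sde_solution] does not include adaptedness, so the states cannot be treated
    as adapted. What is propagated is a property of a test variable: if [Z] is orthogonal to all
    square-integrable functions measurable for the past of u, it is orthogonal to the states up to
    u.

    In the cost gap the mean deviation has squared norm of order |zeta|^2 / N^2 and a coefficient of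
    order 1, while the own deviation has squared norm of order |zeta|^2 and a coefficient of squared
    norm O(1 / N). Young's inequality with weights [eps * N ^ 2] and [eps] balances both: the
    coefficients then cost 1 / N^2 and 1 / N, and [eps] is fixed by the coercivity of R alone,
    uniformly in N. *)

Section SquareIntegrable.
Context {dd : measure_display} {S : measurableType dd} {K : realType}.
Variables (mu : {measure set S -> \bar K}) (D : set S) (mD : measurable D).
Implicit Types f g h : S -> K.

Definition sqint f :=
  measurable_fun D f /\ (\int[mu]_(x in D) (f x ^+ 2)%:E < +oo)%E.

Lemma sqint_measurable f : sqint f -> measurable_fun D f.
Proof. by case. Qed.

Lemma sqint_integrable2 f : sqint f ->
  mu.-integrable D (EFin \o (fun x => f x ^+ 2)).
Proof.
move=> [mf fi]; apply/integrableP; split.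
  exact/measurable_EFinP/measurable_funX.
rewrite (eq_integral (fun x => (f x ^+ 2)%:E)) // => x _ /=.
by rewrite ger0_norm ?sqr_ge0.
Qed.

Lemma sqint_of_integrable2 f : measurable_fun D f ->
  mu.-integrable D (EFin \o (fun x => f x ^+ 2)) -> sqint f.
Proof.
move=> mf /integrableP[_ fi]; split => //; move: fi.
rewrite (eq_integral (fun x => (f x ^+ 2)%:E)) // => x _ /=.
by rewrite ger0_norm ?sqr_ge0.
Qed.

Lemma integrable_le f g : measurable_fun D f ->
  mu.-integrable D (EFin \o g) -> (forall x, D x -> `|f x| <= g x) ->
  mu.-integrable D (EFin \o f).
Proof.
move=> mf ig fg; apply: (le_integrable mD _ _ ig); first exact/measurable_EFinP.
by move=> x Dx /=; rewrite lee_fin (le_trans (fg _ Dx)) ?ler_norm.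
Qed.

Lemma sqint_le f g : measurable_fun D f -> sqint g ->
  (forall x, D x -> `|f x| <= `|g x|) -> sqint f.
Proof.
move=> mf sg fg; apply: sqint_of_integrable2 => //.
apply: (integrable_le (g := fun x => g x ^+ 2)).
- exact: measurable_funX.
- exact: sqint_integrable2.
- move=> x Dx; rewrite normrX -[leRHS]real_normK ?num_real//.
  by rewrite lerXn2r ?nnegrE// fg.
Qed.

Lemma sqintM f g : sqint f -> sqint g ->
  mu.-integrable D (EFin \o (fun x => f x * g x)).
Proof.
move=> sf sg; apply: (integrable_le (g := fun x => f x ^+ 2 + g x ^+ 2)).
- by apply: measurable_funM; [case: sf|case: sg].
- under [EFin \o _]eq_fun do rewrite /= EFinD.
  by apply: integrableD => //; exact: sqint_integrable2.
- move=> x _; rewrite normrM -(real_normK (num_real (f x))) -(real_normK (num_real (g x))).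
  have := sqr_ge0 (`|f x| - `|g x|); have := sqr_ge0 (`|f x| + `|g x|).
  rewrite ?sqrrB ?sqrrD !mulr2n; lra.
Qed.

Lemma sqintZ (c : K) f : sqint f -> sqint (fun x => c * f x).
Proof.
move=> sf; apply: sqint_of_integrable2.
  by apply: measurable_funM => //; case: sf.
under [EFin \o _]eq_fun do rewrite /= exprMn EFinM.
by apply: integrableZl => //; exact: sqint_integrable2.
Qed.

Lemma sqintD f g : sqint f -> sqint g -> sqint (fun x => f x + g x).
Proof.
move=> sf sg; apply: sqint_of_integrable2.
  by apply: measurable_funD; [case: sf|case: sg].
apply: (integrable_le (g := fun x => 2 * f x ^+ 2 + 2 * g x ^+ 2)).
- by apply/measurable_funX/measurable_funD; [case: sf|case: sg].
- under [EFin \o _]eq_fun do rewrite /= EFinD !EFinM.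
  by apply: integrableD => //; apply: integrableZl => //; exact: sqint_integrable2.
- move=> x _; rewrite ger0_norm ?sqr_ge0//.
  by have := sqr_ge0 (f x - g x); rewrite ?sqrrB ?sqrrD !mulr2n; lra.
Qed.

Lemma sqintN f : sqint f -> sqint (fun x => - f x).
Proof. by under eq_fun do rewrite -mulN1r; exact: sqintZ. Qed.

Lemma sqintB f g : sqint f -> sqint g -> sqint (fun x => f x - g x).
Proof. by move=> sf sg; apply: sqintD => //; exact: sqintN. Qed.

Lemma sqint0 : sqint (fun=> 0).
Proof.
split; first exact: measurable_cst.
by under eq_integral do rewrite expr0n; rewrite integral0 ltry.
Qed.

Lemma sqint_sum (I : Type) (s : seq I) (F : I -> S -> K) :
  (forall i, sqint (F i)) -> sqint (fun x => \sum_(i <- s) F i x).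
Proof.
move=> sF; elim: s => [|i s IH].
  by under eq_fun do rewrite big_nil; exact: sqint0.
by under eq_fun do rewrite big_cons; apply: sqintD.
Qed.

Lemma sqintM_bounded (c : K) h f : measurable_fun D h ->
  (forall x, D x -> `|h x| <= c) -> sqint f -> sqint (fun x => h x * f x).
Proof.
move=> mh hc sf; apply: (sqint_le (g := fun x => c * f x)).
- by apply: measurable_funM => //; case: sf.
- exact: sqintZ.
- move=> x Dx; rewrite !normrM ler_wpM2r// (le_trans (hc _ Dx))//.
  by rewrite ler_norm.
Qed.

Lemma eq_sqint f g : (forall x, D x -> f x = g x) -> sqint f -> sqint g.
Proof.
move=> fg [mf fi]; split.
  by apply: (eq_measurable_fun f) => // x /set_mem /fg.
by rewrite (eq_integral (fun x => (f x ^+ 2)%:E))// => x /set_mem /fg ->.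
Qed.

(** The quadratic form in (t, s) given by the integral of (t f + s g)^2 is nonnegative; its value at
    (b, -a) is a (a c - b^2), which settles the case a > 0. *)
Lemma Rint_CS f g : sqint f -> sqint g ->
  (\int[mu]_(x in D) (f x * g x)) ^+ 2 <=
    (\int[mu]_(x in D) (f x ^+ 2)) * (\int[mu]_(x in D) (g x ^+ 2)).
Proof.
move=> sf sg; set a := \int[mu]_(x in D) (f x ^+ 2).
set b := \int[mu]_(x in D) (f x * g x); set c := \int[mu]_(x in D) (g x ^+ 2).
have quad (t s : K) : 0 <= t ^+ 2 * a + 2 * t * s * b + s ^+ 2 * c.
  have -> : t ^+ 2 * a + 2 * t * s * b + s ^+ 2 * c =
    \int[mu]_(x in D) ((t * f x + s * g x) ^+ 2).
    have -> : (fun x => (t * f x + s * g x) ^+ 2) =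
        (fun x => (t ^+ 2 * f x ^+ 2 + 2 * t * s * (f x * g x)) + s ^+ 2 * g x ^+ 2).
      by apply/funext => x; ring.
    have if2 := sqint_integrable2 sf; have ig2 := sqint_integrable2 sg.
    have ifg := sqintM sf sg.
    have iZ k u : mu.-integrable D (EFin \o u) ->
        mu.-integrable D (EFin \o (fun x => k * u x)).
      by move=> iu; under [EFin \o _]eq_fun do rewrite /= EFinM; exact: integrableZl.
    rewrite RintegralD//; last 2 first.
      under [EFin \o _]eq_fun do rewrite /= EFinD.
      by apply: integrableD => //; exact: iZ.
      exact: iZ.
    rewrite RintegralD//; [|exact: iZ|exact: iZ].
    by rewrite !RintegralZl.
  by apply: Rintegral_ge0 => x _; rewrite sqr_ge0.
have a0 : 0 <= a by apply: Rintegral_ge0 => x _; rewrite sqr_ge0.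
have c0 : 0 <= c by apply: Rintegral_ge0 => x _; rewrite sqr_ge0.
have [az|an] := eqVneq a 0.
  have [bz|bn] := eqVneq b 0; first by rewrite bz expr0n mulr_ge0.
  (* With a = 0 and b nonzero, the form takes the value -1 at this point. *)
  have /= := quad (- (c + 1) / (2 * b)) 1.
  rewrite az mulr0 add0r !mulr1 expr1n mul1r.
  have -> : 2 * (- (c + 1) / (2 * b)) * b = - (c + 1) by field.
  lra.
have := quad b (- a).
have -> : b ^+ 2 * a + 2 * b * - a * b + (- a) ^+ 2 * c = a * (a * c - b ^+ 2) by ring.
by rewrite pmulr_rge0 ?subr_ge0// lt_neqAle eq_sym an.
Qed.

Lemma Rint_sum (I : Type) (s : seq I) (F : I -> S -> K) :
  (forall i, mu.-integrable D (EFin \o F i)) ->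
  \int[mu]_(x in D) (\sum_(i <- s) F i x) =
  \sum_(i <- s) \int[mu]_(x in D) F i x.
Proof.
move=> Fi; rewrite /Rintegral.
under eq_integral do rewrite -sumEFin.
rewrite integral_sum//= (eq_bigr (fun i => (\int[mu]_(x in D) F i x)%:E)) ?sumEFin//.
by move=> i _; rewrite /Rintegral fineK//; exact: integrable_fin_num (Fi i).
Qed.

End SquareIntegrable.

(** * Tonelli and Fubini on measurable rectangles *)

Section RectangleFubini.
Context {d1 d2 : measure_display} {T1 : measurableType d1} {T2 : measurableType d2}
  {K : realType}.
Variables (m1 : {sigma_finite_measure set T1 -> \bar K})
  (m2 : {sigma_finite_measure set T2 -> \bar K}).
Variables (D1 : set T1) (D2 : set T2) (mD1 : measurable D1) (mD2 : measurable D2).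

Let mS : measurable (D1 `*` D2). Proof. exact: measurableX. Qed.

(** Extension by zero outside the rectangle commutes with taking slices, so the statements below
    follow from those on the full product applied to the extended function. *)
Lemma rect_patch1 (f : T1 * T2 -> \bar K) x :
  (\int[m2]_y (f \_ (D1 `*` D2)) (x, y) =
   ((fun x => \int[m2]_(y in D2) f (x, y)) \_ D1) x)%E.
Proof.
rewrite !patchE; case: ifPn => [xD|xD].
  rewrite [RHS]integral_mkcond; apply: eq_integral => y _; rewrite !patchE.
  by rewrite in_setX xD.
by apply: integral0_eq => y _; rewrite patchE in_setX (negbTE xD).
Qed.

Lemma rect_patch2 (f : T1 * T2 -> \bar K) y :
  (\int[m1]_x (f \_ (D1 `*` D2)) (x, y) =
   ((fun y => \int[m1]_(x in D1) f (x, y)) \_ D2) y)%E.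
Proof.
rewrite !patchE; case: ifPn => [yD|yD].
  rewrite [RHS]integral_mkcond; apply: eq_integral => x _; rewrite !patchE.
  by rewrite in_setX /= yD andbT.
by apply: integral0_eq => x _; rewrite patchE in_setX (negbTE yD) andbF.
Qed.

Section Nonneg.
Variables (f : T1 * T2 -> \bar K).
Hypotheses (mf : measurable_fun (D1 `*` D2) f)
  (f0 : forall z, (D1 `*` D2) z -> (0 <= f z)%E).

Let mg : measurable_fun setT (f \_ (D1 `*` D2)).
Proof. exact: (measurable_restrictT f mS).1 mf. Qed.

Let g0 z : (0 <= (f \_ (D1 `*` D2)) z)%E.
Proof. by rewrite patchE; case: ifPn => // /set_mem /f0. Qed.

Lemma tonelli_rect1 :
  (\int[m1 \x m2]_(z in D1 `*` D2) f z =
   \int[m1]_(x in D1) \int[m2]_(y in D2) f (x, y))%E.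
Proof.
rewrite integral_mkcond (fubini_tonelli1 _ mg g0) [RHS]integral_mkcond.
by apply: eq_integral => x _; rewrite /fubini_F rect_patch1.
Qed.

Lemma tonelli_rect2 :
  (\int[m1 \x m2]_(z in D1 `*` D2) f z =
   \int[m2]_(y in D2) \int[m1]_(x in D1) f (x, y))%E.
Proof.
rewrite integral_mkcond (fubini_tonelli2 _ mg g0) [RHS]integral_mkcond.
by apply: eq_integral => y _; rewrite /fubini_G rect_patch2.
Qed.

Lemma measurable_tonelli_rect1 :
  measurable_fun D1 (fun x => \int[m2]_(y in D2) f (x, y))%E.
Proof.
apply/(measurable_restrictT _ mD1).2.
have := measurable_fun_fubini_tonelli_F (m2 := m2) _ mg g0.
by apply: eq_measurable_fun => x _; rewrite /fubini_F rect_patch1.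
Qed.

Lemma measurable_tonelli_rect2 :
  measurable_fun D2 (fun y => \int[m1]_(x in D1) f (x, y))%E.
Proof.
apply/(measurable_restrictT _ mD2).2.
have := measurable_fun_fubini_tonelli_G (m1 := m1) _ mg g0.
by apply: eq_measurable_fun => x _; rewrite /fubini_G rect_patch2.
Qed.

End Nonneg.

Section Real.
Variable f : T1 * T2 -> K.
Hypothesis fi : (m1 \x m2)%E.-integrable (D1 `*` D2) (EFin \o f).

Let gi : (m1 \x m2)%E.-integrable setT ((EFin \o f) \_ (D1 `*` D2)).
Proof. exact: (integrable_mkcond _ mS).1 fi. Qed.

Lemma ae_integrable_rect1 :
  {ae m1, forall x, D1 x -> m2.-integrable D2 (EFin \o (fun y => f (x, y)))}.
Proof.
apply: filterS (ae_integrable1 gi) => x /= + D1x.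
rewrite [X in m2.-integrable setT X -> _](_ : _ =
    (EFin \o (fun y => f (x, y))) \_ D2); first exact/(integrable_mkcond _ mD2).2.
by apply/funext => y; rewrite !patchE in_setX mem_set.
Qed.

Lemma ae_integrable_rect2 :
  {ae m2, forall y, D2 y -> m1.-integrable D1 (EFin \o (fun x => f (x, y)))}.
Proof.
apply: filterS (ae_integrable2 gi) => y /= + D2y.
rewrite [X in m1.-integrable setT X -> _](_ : _ =
    (EFin \o (fun x => f (x, y))) \_ D1); first exact/(integrable_mkcond _ mD1).2.
by apply/funext => x; rewrite !patchE in_setX /= (mem_set D2y) andbT.
Qed.

Lemma integrable_rect1e :
  m1.-integrable D1 (fun x => \int[m2]_(y in D2) (f (x, y))%:E)%E.
Proof.
apply/(integrable_mkcond _ mD1).2.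
rewrite (_ : _ \_ D1 = fubini_F m2 ((EFin \o f) \_ (D1 `*` D2))).
  exact: (integrable_fubini_F gi).
by apply/funext => x; rewrite /fubini_F rect_patch1.
Qed.

Lemma integrable_rect2e :
  m2.-integrable D2 (fun y => \int[m1]_(x in D1) (f (x, y))%:E)%E.
Proof.
apply/(integrable_mkcond _ mD2).2.
rewrite (_ : _ \_ D2 = fubini_G m1 ((EFin \o f) \_ (D1 `*` D2))); last first.
  by apply/funext => x; rewrite /fubini_G rect_patch2.
apply/integrableP; split; first exact: (measurable_fubini_G gi).
have mg := measurable_int _ gi.
apply: le_lt_trans ((integrable21ltyP _ _ mg).1 gi).
apply: ge0_le_integral => //.
- by apply: measurableT_comp => //; exact: (measurable_fubini_G gi).
- apply: (measurable_fun_fubini_tonelli_G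
    (abse \o ((EFin \o f) \_ (D1 `*` D2)))) => [|z /=]; last exact: abse_ge0.
  exact: measurableT_comp.
- move=> y _; apply: le_abse_integral => //.
  exact: (measurableT_comp mg (pair2_measurable y)).
Qed.

(** An inner integral of an integrable function is finite only almost everywhere; passing to [fine]
    alters it on a null set. This is what allows real-valued iterated integrals. *)
Lemma fine_integrable d (T : measurableType d) (m : {measure set T -> \bar K})
  (D : set T) (g : T -> \bar K) : measurable D -> m.-integrable D g ->
  m.-integrable D (EFin \o (fine \o g)) /\
  (\int[m]_(x in D) g x = (\int[m]_(x in D) (fine (g x)))%R%:E)%E.
Proof.
move=> mD ig; have mg := measurable_int _ ig.
have mfg : measurable_fun D (EFin \o (fine \o g)).
  by apply/measurable_EFinP; exact: measurableT_comp.
have ae : ae_eq m D g (EFin \o (fine \o g)).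
  by apply: filterS (integrable_ae mD ig) => x /= + Dx => /(_ Dx) /fineK.
have iE := ae_eq_integral _ _ mD mg mfg ae.
split.
  apply/integrableP; split=> //; case/integrableP: (ig) => _.
  apply: le_lt_trans; apply: ae_ge0_le_integral => //.
    by apply: measurableT_comp.
    by apply: measurableT_comp.
  by apply: filterS ae => x h Dx; rewrite [in leRHS](h Dx).
have fin := integrable_fin_num mD ig; rewrite iE in fin.
by rewrite iE; exact/esym/fineK.
Qed.

Lemma integrable_rect1 :
  m1.-integrable D1 (EFin \o (fun x => \int[m2]_(y in D2) f (x, y))).
Proof. by have [] := fine_integrable mD1 integrable_rect1e. Qed.

Lemma integrable_rect2 :
  m2.-integrable D2 (EFin \o (fun y => \int[m1]_(x in D1) f (x, y))).
Proof. by have [] := fine_integrable mD2 integrable_rect2e. Qed.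

Lemma fubini_rect1 :
  \int[(m1 \x m2)%E]_(z in D1 `*` D2) f z =
  \int[m1]_(x in D1) \int[m2]_(y in D2) f (x, y).
Proof.
rewrite {1}/Rintegral integral_mkcond -(integral12_prod_meas1 gi).
transitivity (fine (\int[m1]_(x in D1) \int[m2]_(y in D2) (f (x, y))%:E)%E).
  congr fine; rewrite [RHS]integral_mkcond.
  by apply: eq_integral => x _; rewrite /fubini_F rect_patch1.
by have [_ ->] := fine_integrable mD1 integrable_rect1e.
Qed.

Lemma fubini_rect2 :
  \int[(m1 \x m2)%E]_(z in D1 `*` D2) f z =
  \int[m2]_(y in D2) \int[m1]_(x in D1) f (x, y).
Proof.
rewrite {1}/Rintegral integral_mkcond -(integral21_prod_meas1 gi).
transitivity (fine (\int[m2]_(y in D2) \int[m1]_(x in D1) (f (x, y))%:E)%E).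
  congr fine; rewrite [RHS]integral_mkcond.
  by apply: eq_integral => x _; rewrite /fubini_G rect_patch2.
by have [_ ->] := fine_integrable mD2 integrable_rect2e.
Qed.

End Real.

End RectangleFubini.

(** * Absolutely continuous functions on an interval *)

Lemma measurable_rect_fst d1 d2 d3 (T1 : measurableType d1) (T2 : measurableType d2)
    (U : measurableType d3) (D1 : set T1) (D2 : set T2) (f : T1 -> U) :
  measurable D1 -> measurable_fun D1 f ->
  measurable_fun (D1 `*` D2) (fun z => f z.1).
Proof.
move=> mD1 mf; apply: (measurable_comp (F := D1)) => //.
  by move=> _ [z [? _] <-].
exact: measurable_funTS.
Qed.

Lemma measurable_rect_snd d1 d2 d3 (T1 : measurableType d1) (T2 : measurableType d2)
    (U : measurableType d3) (D1 : set T1) (D2 : set T2) (f : T2 -> U) :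
  measurable D2 -> measurable_fun D2 f ->
  measurable_fun (D1 `*` D2) (fun z => f z.2).
Proof.
move=> mD2 mf; apply: (measurable_comp (F := D2)) => //.
  by move=> _ [z [_ ?] <-].
exact: measurable_funTS.
Qed.

Section AbsolutelyContinuous.
Context {K : realType}.
Local Notation leb := (@lebesgue_measure K).
Implicit Types (t T : K) (F f G g b h : K -> K).

Lemma mem_it T t : (t \in [set` `[0, T] : interval K]) = (0 <= t <= T).
Proof. by rewrite mem_setE in_itv. Qed.

Definition integ T f := leb.-integrable `[0, T] (EFin \o f).

Lemma integS T t f : 0 <= t <= T -> integ T f -> integ t f.
Proof.
move=> /andP[_ tT]; apply: integrableS => //.
by apply: subset_itvl; rewrite bnd_simp.
Qed.

Lemma integ_measurable T f : integ T f -> measurable_fun `[0, T] f.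
Proof. by move=> /(measurable_int leb) /measurable_EFinP. Qed.

Lemma integD T f g : integ T f -> integ T g -> integ T (fun s => f s + g s).
Proof.
move=> fi gi; rewrite /integ; under [EFin \o _]eq_fun do rewrite /= EFinD.
exact: integrableD.
Qed.

Lemma integZ T c f : integ T f -> integ T (fun s => c * f s).
Proof.
move=> fi; rewrite /integ; under [EFin \o _]eq_fun do rewrite /= EFinM.
exact: integrableZl.
Qed.

Lemma integ0 T : integ T (fun=> 0).
Proof. exact: integrable0. Qed.

Lemma integ_cst T c : integ T (fun=> c).
Proof.
apply: (@measurable_bounded_integrable _ _ _ leb) => //.
  by rewrite /= lebesgue_measure_itv /=; case: ifP => _; rewrite ?ltry// -EFinB ltry.
exists `|c|; split; first exact: num_real.
by move=> M cM s _ /=; rewrite ltW.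
Qed.

Lemma integM_bounded T c f g : measurable_fun `[0, T] g ->
  (forall s, 0 <= s <= T -> `|g s| <= c) -> integ T f ->
  integ T (fun s => f s * g s).
Proof.
move=> mg gc fi.
apply: (@integrable_le _ _ _ leb _ _ _ (fun s => c * `|f s|)) => //.
- by apply: measurable_funM => //; exact: integ_measurable fi.
- apply: integZ; apply: integrable_norm fi.
- move=> s; rewrite /= in_itv /= => sT; rewrite normrM mulrC ler_wpM2r//.
  exact: gc.
Qed.

Lemma within_cont_bounded T f : {within `[0, T], continuous f} ->
  exists c, forall s, 0 <= s <= T -> `|f s| <= c.
Proof.
move=> cf.
have cK : compact [set` `[0, T] : interval K] by exact: segment_compact.
have [M [_ MP]] := compact_bounded (continuous_compact cf cK).
exists (M + 1) => s sT; apply: (MP (M + 1)); first by rewrite ltrDl.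
by exists s => //; rewrite /= in_itv.
Qed.

Lemma within_cont_measurable T f : {within `[0, T], continuous f} ->
  measurable_fun `[0, T] f.
Proof. by move=> cf; exact: subspace_continuous_measurable_fun. Qed.

Lemma within_cont_integ T f : {within `[0, T], continuous f} -> integ T f.
Proof.
by move=> cf; apply: continuous_compact_integrable => //; exact: segment_compact.
Qed.

Lemma prim_continuous T f : 0 <= T -> integ T f ->
  {within `[0, T], continuous (fun t => \int[leb]_(s in `[0, t]) f s)}.
Proof. by move=> T0; exact: parameterized_integral_continuous. Qed.

Let itvT T := [set` `[0, T] : interval K].
Let mitvT T : measurable (itvT T). Proof. exact: measurable_itv. Qed.

(** Fubini on the square for b(x) h(y), split along the diagonal: the triangle y <= x contributes b
    H and the rest contributes h B. Integrability of b and h suffices for this. *)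
Lemma prim_ibp T b h : 0 <= T -> integ T b -> integ T h ->
  let B t := \int[leb]_(s in `[0, t]) b s in
  let H t := \int[leb]_(s in `[0, t]) h s in
  B T * H T = \int[leb]_(s in `[0, T]) (b s * H s + h s * B s).
Proof.
move=> T0 bi hi B H; have mD := mitvT T.
have mb := integ_measurable bi; have mh := integ_measurable hi.
pose f (z : measurableTypeR K * measurableTypeR K) := b z.1 * h z.2.
have mf : measurable_fun (itvT T `*` itvT T) f.
  by apply: measurable_funM; [exact: measurable_rect_fst|exact: measurable_rect_snd].
have fi : (leb \x leb)%E.-integrable (itvT T `*` itvT T) (EFin \o f).
  apply/integrableP; split; first exact/measurable_EFinP.
  rewrite tonelli_rect1 //; last 1 first.
  - by apply: measurableT_comp => //; exact/measurable_EFinP.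
  have E x : (\int[leb]_(y in itvT T) `|(EFin \o f) (x, y)| =
      `|(b x)%:E| * \int[leb]_(y in itvT T) `|(h y)%:E|)%E.
    under eq_integral do rewrite /f /= normrM EFinM.
    rewrite ge0_integralZl//.
    by apply/measurable_EFinP; exact: measurableT_comp.
  under eq_integral do rewrite E.
  rewrite ge0_integralZr//; last 2 first.
  - by apply: measurableT_comp => //; exact/measurable_EFinP.
  - exact: integral_ge0.
  case/integrableP : bi => _ bi; case/integrableP : hi => _ hi.
  by apply: lte_mul_pinfty => //; [exact: integral_ge0|rewrite ge0_fin_numE//; exact: integral_ge0].
pose C := [set z : measurableTypeR K * measurableTypeR K | z.2 <= z.1].
have mC : measurable C.
  rewrite (_ : C = [set z | (z.2 <= z.1) = true]); last by apply/funext => z.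
  have := @measurable_fun_ler _ _ K setT snd fst measurable_snd measurable_fst.
  by move=> /(_ measurableT [set true] Logic.I); rewrite setTI.
pose f1 z := f z * \1_C z; pose f2 z := f z * \1_(~` C) z.
have bnd (A : set (measurableTypeR K * measurableTypeR K)) : measurable A ->
    (leb \x leb)%E.-integrable (itvT T `*` itvT T) (EFin \o (fun z => f z * \1_A z)).
  move=> mA; apply: (integrable_le _ (g := fun z => `|f z|)).
  - exact: measurableX.
  - by apply: measurable_funM => //; exact: measurable_indic.
  - exact: integrable_norm.
  - move=> z _; rewrite normrM ler_piMr// indicE; case: (_ \in _);
    by rewrite ?normr1 ?normr0.
have fi1 := bnd _ mC; have fi2 := bnd _ (measurableC mC).
have split_f : \int[(leb \x leb)%E]_(z in itvT T `*` itvT T) f z =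
    \int[(leb \x leb)%E]_(z in itvT T `*` itvT T) f1 z +
    \int[(leb \x leb)%E]_(z in itvT T `*` itvT T) f2 z.
  rewrite -RintegralD//; last exact: measurableX.
  apply: eq_Rintegral => z _; rewrite /f1 /f2 -mulrDr !indicE in_setC.
  by case: (_ \in _); rewrite /= ?addr0 ?add0r mulr1.
have int_f : \int[(leb \x leb)%E]_(z in itvT T `*` itvT T) f z = B T * H T.
  rewrite fubini_rect1//.
  transitivity (\int[leb]_(x in itvT T) (b x * H T)).
    by apply: eq_Rintegral => x _; rewrite /f /= RintegralZl.
  by rewrite RintegralZr.
have int_in1 x : 0 <= x -> x <= T ->
    \int[leb]_(y in itvT T) f1 (x, y) = b x * H x.
  move=> x0 xT; have hix : integ x h by apply: integS hi; rewrite x0.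
  rewrite /H -RintegralZl// -/(itvT x).
  have -> : itvT x = itvT T `&` itvT x.
    by apply/esym/setIidPr/subset_itvl; rewrite bnd_simp.
  rewrite [RHS]Rintegral_mkcondr; apply: eq_Rintegral => y.
  rewrite mem_it => /andP[y0 yT].
  rewrite /f1 /f /= patchE indicE /= mem_it.
  have -> : ((x, y) \in C) = (y <= x) by apply/idP/idP; rewrite inE.
  by rewrite y0 /=; case: (_ <= _); rewrite ?mulr1 ?mulr0.
have int_in2 y : 0 <= y -> y <= T ->
    \int[leb]_(x in itvT T) f2 (x, y) = h y * B y.
  move=> y0 yT; have biy : integ y b by apply: integS bi; rewrite y0.
  (* The complement of [C] is the strict inequality x < y, hence an integral over [0, y[; the
     missing end point has measure zero. *)
  rewrite /B -RintegralZl// -[RHS]Rintegral_itv_bndo_bndc; last first.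
    have := integZ (h y) biy; apply: integrableS => //.
    by apply: subset_itvl; rewrite bnd_simp.
  have -> : `[0, y[%classic = itvT T `&` `[0, y[%classic.
    by apply/esym/setIidPr/subset_itvl; rewrite bnd_simp.
  rewrite [RHS]Rintegral_mkcondr; apply: eq_Rintegral => x.
  rewrite mem_it => /andP[x0 xT].
  rewrite /f2 /f /= patchE indicE /= in_setC.
  have -> : ((x, y) \in C) = (y <= x) by apply/idP/idP; rewrite inE.
  by rewrite mem_setE in_itv /= x0 /= ltNge; case: (_ <= _); rewrite ?mulr1 ?mulr0// mulrC.
have int_f1 : \int[(leb \x leb)%E]_(z in itvT T `*` itvT T) f1 z =
    \int[leb]_(s in `[0, T]) (b s * H s).
  rewrite fubini_rect1//; apply: eq_Rintegral => x; rewrite mem_it => /andP[? ?].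
  exact: int_in1.
have int_f2 : \int[(leb \x leb)%E]_(z in itvT T `*` itvT T) f2 z =
    \int[leb]_(s in `[0, T]) (h s * B s).
  rewrite fubini_rect2//; apply: eq_Rintegral => x; rewrite mem_it => /andP[? ?].
  exact: int_in2.
rewrite RintegralD//; first by rewrite -int_f split_f int_f1 int_f2.
- rewrite /integ; have : leb.-integrable (itvT T) (EFin \o (fun x => \int[leb]_(y in itvT T) f1 (x, y))).
    exact: integrable_rect1.
  apply: eq_integrable => // x; rewrite mem_it /= => /andP[x0 xT].
  congr EFin; exact: int_in1.
- have : leb.-integrable (itvT T) (EFin \o (fun y => \int[leb]_(x in itvT T) f2 (x, y))).
    exact: integrable_rect2.
  apply: eq_integrable => // x; rewrite mem_it /= => /andP[x0 xT].
  congr EFin; exact: int_in2.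
Qed.
End AbsolutelyContinuous.

(** * Product rule and Gronwall's inequality *)

Section ACCalculus.
Context {K : realType}.
Local Notation leb := (@lebesgue_measure K).
Implicit Types (t T c : K) (F f G g b h : K -> K).

(** The density is carried along explicitly instead of being recovered by differentiation: the
    drifts contain a control that is only measurable in time, so their primitives need not be
    differentiable everywhere. *)
Definition abscont T F f :=
  integ T f /\
  forall t, 0 <= t <= T -> F t = F 0 + \int[leb]_(s in `[0, t]) f s.

Lemma Rint_0_0 f : \int[leb]_(s in `[0, 0]) f s = 0.
Proof. by rewrite set_itv1 Rintegral_set1. Qed.

Lemma abscont_prim T f : integ T f ->
  abscont T (fun t => \int[leb]_(s in `[0, t]) f s) f.
Proof. by move=> fi; split => // t _; rewrite Rint_0_0 add0r. Qed.

Lemma abscont_cont T F f : 0 <= T -> abscont T F f ->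
  {within `[0, T], continuous F}.
Proof.
move=> T0 [fi FE].
apply: (@subspace_eq_continuous _ _ _ (fun t => F 0 + \int[leb]_(s in `[0, t]) f s)).
  by move=> t; rewrite mem_it => /FE.
move=> t; apply: cvgD; first exact: cvg_cst.
exact: prim_continuous.
Qed.

Lemma abscont_cst T c : abscont T (fun=> c) (fun=> 0).
Proof.
by split; [exact: integ0|move=> t _; rewrite /Rintegral integral0 addr0].
Qed.

Lemma eq_abscont T F f G g : (forall t, 0 <= t <= T -> F t = G t) ->
  (forall t, 0 <= t <= T -> f t = g t) -> 0 <= T -> abscont T F f -> abscont T G g.
Proof.
move=> FG fg T0 [fi FE]; split.
  by apply: eq_integrable fi => // t; rewrite mem_it /= => /fg ->.
move=> t /andP[t0 tT]; rewrite -FG ?t0// -FG ?lexx// FE ?t0//; congr (_ + _).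
apply: eq_Rintegral => s; rewrite mem_it => /andP[s0 st].
by apply: fg; rewrite s0 (le_trans st).
Qed.

Lemma abscontD T F f G g : abscont T F f -> abscont T G g ->
  abscont T (fun t => F t + G t) (fun t => f t + g t).
Proof.
move=> [fi FE] [gi GE]; split; first exact: integD.
move=> t tT; rewrite FE// GE// RintegralD//; last 2 first.
- exact: (integS tT fi).
- exact: (integS tT gi).
ring.
Qed.

Lemma abscont_sum T (I : Type) (s : seq I) (F f : I -> K -> K) :
  (forall i, abscont T (F i) (f i)) ->
  abscont T (fun t => \sum_(i <- s) F i t) (fun t => \sum_(i <- s) f i t).
Proof.
move=> FE; elim: s => [|i s IH].
  by under eq_fun do rewrite big_nil; under [X in abscont _ _ X]eq_fun do
    rewrite big_nil; exact: abscont_cst.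
under eq_fun do rewrite big_cons; under [X in abscont _ _ X]eq_fun do
    rewrite big_cons.
exact: abscontD.
Qed.

(** Writing each factor as its initial value plus a primitive, the initial values produce linear
    terms and the product of the two primitives is [prim_ibp]. *)
Lemma abscontM T F f G g : 0 <= T -> abscont T F f -> abscont T G g ->
  abscont T (fun t => F t * G t) (fun t => f t * G t + F t * g t).
Proof.
move=> T0 aF aG.
have [cF bF] := within_cont_bounded (abscont_cont T0 aF).
have [cG bG] := within_cont_bounded (abscont_cont T0 aG).
have mF := within_cont_measurable (abscont_cont T0 aF).
have mG := within_cont_measurable (abscont_cont T0 aG).
case: aF aG => fi FE [gi GE].
have fGi : integ T (fun t => f t * G t) by exact: (integM_bounded mG bG fi).
have Fgi : integ T (fun t => F t * g t).
  by under eq_fun do rewrite mulrC; exact: (integM_bounded mF bF gi).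
split; first exact: integD.
move=> t tT; have [t0 _] := andP tT.
have fit := integS tT fi; have git := integS tT gi.
have E s : 0 <= s <= t -> f s * G s + F s * g s =
    (G 0 * f s + F 0 * g s) +
    (f s * (\int[leb]_(u in `[0, s]) g u) + g s * (\int[leb]_(u in `[0, s]) f u)).
  move=> /andP[s0 st]; have sT : 0 <= s <= T.
    by rewrite s0 (le_trans st) //; case/andP: tT.
  by rewrite (FE s)// (GE s)//; ring.
have E2 : \int[leb]_(s in `[0, t]) (f s * G s + F s * g s) =
    \int[leb]_(s in `[0, t]) ((G 0 * f s + F 0 * g s) +
    (f s * (\int[leb]_(u in `[0, s]) g u) + g s * (\int[leb]_(u in `[0, s]) f u))).
  by apply: eq_Rintegral => s; rewrite mem_it => /E.
have i1 : integ t (fun s => G 0 * f s + F 0 * g s) by apply: integD; exact: integZ.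
rewrite E2 RintegralD//; last first.
  have : integ t (fun s => (f s * G s + F s * g s) + -1 * (G 0 * f s + F 0 * g s)).
    by apply: integD; [apply: integD; [exact: integS fGi|exact: integS Fgi]|exact: integZ].
  by apply: eq_integrable => // s; rewrite mem_it /= => /E ->; congr EFin; ring.
rewrite -prim_ibp// RintegralD//; [|exact: integZ|exact: integZ].
by rewrite !RintegralZl// FE// GE//; ring.
Qed.

Lemma abscontZ T c F f : 0 <= T -> abscont T F f ->
  abscont T (fun t => c * F t) (fun t => c * f t).
Proof.
move=> T0 aF; apply: eq_abscont (abscontM T0 (abscont_cst T c) aF) => //= t _.
by rewrite mul0r add0r.
Qed.

(** Bridge from classical solutions, whose equation holds on the open interval only, to densities:
    continuity up to the end points lets the fundamental theorem of calculus reach 0 and T. *)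
Lemma abscont_C1 T F f : {within `[0, T], continuous F} ->
  {within `[0, T], continuous f} ->
  (forall t, 0 < t < T -> derivable F t 1) ->
  (forall t, 0 < t < T -> derive1 F t = f t) -> abscont T F f.
Proof.
move=> cF cf dF F'f; split; first exact: within_cont_integ.
move=> t /andP[t0 tT]; have [<-|tn0] := eqVneq 0 t; first by rewrite Rint_0_0 addr0.
have {t0 tn0} t0 : 0 < t by rewrite lt_neqAle tn0.
have sub : `[0, t] `<=` `[0, T] by apply: subset_itvl; rewrite bnd_simp.
have cFt : {within `[0, t], continuous F} by exact: (continuous_subspaceW sub).
rewrite /Rintegral (@continuous_FTC2 K f F 0 t t0)//.
- by rewrite -EFinB /=; ring.
- exact: (continuous_subspaceW sub).
- have [_ l r] := (continuous_within_itvP F t0).1 cFt.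
  split=> // x; rewrite in_itv/= => /andP[x0 xt].
  by apply: dF; rewrite x0 (lt_le_trans xt).
- move=> x; rewrite in_itv/= => /andP[x0 xt].
  by apply: F'f; rewrite x0 (lt_le_trans xt).
Qed.

Lemma abscont_expR T c :
  abscont T (fun t => expR (c * t)) (fun t => c * expR (c * t)).
Proof.
have dE t : is_derive t 1 (fun t : K => expR (c * t)) (c * expR (c * t)).
  have h : is_derive t 1 (fun t : K => c * t) (c * 1).
    by apply: is_deriveZ.
  have := @is_derive1_comp K expR (fun t => c * t) t _ _ (is_derive_expR _) h.
  by rewrite mulr1 mulrC.
have ct : continuous (fun t : K => expR (c * t)).
  move=> t; have [dd _] := dE t.
  by apply: differentiable_continuous; apply/derivable1_diffP.
apply: abscont_C1.
- by apply: continuous_subspaceT.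
- apply: continuous_subspaceT => t.
  by apply: (@cvgM _ K); [exact: cvg_cst|exact: ct].
- by move=> t _; have [] := dE t.
- by move=> t _; rewrite derive1E; have [] := dE t.
Qed.

(** The product rule for the primitive F of f and exp(-c s) replaces differentiation of F, so f may
    be merely integrable. It bounds c F(t) exp(-c t) by a - a exp(-c t); keeping the factor c on the
    left avoids a division and includes c = 0. *)
Lemma gronwall T c a f : 0 <= c -> integ T f ->
  (forall t, 0 <= t <= T -> f t <= a + c * \int[leb]_(s in `[0, t]) f s) ->
  forall t, 0 <= t <= T -> f t <= a * expR (c * t).
Proof.
move=> c0 fi fle t tT; have [t0 _] := andP tT.
have fit := integS tT fi.
pose F t := \int[leb]_(s in `[0, t]) f s.
have aE := abscont_expR t (- c).
have [i1 E1] := abscontM t0 (abscont_prim fit) aE.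
have := E1 t; rewrite t0 lexx Rint_0_0 mul0r add0r => /(_ isT).
have [i2 E2] := abscontZ a t0 aE.
have := E2 t; rewrite t0 lexx mulr0 expR0 mulr1 => /(_ isT).
set e := expR _.
have lec : c * \int[leb]_(s in `[0, t])
    (f s * expR (- c * s) +
     (\int[leb]_(s0 in `[0, s]) f s0) * (- c * expR (- c * s)))
   <= - \int[leb]_(s in `[0, t]) (a * (- c * expR (- c * s))).
  rewrite -RintegralZl// -[leRHS]mulN1r -RintegralZl//.
  apply: le_Rintegral => //; [exact: integZ|exact: integZ|move=> s].
  rewrite /= in_itv/= => /andP[s0 st].
  have := fle s; rewrite s0 (le_trans st) => [/(_ isT)|]; last by case/andP: tT.
  rewrite -/(F s) => fs; have e0 := expR_ge0 (- c * s).
  have := mulr_ge0 (mulr_ge0 c0 e0) (_ : 0 <= a + c * F s - f s).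
  rewrite subr_ge0 => /(_ fs); rewrite -/(F s).
  by set E := expR _; nra.
set X := \int[leb]_(s in `[0, t]) (_ + _) in lec *.
set Y := \int[leb]_(s in `[0, t]) (_ * _) in lec *.
rewrite -/(F t) => aeE FeE.
have : c * (F t * e) <= a - a * e by rewrite FeE; lra.
have eE : expR (c * t) * e = 1 by rewrite -expRD mulNr subrr expR0.
move=> /(ler_wpM2l (expR_ge0 (c * t))).
have -> : expR (c * t) * (c * (F t * e)) = c * F t * (expR (c * t) * e) by ring.
have -> : expR (c * t) * (a - a * e) = a * expR (c * t) - a * (expR (c * t) * e) by ring.
rewrite eE !mulr1 => h; apply: le_trans (fle _ tT) _.
by rewrite -/(F t); lra.
Qed.

(** The primitive of f satisfies the hypothesis of [gronwall] with the constant given by the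
    integral of a over [0, T]. The conclusion is about integrals, the form in which mean-square
    estimates use it. *)
Lemma gronwall_int T c a f : 0 <= T -> 0 <= c -> integ T f -> integ T a ->
  (forall t, 0 <= t <= T -> 0 <= a t) ->
  (forall t, 0 <= t <= T -> f t <= a t + c * \int[leb]_(s in `[0, t]) f s) ->
  \int[leb]_(s in `[0, T]) f s <= expR (c * T) * \int[leb]_(s in `[0, T]) a s.
Proof.
move=> T0 c0 fi ai a0 fle.
have cF := prim_continuous T0 fi.
rewrite [leRHS]mulrC.
apply: (@gronwall T c _ (fun t => \int[leb]_(s in `[0, t]) f s)) => //; last by rewrite T0 lexx.
  exact: within_cont_integ.
move=> t tT; have [t0 tT'] := andP tT.
have ait := integS tT ai; have fit := integS tT fi.
have Fit : integ t (fun u => \int[leb]_(s in `[0, u]) f s).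
  exact: (integS tT (within_cont_integ cF)).
apply: (@le_trans _ _ (\int[leb]_(s in `[0, t])
    (a s + c * \int[leb]_(u in `[0, s]) f u))).
  apply: le_Rintegral => //; first by apply: integD => //; exact: integZ.
  move=> s; rewrite /= in_itv/= => /andP[s0 st].
  by apply: fle; rewrite s0 (le_trans st).
rewrite RintegralD//; last exact: integZ.
rewrite RintegralZl// lerD2r.
rewrite /Rintegral fine_le//.
- exact: integrable_fin_num ait.
- exact: integrable_fin_num ai.
- apply: ge0_subset_integral => //.
  + by case/integrableP : ai.
  + by apply: subset_itvl; rewrite bnd_simp.
Qed.

End ACCalculus.

(** * Euclidean forms and matrix paths *)

(** Once products are expanded, each [M *m v] becomes an atom and the goal is a linear identity that
    holds entry by entry. *)
Ltac mx_abelian :=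
  repeat match goal with |- context [?M *m ?v] => move: (M *m v) => ? end;
  apply/matrixP => ? ?; rewrite !mxE; ring.

Section EuclideanForms.
Context {K : realType}.

Lemma sqnormE k (z : 'cV[K]_k) : sqnorm z = \sum_j z j 0 ^+ 2.
Proof. by rewrite /sqnorm mxE; apply: eq_bigr => j _; rewrite mxE expr2. Qed.

Lemma sqnorm_ge0 k (z : 'cV[K]_k) : 0 <= sqnorm z.
Proof. by rewrite sqnormE; apply: sumr_ge0 => j _; exact: sqr_ge0. Qed.

Lemma sqnorm0 k : sqnorm (0 : 'cV[K]_k) = 0.
Proof. by rewrite /sqnorm mulmx0 mxE. Qed.

Lemma sqnormZ k c (z : 'cV[K]_k) : sqnorm (c *: z) = c ^+ 2 * sqnorm z.
Proof.
by rewrite !sqnormE mulr_sumr; apply: eq_bigr => j _; rewrite mxE exprMn.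
Qed.

Lemma sqnormD_le k (u v : 'cV[K]_k) : sqnorm (u + v) <= 2 * sqnorm u + 2 * sqnorm v.
Proof.
rewrite !sqnormE !mulr_sumr -big_split; apply: ler_sum => j _; rewrite mxE /=.
by have := sqr_ge0 (u j 0 - v j 0); rewrite sqrrB sqrrD !mulr2n; lra.
Qed.

Lemma sqr_coord_le k (z : 'cV[K]_k) j : z j 0 ^+ 2 <= sqnorm z.
Proof.
rewrite sqnormE (bigD1 j)//= lerDl; apply: sumr_ge0 => i _; exact: sqr_ge0.
Qed.

(** The square of the Frobenius norm, used as a root-free bound for the square of the operator
    norm. *)
Definition mxfrob m k (M : 'M[K]_(m, k)) : K := \sum_i \sum_j M i j ^+ 2.

Lemma mxfrob_ge0 m k (M : 'M[K]_(m, k)) : 0 <= mxfrob M.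
Proof. by do 2 (apply: sumr_ge0 => ? _); exact: sqr_ge0. Qed.

(** Lagrange's identity: the difference of the two sides is half the double sum of (a_i b_j - a_j
    b_i)^2. *)
Lemma sum_CS (I : finType) (a b : I -> K) :
  (\sum_i a i * b i) ^+ 2 <= (\sum_i a i ^+ 2) * (\sum_i b i ^+ 2).
Proof.
rewrite -subr_ge0 expr2 !big_distrlr/= -sumrB.
rewrite (_ : \sum_i _ = 2^-1 * \sum_i \sum_j (a i * b j - a j * b i) ^+ 2); last first.
  have E : \sum_i \sum_j (a i * b j - a j * b i) ^+ 2 =
      \sum_i \sum_j (a i ^+ 2 * b j ^+ 2 - (a i * b i) * (a j * b j)) +
      \sum_i \sum_j (a j ^+ 2 * b i ^+ 2 - (a j * b j) * (a i * b i)).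
    rewrite -big_split; apply: eq_bigr => i _; rewrite -big_split.
    by apply: eq_bigr => j _ /=; ring.
  rewrite E [X in _ + X]exchange_big /=; set S := \sum_i \sum_j _.
  have -> : 2^-1 * (S + S) = S by field.
  by apply: eq_bigr => i _; rewrite sumrB.
rewrite mulr_ge0 ?invr_ge0//.
by do 2 (apply: sumr_ge0 => ? _); exact: sqr_ge0.
Qed.

Lemma sqnorm_mulmx m k (M : 'M[K]_(m, k)) (z : 'cV[K]_k) :
  sqnorm (M *m z) <= mxfrob M * sqnorm z.
Proof.
rewrite !sqnormE /mxfrob mulr_suml; apply: ler_sum => i _.
by rewrite mxE; exact: sum_CS.
Qed.

Definition dotv k (u v : 'cV[K]_k) : K := (u^T *m v) 0 0.

Lemma dotvE k (u v : 'cV[K]_k) : dotv u v = \sum_j u j 0 * v j 0.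
Proof. by rewrite /dotv mxE; apply: eq_bigr => j _; rewrite mxE. Qed.

Lemma dotvC k (u v : 'cV[K]_k) : dotv u v = dotv v u.
Proof. by rewrite !dotvE; apply: eq_bigr => j _; rewrite mulrC. Qed.

Lemma dotvDl k (u v w : 'cV[K]_k) : dotv (u + v) w = dotv u w + dotv v w.
Proof. by rewrite /dotv linearD mulmxDl mxE. Qed.

Lemma dotvDr k (u v w : 'cV[K]_k) : dotv w (u + v) = dotv w u + dotv w v.
Proof. by rewrite /dotv mulmxDr mxE. Qed.

Lemma dotvNl k (u w : 'cV[K]_k) : dotv (- u) w = - dotv u w.
Proof. by rewrite /dotv linearN mulNmx mxE. Qed.

Lemma dotvNr k (u w : 'cV[K]_k) : dotv w (- u) = - dotv w u.
Proof. by rewrite dotvC dotvNl dotvC. Qed.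

Lemma dotvBl k (u v w : 'cV[K]_k) : dotv (u - v) w = dotv u w - dotv v w.
Proof. by rewrite dotvDl dotvNl. Qed.

Lemma dotvBr k (u v w : 'cV[K]_k) : dotv w (u - v) = dotv w u - dotv w v.
Proof. by rewrite dotvDr dotvNr. Qed.

Lemma dotvZl k c (u w : 'cV[K]_k) : dotv (c *: u) w = c * dotv u w.
Proof. by rewrite /dotv linearZ /= -scalemxAl mxE. Qed.

Lemma dotvZr k c (u w : 'cV[K]_k) : dotv w (c *: u) = c * dotv w u.
Proof. by rewrite dotvC dotvZl dotvC. Qed.

Lemma dotv_mulmxl m k (M : 'M[K]_(m, k)) u w : dotv (M *m u) w = dotv u (M^T *m w).
Proof. by rewrite /dotv trmx_mul mulmxA. Qed.

Lemma dotv_mulmxr m k (M : 'M[K]_(m, k)) u w : dotv w (M *m u) = dotv (M^T *m w) u.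
Proof. by rewrite dotvC dotv_mulmxl dotvC. Qed.

(** The right side minus the left side is e^-1 |e u + v|^2. *)
Lemma dotv_young k (e : K) (u v : 'cV[K]_k) : 0 < e ->
  - 2 * dotv u v <= e * sqnorm u + e^-1 * sqnorm v.
Proof.
move=> e0; rewrite dotvE !sqnormE !mulr_sumr -big_split; apply: ler_sum => j _ /=.
set a := u j 0; set b := v j 0.
have -> : e * a ^+ 2 + e^-1 * b ^+ 2 = e^-1 * (e * a + b) ^+ 2 + -2 * (a * b).
  by field; rewrite gt_eqF.
by rewrite lerDr mulr_ge0 ?sqr_ge0// invr_ge0 ltW.
Qed.

Lemma wsqnormE k (M : 'M[K]_k) z : wsqnorm M z = dotv z (M *m z).
Proof. by rewrite /wsqnorm /dotv mulmxA. Qed.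

Lemma wsqnormD k (M : 'M[K]_k) u v : mxsym M ->
  wsqnorm M (u + v) = wsqnorm M u + wsqnorm M v + 2 * dotv (M *m u) v.
Proof.
move=> sM; rewrite !wsqnormE mulmxDr !dotvDl !dotvDr.
have -> : dotv u (M *m v) = dotv (M *m u) v by rewrite dotv_mulmxr sM.
by rewrite [dotv v (M *m u)]dotvC; ring.
Qed.

(** The argument of [Rint_CS] for the nonnegative form (t, s) -> |t u + s v|_M^2, with the same test
    points. *)
Lemma psd_CS k (M : 'M[K]_k) u v : mxsym M -> mxpsd M ->
  dotv (M *m u) v ^+ 2 <= wsqnorm M u * wsqnorm M v.
Proof.
move=> sM pM; set a := wsqnorm M u; set b := dotv _ _; set c := wsqnorm M v.
have quad (t s : K) : 0 <= t ^+ 2 * a + 2 * t * s * b + s ^+ 2 * c.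
  have := pM (t *: u + s *: v); rewrite wsqnormD// !wsqnormE -!scalemxAr.
  rewrite !dotvZl !dotvZr -!wsqnormE -/a -/b -/c.
  by congr (_ <= _); ring.
have a0 : 0 <= a := pM u. have c0 : 0 <= c := pM v.
have [az|an] := eqVneq a 0.
  have [bz|bn] := eqVneq b 0; first by rewrite bz expr0n mulr_ge0.
  have /= := quad (- (c + 1) / (2 * b)) 1.
  rewrite az mulr0 add0r !mulr1 expr1n mul1r.
  have -> : 2 * (- (c + 1) / (2 * b)) * b = - (c + 1) by field.
  lra.
have := quad b (- a).
have -> : b ^+ 2 * a + 2 * b * - a * b + (- a) ^+ 2 * c = a * (a * c - b ^+ 2) by ring.
by rewrite pmulr_rge0 ?subr_ge0// lt_neqAle eq_sym an.
Qed.

Lemma posdef_unit k (R : 'M[K]_k) : mxposdef R -> R \in unitmx.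
Proof.
move=> pR; rewrite -row_free_unit -kermx_eq0; apply/rowV0P => v /sub_kermxP vR0.
apply/eqP/negPn/negP => v0.
have : v^T != 0 by rewrite trmx_eq0.
by move=> /pR; rewrite /wsqnorm trmxK vR0 mul0mx mxE ltxx.
Qed.

Lemma posdef_psd k (R : 'M[K]_k) : mxposdef R -> mxpsd R.
Proof.
move=> pR z; have [->|/pR/ltW//] := eqVneq z 0.
by rewrite /wsqnorm mulmx0 mxE.
Qed.

(* Cauchy-Schwarz for the form of [R], tested against the columns of its inverse *)
Lemma posdef_coercive k (R : 'M[K]_k) : mxsym R -> mxposdef R ->
  exists2 c : K, 0 < c & forall z, c * sqnorm z <= wsqnorm R z.
Proof.
move=> sR pR; have uR := posdef_unit pR; have psR := posdef_psd pR.
(* This sum is the trace of [invmx R]. The 1 added to it keeps the constant well defined in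
   dimension 0 as well. *)
pose b : K := \sum_j wsqnorm R (invmx R *m delta_mx j 0).
have b0 : 0 <= b by apply: sumr_ge0 => j _; exact: psR.
exists (b + 1)^-1 => [|z]; first by rewrite invr_gt0 ltr_wpDl.
rewrite ler_pdivrMl ?ltr_wpDl//.
have Hz : sqnorm z <= b * wsqnorm R z.
  rewrite sqnormE /b mulr_suml; apply: ler_sum => j _.
  have -> : z j 0 = dotv (R *m (invmx R *m delta_mx j 0)) z.
    rewrite mulmxA mulmxV// mul1mx dotvE (bigD1 j)//= mxE !eqxx mul1r.
    rewrite big1 ?addr0// => i ij; rewrite mxE (negbTE ij) mul0r//.
  exact: psd_CS.
by rewrite mulrDl mul1r (le_trans Hz)// lerDl; exact: psR.
Qed.

End EuclideanForms.

(** * Continuous and absolutely continuous matrix-valued paths *)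

Section MatrixPaths.
Context {K : realType}.
Local Notation leb := (@lebesgue_measure K).
Variable T : K.
Hypothesis T0 : 0 <= T.

Definition mxcont m k (M : K -> 'M[K]_(m, k)) :=
  forall i j, {within `[0, T], continuous (fun t => M t i j)}.

Lemma eq_within_cont (g f : K -> K) : f =1 g ->
  {within `[0, T], continuous f} -> {within `[0, T], continuous g}.
Proof. by move=> /funext ->. Qed.

Lemma mxcont_within m k (M : K -> 'M[K]_(m, k)) :
  {within `[0, T], continuous M} -> mxcont M.
Proof.
move=> cM i j t; have := @coord_continuous K m k i j (M t).
exact: (cvg_comp M (fun X : 'M[K]_(m, k) => X i j) (cM t)).
Qed.

Lemma mxcont_cst m k (M : 'M[K]_(m, k)) : mxcont (fun=> M).
Proof. by move=> i j; apply: continuous_subspaceT => t; exact: cvg_cst. Qed.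

Lemma mxcontD m k (M N : K -> 'M[K]_(m, k)) :
  mxcont M -> mxcont N -> mxcont (fun t => M t + N t).
Proof.
move=> cM cN i j; apply: (eq_within_cont (f := fun t => M t i j + N t i j)).
  by move=> t; rewrite mxE.
by move=> t; apply: cvgD; [exact: cM|exact: cN].
Qed.

Lemma mxcontN m k (M : K -> 'M[K]_(m, k)) : mxcont M -> mxcont (fun t => - M t).
Proof.
move=> cM i j; apply: (eq_within_cont (f := fun t => - M t i j)).
  by move=> t; rewrite mxE.
by move=> t; apply: cvgN; exact: cM.
Qed.

Lemma mxcontB m k (M N : K -> 'M[K]_(m, k)) :
  mxcont M -> mxcont N -> mxcont (fun t => M t - N t).
Proof. by move=> cM cN; apply: mxcontD => //; exact: mxcontN. Qed.

Lemma mxcontZ m k (c : K -> K) (M : K -> 'M[K]_(m, k)) :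
  {within `[0, T], continuous c} -> mxcont M -> mxcont (fun t => c t *: M t).
Proof.
move=> cc cM i j; apply: (eq_within_cont (f := fun t => c t * M t i j)).
  by move=> t; rewrite mxE.
by move=> t; apply: (@cvgM K); [exact: cc|exact: cM].
Qed.

Lemma within_cont_sum (I : Type) (s : seq I) (F : I -> K -> K) :
  (forall i, {within `[0, T], continuous (F i)}) ->
  {within `[0, T], continuous (fun t => \sum_(i <- s) F i t)}.
Proof.
move=> cF; elim: s => [|i s IH].
  apply: (eq_within_cont (f := fun=> 0)); first by move=> t; rewrite big_nil.
  by apply: continuous_subspaceT => t; exact: cvg_cst.
apply: (eq_within_cont (f := fun t => F i t + \sum_(i <- s) F i t)).
  by move=> t; rewrite big_cons.
by move=> t; apply: cvgD; [exact: cF|exact: IH].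
Qed.

Lemma mxcontM m k l (M : K -> 'M[K]_(m, k)) (N : K -> 'M[K]_(k, l)) :
  mxcont M -> mxcont N -> mxcont (fun t => M t *m N t).
Proof.
move=> cM cN i j; apply: (eq_within_cont (f := fun t => \sum_q M t i q * N t q j)).
  by move=> t; rewrite mxE.
apply: within_cont_sum => q t.
by apply: (@cvgM K); [exact: cM|exact: cN].
Qed.

Lemma mxcont_frob_bounded m k (M : K -> 'M[K]_(m, k)) : mxcont M ->
  exists2 c, 0 <= c & forall t, 0 <= t <= T -> mxfrob (M t) <= c.
Proof.
move=> cM; have : {within `[0, T], continuous (fun t => mxfrob (M t))}.
  apply: within_cont_sum => i; apply: within_cont_sum => j.
  apply: (eq_within_cont (f := fun t => M t i j * M t i j)) => //.
  by move=> t; apply: (@cvgM K); exact: cM.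
move=> /within_cont_bounded[c Hc]; exists `|c| => // t tT.
by rewrite (le_trans (ler_norm _))// (le_trans (Hc _ tT))// ler_norm.
Qed.

Definition mxabscont m k (F F' : K -> 'M[K]_(m, k)) :=
  forall i j, abscont T (fun t => F t i j) (fun t => F' t i j).

Lemma mxabscontD m k (F F' G G' : K -> 'M[K]_(m, k)) :
  mxabscont F F' -> mxabscont G G' ->
  mxabscont (fun t => F t + G t) (fun t => F' t + G' t).
Proof.
move=> aF aG i j; under eq_fun do rewrite mxE.
by under [X in abscont _ _ X]eq_fun do rewrite mxE; exact: abscontD.
Qed.

Lemma mxabscontZ m k (c c' : K -> K) (F F' : K -> 'M[K]_(m, k)) :
  abscont T c c' -> mxabscont F F' ->
  mxabscont (fun t => c t *: F t) (fun t => c' t *: F t + c t *: F' t).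
Proof.
move=> ac aF i j; under eq_fun do rewrite mxE.
by under [X in abscont _ _ X]eq_fun do rewrite !mxE; exact: abscontM.
Qed.

Lemma mxabscontN m k (F F' : K -> 'M[K]_(m, k)) :
  mxabscont F F' -> mxabscont (fun t => - F t) (fun t => - F' t).
Proof.
move=> aF i j; under eq_fun do rewrite mxE -mulN1r.
by under [X in abscont _ _ X]eq_fun do rewrite mxE -mulN1r; exact: abscontZ.
Qed.

Lemma mxabscontM m k l (F F' : K -> 'M[K]_(m, k)) (G G' : K -> 'M[K]_(k, l)) :
  mxabscont F F' -> mxabscont G G' ->
  mxabscont (fun t => F t *m G t) (fun t => F' t *m G t + F t *m G' t).
Proof.
move=> aF aG i j; under eq_fun do rewrite mxE.
under [X in abscont _ _ X]eq_fun do rewrite !mxE -big_split.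
by apply: abscont_sum => q; exact: abscontM.
Qed.

Lemma mxabscont_trmx m k (F F' : K -> 'M[K]_(m, k)) :
  mxabscont F F' -> mxabscont (fun t => (F t)^T) (fun t => (F' t)^T).
Proof.
move=> aF i j; under eq_fun do rewrite mxE.
by under [X in abscont _ _ X]eq_fun do rewrite mxE; exact: aF.
Qed.

Lemma eq_mxabscont m k (F F' G G' : K -> 'M[K]_(m, k)) :
  (forall t, 0 <= t <= T -> F t = G t) ->
  (forall t, 0 <= t <= T -> F' t = G' t) -> mxabscont F F' -> mxabscont G G'.
Proof.
move=> FG FG' aF i j; apply: eq_abscont (aF i j) => // t tT.
  by rewrite FG.
by rewrite FG'.
Qed.

Lemma mxabscont_ode m k (F F' : K -> 'M[K]_(m, k)) :
  ode_regular T F -> mxcont F' -> (forall t, 0 < t < T -> derive1 F t = F' t) ->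
  mxabscont F F'.
Proof.
move=> [cF dF] cF' FF' i j; apply: abscont_C1.
- exact: mxcont_within.
- exact: cF'.
- by move=> t /dF /derivable_mxP.
- move=> t tT; rewrite derive1E -FF'// derive1E derive_mx ?mxE//.
  exact: dF.
Qed.

Lemma time_integral_prim k (b : K -> 'cV[K]_k) :
  (forall j, integ T (fun t => b t j 0)) -> mxabscont (time_integral b) b.
Proof.
move=> bi i j; rewrite ord1; under eq_fun do rewrite mxE.
exact: abscont_prim.
Qed.

Lemma time_integral0 k (b : K -> 'cV[K]_k) : time_integral b 0 = 0.
Proof. by apply/matrixP => i j; rewrite !mxE Rint_0_0. Qed.

End MatrixPaths.

(** * Volterra equations *)

Section PathEstimates.
Context {K : realType}.
Local Notation leb := (@lebesgue_measure K).
Variable T : K.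
Hypothesis T0 : 0 <= T.
Let mIT : measurable ([set` `[0, T]] : set (measurableTypeR K)).
Proof. exact: measurable_itv. Qed.

Definition sqpath k (b : K -> 'cV[K]_k) :=
  forall j, sqint leb `[0, T] (fun t => b t j 0).

Lemma sqint_cst_itv (c : K) : sqint leb `[0, T] (fun=> c).
Proof.
split; first exact: measurable_cst.
by have := integrable_lty mIT (integ_cst T (c ^+ 2)).
Qed.

Lemma sqpath_integ k (b : K -> 'cV[K]_k) j : sqpath b -> integ T (fun t => b t j 0).
Proof.
move=> sb; have := sqintM mIT (sb j) (sqint_cst_itv 1).
by apply: eq_integrable => // t _ /=; rewrite mulr1.
Qed.

Lemma integ_sum (I : Type) (s : seq I) u (F : I -> K -> K) :
  (forall i, integ u (F i)) -> integ u (fun t => \sum_(i <- s) F i t).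
Proof.
move=> Fi; elim: s => [|i s IH].
  by under eq_fun do rewrite big_nil; exact: integ0.
by under eq_fun do rewrite big_cons; exact: integD.
Qed.

Lemma sqpath_sqnorm k (b : K -> 'cV[K]_k) : sqpath b -> integ T (fun t => sqnorm (b t)).
Proof.
move=> sb; under eq_fun do rewrite sqnormE.
by apply: integ_sum => j; exact: (sqint_integrable2 (sb j)).
Qed.

Lemma sqpathD k (a b : K -> 'cV[K]_k) : sqpath a -> sqpath b ->
  sqpath (fun t => a t + b t).
Proof.
move=> sa sb j; apply: eq_sqint (sqintD mIT (sa j) (sb j)) => t _.
by rewrite mxE.
Qed.

Lemma sqpath_mulmx m k (M : K -> 'M[K]_(m, k)) b : mxcont T M -> sqpath b ->
  sqpath (fun t => M t *m b t).
Proof.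
move=> cM sb j.
suff sM : forall i, sqint leb `[0, T] (fun t => M t j i * b t i 0).
  apply: eq_sqint (sqint_sum mIT (index_enum _) sM) => t _.
  by rewrite mxE.
move=> i.
have [c Hc] := within_cont_bounded (cM j i).
apply: (@sqintM_bounded _ _ _ leb _ mIT c) => //.
  exact: within_cont_measurable.
Qed.

(** Cauchy-Schwarz in time against the constant 1, whose square integrates to t <= T. *)
Lemma sqnorm_time_integral k (b : K -> 'cV[K]_k) t : 0 <= t <= T -> sqpath b ->
  sqnorm (time_integral b t) <= T * \int[leb]_(s in `[0, t]) sqnorm (b s).
Proof.
move=> tT sb; have [t0 tT'] := andP tT.
have mIt : measurable ([set` `[0, t]] : set (measurableTypeR K)) by exact: measurable_itv.
have sbt j : sqint leb `[0, t] (fun t => b t j 0).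
  apply: sqint_of_integrable2.
    exact: (integ_measurable (integS tT (sqpath_integ j sb))).
  exact: (integS tT (sqint_integrable2 (sb j))).
have s1 : sqint leb `[0, t] (fun=> 1).
  split; first exact: measurable_cst.
  by have := integrable_lty mIt (integ_cst t (1 ^+ 2)).
under eq_Rintegral do rewrite sqnormE.
rewrite sqnormE (Rint_sum mIt); last first.
  by move=> j; exact: (sqint_integrable2 (sbt j)).
rewrite mulr_sumr; apply: ler_sum => j _; rewrite mxE.
have := Rint_CS mIt (sbt j) s1.
under eq_Rintegral do rewrite mulr1.
move=> /le_trans; apply; rewrite mulrC ler_wpM2r//.
  by apply: Rintegral_ge0 => s _; exact: sqr_ge0.
rewrite Rintegral_cst// expr1n mul1r /=.
by rewrite lebesgue_measure_itv /= lte_fin; case: ifP => _ //=; rewrite oppr0 addr0.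
Qed.

(** From y = a + int (M y + b) one gets |y|^2 <= 2 |a|^2 + 4 T c int |y|^2 + 4 T int |b|^2, where c
    bounds the squared norm of M. Gronwall over [0, T] yields the exponential, and integrating the
    source yields 2 and 4 T T, which are merged into one factor. *)
Definition volterra_const (c : K) := expR (4 * T * c * T) * (2 + 4 * T * T).

Lemma volterra_const_ge0 c : 0 <= volterra_const c.
Proof. by rewrite mulr_ge0 ?expR_ge0// addr_ge0// !mulr_ge0. Qed.

Lemma volterra_path k (c : K) (M : K -> 'M[K]_k) (y a b : K -> 'cV[K]_k) :
  mxcont T M -> 0 <= c -> (forall t, 0 <= t <= T -> mxfrob (M t) <= c) ->
  sqpath y -> sqpath a -> sqpath b ->
  (forall t, 0 <= t <= T ->
     y t = a t + time_integral (fun s => M s *m y s + b s) t) ->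
  \int[leb]_(t in `[0, T]) sqnorm (y t) <=
    volterra_const c * (\int[leb]_(t in `[0, T]) sqnorm (a t) +
         \int[leb]_(t in `[0, T]) sqnorm (b t)).
Proof.
move=> cM c0 Mc sy sa sb yE.
have sg : sqpath (fun s => M s *m y s + b s).
  by apply: sqpathD => //; exact: sqpath_mulmx.
have iy := sqpath_sqnorm sy; have ia := sqpath_sqnorm sa.
have ib := sqpath_sqnorm sb; have ig := sqpath_sqnorm sg.
set Na := \int[leb]_(t in `[0, T]) sqnorm (a t).
set Nb := \int[leb]_(t in `[0, T]) sqnorm (b t).
have Na0 : 0 <= Na by apply: Rintegral_ge0 => t _; exact: sqnorm_ge0.
have Nb0 : 0 <= Nb by apply: Rintegral_ge0 => t _; exact: sqnorm_ge0.
have := @gronwall_int K T (4 * T * c) (fun t => 2 * sqnorm (a t) + 4 * T * Nb)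
  (fun t => sqnorm (y t)) T0.
move=> /(_ _ iy) H; apply: le_trans (H _ _ _ _) _.
- by rewrite !mulr_ge0.
- by apply: integD; [exact: integZ|exact: integ_cst].
- by move=> t _; rewrite addr_ge0// !mulr_ge0// sqnorm_ge0.
- move=> t tT; have [t0 tT'] := andP tT; rewrite {1}yE//.
  apply: le_trans (sqnormD_le _ _) _.
  have Ht := sqnorm_time_integral tT sg.
  have Hg : \int[leb]_(s in `[0, t]) sqnorm (M s *m y s + b s) <=
      2 * c * (\int[leb]_(s in `[0, t]) sqnorm (y s)) + 2 * Nb.
    apply: (@le_trans _ _ (\int[leb]_(s in `[0, t]) (2 * c * sqnorm (y s) + 2 * sqnorm (b s)))).
      apply: le_Rintegral => //; first exact: (integS tT ig).
        apply: integD; apply: integZ; [exact: (integS tT iy)|exact: (integS tT ib)].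
      move=> s; rewrite /= in_itv/= => /andP[s0 st].
      rewrite (le_trans (sqnormD_le _ _))// lerD2r -mulrA ler_wpM2l//.
      rewrite (le_trans (sqnorm_mulmx _ _))// ler_wpM2r ?sqnorm_ge0//.
      by apply: Mc; rewrite s0 (le_trans st).
    have iyt := integS tT iy; have ibt := integS tT ib.
    rewrite RintegralD//; [|exact: integZ|exact: integZ].
    rewrite !RintegralZl// lerD2l ler_wpM2l//.
    rewrite /Nb /Rintegral fine_le//.
    + exact: integrable_fin_num ibt.
    + exact: integrable_fin_num ib.
    + apply: ge0_subset_integral => //.
      * by case/integrableP : ib.
      * by move=> s _; rewrite lee_fin sqnorm_ge0.
      * by apply: subset_itvl; rewrite bnd_simp.
  have : 2 * sqnorm (time_integral (fun s => M s *m y s + b s) t) <=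
      2 * (T * (2 * c * (\int[leb]_(s in `[0, t]) sqnorm (y s)) + 2 * Nb)).
    rewrite ler_wpM2l// (le_trans Ht)// ler_wpM2l//.
  by move=> h; rewrite -addrA lerD2l (le_trans h)//; lra.
- rewrite /volterra_const -[leRHS]mulrA ler_wpM2l ?expR_ge0//.
  rewrite RintegralD//; [|exact: integZ|exact: integ_cst].
  rewrite RintegralZl// Rintegral_cst// -/Na /=.
  rewrite lebesgue_measure_itv /= lte_fin.
  have -> : fine (if (0 < T)%R then T%:E - 0%:E else 0)%E = T.
    by rewrite -EFinB subr0; case: ltgtP T0.
  have TT : 0 <= T * T by exact: mulr_ge0.
  by have := mulr_ge0 TT Na0; have := mulr_ge0 TT Nb0; nra.
Qed.

End PathEstimates.

(** * Square-integrable processes on [0, T] x Omega *)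

Section Processes.
Context {d : measure_display} {Omega : measurableType d} {K : realType}.
Variables (Pr : probability Omega K) (T : K).
Hypothesis T0 : 0 <= T.
Local Notation leb := (@lebesgue_measure K).
Local Notation IT := ([set` `[0, T]] : set (measurableTypeR K)).
Local Notation ET := (IT `*` [set: Omega]).
Local Notation tw := (leb \x Pr)%E.
Local Notation process k := (K -> Omega -> 'cV[K]_k).

Let mIT : measurable IT. Proof. exact: measurable_itv. Qed.
Let mET : measurable ET. Proof. exact: measurableX. Qed.

Lemma measurable_slice_time (f : measurableTypeR K * Omega -> K) w :
  measurable_fun ET f -> measurable_fun IT (fun t => f (t, w)).
Proof.
move=> mf; apply: (measurable_comp (F := ET)) => //.
  by move=> _ [t ? <-].
exact: measurable_funTS.
Qed.

Lemma measurable_slice_omega (f : measurableTypeR K * Omega -> K) t :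
  IT t -> measurable_fun ET f -> measurable_fun setT (fun w => f (t, w)).
Proof.
move=> tT mf; apply: (measurable_comp (F := ET)) => //.
by move=> _ [w ? <-].
Qed.

Lemma tw_finite : (tw ET < +oo)%E.
Proof.
rewrite product_measure1E// [X in (_ * X)%E](_ : _ = 1%E); last exact: probability_setT.
rewrite mule1 /=.
by rewrite lebesgue_measure_itv /=; case: ifP => _; rewrite ?ltry// -EFinB ltry.
Qed.

Lemma tw_integrable_cst c : tw.-integrable ET (EFin \o (fun=> c)).
Proof.
apply: (@measurable_bounded_integrable _ _ _ tw) => //; first exact: tw_finite.
exists `|c|; split; first exact: num_real.
by move=> M cM s _ /=; rewrite ltW.
Qed.

(** The variable upper limit becomes an indicator in a third coordinate, so that the primitive is an
    integral over the fixed interval [0, T] and Tonelli gives its measurability, separately for the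
    positive and the negative part. *)
Lemma prim_jointly_measurable (g : measurableTypeR K * Omega -> K) :
  measurable_fun ET g ->
  measurable_fun ET (fun p => \int[leb]_(s in `[0, p.1]) g (s, p.2)).
Proof.
move=> mg.
pose G (z : measurableTypeR K * Omega * measurableTypeR K) : K :=
  g (z.2, z.1.2) * (if z.2 <= z.1.1 then 1 else 0).
have mG : measurable_fun (ET `*` IT) G.
  apply: measurable_funM.
    apply: (measurable_comp (F := ET)) => //.
    - by move=> _ [[[t w] s] [_ ?] <-].
    - apply: measurable_funTS.
      apply: measurable_fun_pair; first exact: measurable_snd.
      by apply: measurableT_comp; [exact: measurable_snd|exact: measurable_fst].
  apply: measurable_funTS.
  have mle : measurable_fun setT
      (fun z : measurableTypeR K * Omega * measurableTypeR K => z.2 <= z.1.1).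
    apply: measurable_fun_ler; first exact: measurable_snd.
    by apply: measurableT_comp; [exact: measurable_fst|exact: measurable_fst].
  exact: measurable_fun_ifT.
have mGe : measurable_fun (ET `*` IT) (EFin \o G) by exact/measurable_EFinP.
have mp := @measurable_tonelli_rect1 _ _ _ _ K leb ET IT mET mIT _
  (measurable_funepos mGe) (fun z _ => funepos_ge0 _ z).
have mn := @measurable_tonelli_rect1 _ _ _ _ K leb ET IT mET mIT _
  (measurable_funeneg mGe) (fun z _ => funeneg_ge0 _ z).
have mpn := emeasurable_funB mp mn.
have := measurableT_comp (@fine_measurable K setT measurableT) mpn.
apply: eq_measurable_fun => -[t w] /set_mem [/= tT _].
rewrite /Rintegral /=; congr fine.
transitivity (\int[leb]_(s in IT) (G (t, w, s))%:E)%E.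
  rewrite [RHS]integralE; congr (_ - _)%E; apply: eq_integral => s _.
    by rewrite !funeposE.
  by rewrite !funenegE.
move: tT; rewrite /= in_itv/= => /andP[t0 tT].
have -> : [set` `[0, t]] = IT `&` [set` `[0, t]].
  by apply/esym/setIidPr/subset_itvl; rewrite bnd_simp.
rewrite [RHS]integral_mkcondr; apply: eq_integral => s.
rewrite mem_it => /andP[s0 sT]; rewrite patchE /G /= mem_it s0 /=.
by case: (_ <= _); rewrite ?mulr1 ?mulr0.
Qed.

Definition sqproc k (X : process k) :=
  forall j, sqint tw ET (fun p => X p.1 p.2 j 0).

(** Despite its name this is the square of the L^2(dt x dPr) norm. *)
Definition pnorm k (X : process k) : K :=
  \int[tw]_(p in ET) sqnorm (X p.1 p.2).

Lemma sqproc_sqnorm k (X : process k) : sqproc X ->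
  tw.-integrable ET (EFin \o (fun p => sqnorm (X p.1 p.2))).
Proof.
move=> sX; rewrite (_ : _ \o _ = (fun p => \sum_j (X p.1 p.2 j 0 ^+ 2)%:E)%E); last first.
  by apply/funext => p /=; rewrite sqnormE sumEFin.
by apply: integrable_sum => // j _; exact: sqint_integrable2 (sX j).
Qed.

Lemma sqnorm_measurable k (X : process k) : measurable_process T X ->
  measurable_fun ET (fun p => sqnorm (X p.1 p.2)).
Proof.
move=> mX; rewrite (_ : (fun p => _) = (fun p => \sum_j (X p.1 p.2 j 0 ^+ 2))); last first.
  by apply/funext => p; rewrite sqnormE.
by apply: measurable_sum => j; apply: measurable_funX; exact: mX.
Qed.

Lemma sqproc_measurable k (X : process k) : sqproc X -> measurable_process T X.
Proof. by move=> sX j; case: (sX j). Qed.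

Lemma sqprocP k (X : process k) : measurable_process T X ->
  (\int[Pr]_w \int[leb]_(t in IT) (sqnorm (X t w))%:E < +oo)%E -> sqproc X.
Proof.
move=> mX fX j; split; first exact: mX.
apply: le_lt_trans fX.
have mS := sqnorm_measurable mX.
rewrite -(@tonelli_rect2 _ _ _ _ _ leb Pr IT setT mIT _ (fun p => (sqnorm (X p.1 p.2))%:E))//; last 2 first.
- exact/measurable_EFinP.
- by move=> p _; rewrite lee_fin sqnorm_ge0.
apply: ge0_le_integral => //.
- by move=> p _; rewrite lee_fin sqr_ge0.
- by apply/measurable_EFinP/measurable_funX; exact: mX.
- exact/measurable_EFinP.
- by move=> p _; rewrite lee_fin sqr_coord_le.
Qed.

Lemma pnorm_ge0 k (X : process k) : 0 <= pnorm X.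
Proof. by apply: Rintegral_ge0 => p _; exact: sqnorm_ge0. Qed.

Lemma pnormE k (X : process k) : sqproc X ->
  ((pnorm X)%:E = \int[Pr]_w \int[leb]_(t in IT) (sqnorm (X t w))%:E)%E.
Proof.
move=> sX; rewrite -(@tonelli_rect2 _ _ _ _ _ leb Pr IT setT mIT _ (fun p => (sqnorm (X p.1 p.2))%:E))//; last 2 first.
- apply/measurable_EFinP; exact: sqnorm_measurable (sqproc_measurable sX).
- by move=> p _; rewrite lee_fin sqnorm_ge0.
by rewrite /pnorm /Rintegral fineK//; exact: integrable_fin_num (sqproc_sqnorm sX).
Qed.

Lemma ae_sqpath k (X : process k) : sqproc X ->
  {ae Pr, forall w, sqpath T (fun t => X t w)}.
Proof.
move=> sX.
have : {ae Pr, forall w, setT w -> leb.-integrable IT (EFin \o (fun t => sqnorm (X t w)))}.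
  exact: (ae_integrable_rect2 mIT measurableT (sqproc_sqnorm sX)).
apply: filterS => w /(_ Logic.I) iw j; split.
  exact: (measurable_slice_time w (sqproc_measurable sX j)).
have := integrable_lty mIT iw; apply: le_lt_trans.
apply: ge0_le_integral => //.
- by move=> p _; rewrite lee_fin sqr_ge0.
- apply/measurable_EFinP/measurable_funX.
  exact: (measurable_slice_time w (sqproc_measurable sX j)).
- exact: measurable_int iw.
- by move=> p _; rewrite lee_fin sqr_coord_le.
Qed.

Definition sqvec k (X : Omega -> 'cV[K]_k) :=
  forall j, sqint Pr setT (fun w => X w j 0).

(** Square integrability on the product controls the values only at almost every time; this is the
    source of the almost-everywhere quantifiers over time in the orthogonality statements below. *)
Lemma ae_sqvec k (X : process k) : sqproc X ->
  {ae leb, forall t, IT t -> sqvec (X t)}.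
Proof.
move=> sX.
have : {ae leb, forall t, IT t -> Pr.-integrable setT (EFin \o (fun w => sqnorm (X t w)))}.
  exact: (ae_integrable_rect1 mIT measurableT (sqproc_sqnorm sX)).
apply: filterS => t it tT j; have {}it := it tT; split.
  exact: (measurable_slice_omega tT (sqproc_measurable sX j)).
have := integrable_lty measurableT it; apply: le_lt_trans.
apply: ge0_le_integral => //.
- by move=> p _; rewrite lee_fin sqr_ge0.
- apply/measurable_EFinP/measurable_funX.
  exact: (measurable_slice_omega tT (sqproc_measurable sX j)).
- exact: measurable_int it.
- by move=> p _; rewrite lee_fin sqr_coord_le.
Qed.

Lemma sqprocD k (X Y : process k) : sqproc X -> sqproc Y ->
  sqproc (fun t w => X t w + Y t w).
Proof.
move=> sX sY j; apply: eq_sqint (sqintD mET (sX j) (sY j)) => p _.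
by rewrite mxE.
Qed.

Lemma sqprocN k (X : process k) : sqproc X -> sqproc (fun t w => - X t w).
Proof.
by move=> sX j; apply: eq_sqint (sqintN mET (sX j)) => p _; rewrite mxE.
Qed.

Lemma sqprocB k (X Y : process k) : sqproc X -> sqproc Y ->
  sqproc (fun t w => X t w - Y t w).
Proof. by move=> sX sY; apply: sqprocD => //; exact: sqprocN. Qed.

Lemma sqprocZ k c (X : process k) : sqproc X -> sqproc (fun t w => c *: X t w).
Proof.
by move=> sX j; apply: eq_sqint (sqintZ mET c (sX j)) => p _; rewrite mxE.
Qed.

Lemma sqproc_mulmx m k (M : K -> 'M[K]_(m, k)) (X : process k) : mxcont T M ->
  sqproc X -> sqproc (fun t w => M t *m X t w).
Proof.
move=> cM sX j.
suff sM : forall i, sqint tw ET (fun p => M p.1 j i * X p.1 p.2 i 0).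
  apply: eq_sqint (sqint_sum mET (index_enum _) sM) => p _.
  by rewrite mxE.
move=> i; have [c Hc] := within_cont_bounded (cM j i).
apply: (@sqintM_bounded _ _ _ tw _ mET c) => //.
- apply: (measurable_rect_fst (f := fun t => M t j i)) => //.
  exact: within_cont_measurable.
- by move=> [t w] [/=]; rewrite in_itv/= => tT _; exact: Hc.
Qed.

Lemma sqproc_det k (f : K -> 'cV[K]_k) : mxcont T f -> sqproc (fun t _ => f t).
Proof.
move=> cf j; have [c Hc] := within_cont_bounded (cf j 0).
have s1 : sqint tw ET (fun=> 1).
  split; first exact: measurable_cst.
  by have := integrable_lty mET (tw_integrable_cst (1 ^+ 2)).
have := @sqintM_bounded _ _ _ tw _ mET c (fun p => f p.1 j 0) (fun=> 1).
move=> H; apply: eq_sqint (H _ _ s1) => [p _| |].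
- by rewrite mulr1.
- apply: (measurable_rect_fst (f := fun t => f t j 0)) => //.
  exact: within_cont_measurable.
- by move=> [t w] [/=]; rewrite in_itv/= => tT _; exact: Hc.
Qed.

Lemma pnormD_le k (X Y : process k) : sqproc X -> sqproc Y ->
  pnorm (fun t w => X t w + Y t w) <= 2 * pnorm X + 2 * pnorm Y.
Proof.
move=> sX sY; have iX := sqproc_sqnorm sX; have iY := sqproc_sqnorm sY.
have iZ (c : K) (g : measurableTypeR K * Omega -> K) : tw.-integrable ET (EFin \o g) ->
    tw.-integrable ET (EFin \o (fun p => c * g p)).
  by move=> ig; under [EFin \o _]eq_fun do rewrite /= EFinM; exact: integrableZl.
rewrite /pnorm -!RintegralZl// -RintegralD//; [|exact: iZ|exact: iZ].
apply: le_Rintegral => //.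
- exact: (sqproc_sqnorm (sqprocD sX sY)).
- by under [EFin \o _]eq_fun do rewrite /= EFinD; apply: integrableD => //; exact: iZ.
- by move=> p _; exact: sqnormD_le.
Qed.

Lemma pnormZ k c (X : process k) : sqproc X ->
  pnorm (fun t w => c *: X t w) = c ^+ 2 * pnorm X.
Proof.
move=> sX; rewrite /pnorm -RintegralZl//; last exact: sqproc_sqnorm.
by apply: eq_Rintegral => p _; rewrite sqnormZ.
Qed.

Lemma pnorm_mulmx_le m k c (M : K -> 'M[K]_(m, k)) (X : process k) : mxcont T M ->
  (forall t, 0 <= t <= T -> mxfrob (M t) <= c) -> sqproc X ->
  pnorm (fun t w => M t *m X t w) <= c * pnorm X.
Proof.
move=> cM Mc sX; rewrite /pnorm -RintegralZl//; last exact: sqproc_sqnorm.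
apply: le_Rintegral => //.
- exact: (sqproc_sqnorm (sqproc_mulmx cM sX)).
- under [EFin \o _]eq_fun do rewrite /= EFinM.
  by apply: integrableZl => //; exact: sqproc_sqnorm.
- move=> [t w] [/=]; rewrite in_itv/= => tT _.
  by rewrite (le_trans (sqnorm_mulmx _ _))// ler_wpM2r ?sqnorm_ge0// Mc.
Qed.

End Processes.

(** * Volterra equations with random data *)

Section VolterraProcesses.
Context {d : measure_display} {Omega : measurableType d} {K : realType}.
Variables (Pr : probability Omega K) (T : K).
Hypothesis T0 : 0 <= T.
Local Notation leb := (@lebesgue_measure K).
Local Notation IT := ([set` `[0, T]] : set (measurableTypeR K)).
Local Notation ET := (IT `*` [set: Omega]).
Local Notation tw := (leb \x Pr)%E.
Local Notation process k := (K -> Omega -> 'cV[K]_k).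
Local Notation sqproc := (sqproc Pr T).
Local Notation pnorm := (pnorm Pr T).
Local Notation sqvec := (sqvec Pr).

Let mIT : measurable IT. Proof. exact: measurable_itv. Qed.
Let mET : measurable ET. Proof. exact: measurableX. Qed.

Lemma measurable_time_integral k (b : process k) : measurable_process T b ->
  measurable_process T (fun t w => time_integral (fun s => b s w) t).
Proof.
move=> mb j; have := prim_jointly_measurable (mb j).
by apply: eq_measurable_fun => p _; rewrite mxE.
Qed.

Lemma measurable_int_sqnorm k (X : process k) : measurable_process T X ->
  measurable_fun setT (fun w => \int[leb]_(t in IT) (sqnorm (X t w))%:E)%E.
Proof.
move=> mX.
apply: (@measurable_tonelli_rect2 _ _ _ _ _ leb IT setT mIT measurableT
  (fun p => (sqnorm (X p.1 p.2))%:E)).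
- by apply/measurable_EFinP; exact: sqnorm_measurable.
- by move=> p _; rewrite lee_fin sqnorm_ge0.
Qed.

Lemma sqpath_int_sqnorm k (b : K -> 'cV[K]_k) : sqpath T b ->
  (\int[leb]_(t in IT) (sqnorm (b t))%:E = (\int[leb]_(t in IT) sqnorm (b t))%R%:E)%E.
Proof.
move=> sb; rewrite /Rintegral fineK//.
exact: (integrable_fin_num mIT (sqpath_sqnorm sb)).
Qed.

(** Finiteness over Omega is a conclusion: [y] is only assumed to have square-integrable paths
    almost surely. The constant in [volterra_path] does not depend on w, and the pathwise bound is
    integrated in the extended reals, where the left side may a priori be infinite. *)
Lemma volterra_proc k c (M : K -> 'M[K]_k) (y a b : process k) :
  mxcont T M -> 0 <= c -> (forall t, 0 <= t <= T -> mxfrob (M t) <= c) ->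
  measurable_process T y -> {ae Pr, forall w, sqpath T (fun t => y t w)} ->
  sqproc a -> sqproc b ->
  {ae Pr, forall w, forall t, 0 <= t <= T ->
     y t w = a t w + time_integral (fun s => M s *m y s w + b s w) t} ->
  sqproc y /\ pnorm y <= volterra_const T c * (pnorm a + pnorm b).
Proof.
move=> cM c0 Mc my sy sa sb yE.
have C0 := volterra_const_ge0 T0 c.
have ma := measurable_int_sqnorm (sqproc_measurable sa).
have mb := measurable_int_sqnorm (sqproc_measurable sb).
have a0 w : setT w -> (0 <= \int[leb]_(t in IT) (sqnorm (a t w))%:E)%E.
  by move=> _; apply: integral_ge0 => t _; rewrite lee_fin sqnorm_ge0.
have b0 w : setT w -> (0 <= \int[leb]_(t in IT) (sqnorm (b t w))%:E)%E.
  by move=> _; apply: integral_ge0 => t _; rewrite lee_fin sqnorm_ge0.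
have le : (\int[Pr]_w \int[leb]_(t in IT) (sqnorm (y t w))%:E <=
    (volterra_const T c * (pnorm a + pnorm b))%:E)%E.
  rewrite EFinM EFinD (pnormE sa) (pnormE sb) -ge0_integralD// -ge0_integralZl//.
  - apply: ae_ge0_le_integral => //.
    + by move=> w _; apply: integral_ge0 => t _; rewrite lee_fin sqnorm_ge0.
    + exact: measurable_int_sqnorm.
    + move=> w ww; apply: mule_ge0; first by rewrite lee_fin.
      by apply: adde_ge0; [exact: a0|exact: b0].
    + by apply: emeasurable_funM => //; exact: emeasurable_funD.
    + have sab : {ae Pr, forall w, sqpath T (fun t => a t w) /\ sqpath T (fun t => b t w)}.
        by apply: filterS2 (ae_sqpath sa) (ae_sqpath sb).
      apply: filterS3 sy yE sab => w syw yEw [saw sbw] _.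
      rewrite !sqpath_int_sqnorm// -EFinD -EFinM lee_fin.
      exact: (volterra_path T0 cM c0 Mc).
  - exact: emeasurable_funD.
  - by move=> w ww; apply: adde_ge0; [exact: a0|exact: b0].
have sqy : sqproc y by apply: sqprocP => //; apply: le_lt_trans le _; rewrite ltry.
by split => //; rewrite -lee_fin (pnormE sqy).
Qed.

(** A primitive solves a Volterra equation with zero matrix and zero source [a], so this is an
    instance of [volterra_proc]. *)
Lemma sqproc_time_integral k (b : process k) : sqproc b ->
  sqproc (fun t w => time_integral (fun s => b s w) t).
Proof.
move=> sb.
have mb := measurable_time_integral (sqproc_measurable sb).
have iE t w : time_integral (fun s => 0 *m time_integral (fun s => b s w) s + b s w) t
    = time_integral (fun s => b s w) t.
  by congr time_integral; apply/funext => s; rewrite mul0mx add0r.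
have s0 : sqproc (fun _ _ => 0 : 'cV[K]_k).
  by apply: (@sqproc_det _ _ _ Pr T k (fun=> 0)); exact: mxcont_cst.
have [] := @volterra_proc k 0 (fun=> 0) (fun t w => time_integral (fun s => b s w) t)
  (fun _ _ => 0) b => //.
- exact: mxcont_cst.
- by move=> t _; rewrite /mxfrob big1// => i _; rewrite big1// => j _; rewrite mxE expr0n.
- apply: filterS (ae_sqpath sb) => w sw j.
  have cb := prim_continuous T0 (sqpath_integ j sw).
  have [C HC] := within_cont_bounded cb.
  have sb' : sqint leb IT (fun t => \int[leb]_(s in `[0, t]) b s w j 0).
    apply: (sqint_le mIT _ (sqint_cst_itv T C)).
      exact: within_cont_measurable.
    move=> t; rewrite /= in_itv/= => tT.
    by rewrite (le_trans (HC _ tT))// ler_norm.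
  by apply: eq_sqint sb' => t _; rewrite mxE.
- by apply: aeW => w t tT; rewrite add0r iE.
Qed.

(** Valid at every t, not only almost every t, because Cauchy-Schwarz in time bounds the value at t
    by the integral of the squared path over [0, T]. *)
Lemma sqvec_time_integral k (b : process k) t : 0 <= t <= T -> sqproc b ->
  sqvec (fun w => time_integral (fun s => b s w) t).
Proof.
move=> tT sb j.
have mt := measurable_time_integral (sqproc_measurable sb) j.
have ITt : IT t by rewrite /= in_itv.
split; first exact: (measurable_slice_omega ITt mt).
apply: (@le_lt_trans _ _ (\int[Pr]_w (T%:E * \int[leb]_(t in IT) (sqnorm (b t w))%:E)))%E.
  apply: ae_ge0_le_integral => //.
  - by move=> w _; rewrite lee_fin sqr_ge0.
  - apply/measurable_EFinP/measurable_funX.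
    exact: (measurable_slice_omega ITt mt).
  - move=> w _; rewrite mule_ge0// integral_ge0// => s _.
    by rewrite lee_fin sqnorm_ge0.
  - apply: emeasurable_funM => //.
    exact: measurable_int_sqnorm (sqproc_measurable sb).
  - apply: filterS (ae_sqpath sb) => w sw _.
    rewrite sqpath_int_sqnorm// -EFinM lee_fin (le_trans (sqr_coord_le _ _))//.
    rewrite (le_trans (sqnorm_time_integral T0 tT sw))// ler_wpM2l//.
    have is' := sqpath_sqnorm sw; have ist := integS tT is'.
    rewrite /Rintegral fine_le//.
    + exact: integrable_fin_num ist.
    + exact: integrable_fin_num is'.
    + apply: ge0_subset_integral => //.
      * by case/integrableP : is'.
      * by move=> s _; rewrite lee_fin sqnorm_ge0.
      * by case/andP: tT => _ tT; apply: subset_itvl; rewrite bnd_simp.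
rewrite ge0_integralZl//.
- by rewrite -(pnormE sb) -EFinM ltry.
- exact: measurable_int_sqnorm (sqproc_measurable sb).
- by move=> w _; rewrite integral_ge0// => s _; rewrite lee_fin sqnorm_ge0.
Qed.

Lemma sqint_omega_tw (Z : Omega -> K) : sqint Pr setT Z ->
  sqint tw ET (fun p => Z p.2).
Proof.
move=> [mZ fZ]; split.
  by apply: measurable_rect_snd.
rewrite (@tonelli_rect1 _ _ _ _ _ leb Pr IT setT mIT measurableT
  (fun p => (Z p.2 ^+ 2)%:E))//; last 2 first.
- apply/measurable_EFinP/measurable_funX.
  by apply: (measurable_rect_snd (f := Z)).
- by move=> p _; rewrite lee_fin sqr_ge0.
rewrite /= integral_cst//=.
apply: lte_mul_pinfty.
- by apply: integral_ge0 => w _; rewrite lee_fin sqr_ge0.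
- by rewrite ge0_fin_numE//; apply: integral_ge0 => w _; rewrite lee_fin sqr_ge0.
- by rewrite lebesgue_measure_itv /=; case: ifP => _; rewrite ?ltry// -EFinB ltry.
Qed.

(** As a process constant in time, [Z] is square integrable on the bounded product, so Z g is
    integrable there and Fubini applies. Taking [Z] out of the time integral is legitimate for
    almost every w. *)
Lemma exp_time_integral (Z : Omega -> K) (g : measurableTypeR K * Omega -> K) t :
  0 <= t <= T -> sqint Pr setT Z -> sqint tw ET g ->
  \int[Pr]_w (Z w * \int[leb]_(s in `[0, t]) g (s, w)) =
  \int[leb]_(s in `[0, t]) \int[Pr]_w (Z w * g (s, w)).
Proof.
move=> tT sZ sg; have [t0 tT'] := andP tT.
pose It := [set` `[0, t]] : set (measurableTypeR K).
have mIt : measurable It by exact: measurable_itv.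
have iZg := sqintM mET (sqint_omega_tw sZ) sg.
have iZgt : tw.-integrable (It `*` setT) (EFin \o (fun p => Z p.2 * g p)).
  apply: integrableS iZg => //; first exact: measurableX.
  by move=> [s w] [/= + _]; rewrite /It /= !in_itv/= => /andP[-> /le_trans ->].
have := fubini_rect1 mIt measurableT iZgt.
rewrite (fubini_rect2 mIt measurableT iZgt) /= => <-.
have aeg : {ae Pr, forall w, setT w -> leb.-integrable It (EFin \o (fun s => g (s, w)))}.
  have ig : tw.-integrable ET (EFin \o g).
    have s1 : sqint tw ET (fun=> 1).
      split; first exact: measurable_cst.
      by have := integrable_lty mET (tw_integrable_cst Pr T (1 ^+ 2)).
    have := sqintM mET sg s1; apply: eq_integrable => // p _ /=.
    by rewrite mulr1.
  apply: (ae_integrable_rect2 mIt measurableT).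
  apply: integrableS ig => //; first exact: measurableX.
  by move=> [s w] [/= + _]; rewrite /It /= !in_itv/= => /andP[-> /le_trans ->].
rewrite /Rintegral; congr fine; apply: ae_eq_integral => //.
- apply/measurable_EFinP; apply: measurable_funM; first by case: sZ.
  have ITt : IT t by rewrite /= in_itv.
  by have := measurable_slice_omega ITt (prim_jointly_measurable (sqint_measurable sg)).
- have := integrable_rect2 mIt measurableT iZgt.
  by move=> /(measurable_int Pr).
- apply: filterS aeg => w /(_ Logic.I) ig _; congr EFin.
  rewrite /= -[RHS]/(\int[leb]_(x in It) (Z w * g (x, w))) RintegralZl//.
Qed.

End VolterraProcesses.

(** * Orthogonality to the past and its propagation *)

Section Orthogonality.
Context {d : measure_display} {Omega : measurableType d} {K : realType}.
Variables (Pr : probability Omega K) (T : K).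
Hypothesis T0 : 0 <= T.
Local Notation leb := (@lebesgue_measure K).
Local Notation IT := ([set` `[0, T]] : set (measurableTypeR K)).
Local Notation ET := (IT `*` [set: Omega]).
Local Notation tw := (leb \x Pr)%E.
Local Notation process k := (K -> Omega -> 'cV[K]_k).
Local Notation sqproc := (sqproc Pr T).
Local Notation sqvec := (sqvec Pr).

Let mIT : measurable IT. Proof. exact: measurable_itv. Qed.
Let mET : measurable ET. Proof. exact: measurableX. Qed.

Lemma sqint_ae (f g : Omega -> K) : measurable_fun setT f -> sqint Pr setT g ->
  {ae Pr, forall w, f w = g w} -> sqint Pr setT f.
Proof.
move=> mf [mg fg] ae; split => //; apply: le_lt_trans fg.
apply: ae_ge0_le_integral => //.
- by move=> w _; rewrite lee_fin sqr_ge0.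
- exact/measurable_EFinP/measurable_funX.
- by move=> w _; rewrite lee_fin sqr_ge0.
- exact/measurable_EFinP/measurable_funX.
- by apply: filterS ae => w -> _.
Qed.

Lemma Rint_ae d' (S : measurableType d') (mu : {measure set S -> \bar K})
    (D : set S) (f g : S -> K) : measurable D ->
  measurable_fun D f -> measurable_fun D g ->
  {ae mu, forall w, D w -> f w = g w} ->
  \int[mu]_(w in D) f w = \int[mu]_(w in D) g w.
Proof.
move=> mD mf mg ae; rewrite /Rintegral; congr fine; apply: ae_eq_integral => //.
- exact/measurable_EFinP.
- exact/measurable_EFinP.
- by apply: filterS ae => w fg Dw; rewrite fg.
Qed.

Lemma exp_integ (Z : Omega -> K) (g : measurableTypeR K * Omega -> K) :
  sqint Pr setT Z -> sqint tw ET g -> integ T (fun s => \int[Pr]_w (Z w * g (s, w))).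
Proof.
move=> sZ sg; have iZg := sqintM mET (sqint_omega_tw T sZ) sg.
exact: (integrable_rect1 mIT measurableT iZg).
Qed.

(* The functional E[Z y(t)] solves the homogeneous deterministic equation, so it
   vanishes by Gronwall. *)
Lemma orth_volterra k (M : K -> 'M[K]_k) (y a b : process k) (Z : Omega -> K) t1 :
  0 <= t1 <= T -> mxcont T M -> sqint Pr setT Z -> sqproc y -> sqproc b ->
  (forall t, 0 <= t <= t1 -> sqvec (a t)) ->
  (forall t j, 0 <= t <= t1 -> \int[Pr]_w (Z w * a t w j 0) = 0) ->
  {ae leb, forall t, 0 <= t <= t1 -> forall j, \int[Pr]_w (Z w * b t w j 0) = 0} ->
  (forall t, 0 <= t <= t1 -> {ae Pr, forall w,
     y t w = a t w + time_integral (fun s => M s *m y s w + b s w) t}) ->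
  forall t, 0 <= t <= t1 ->
    sqvec (y t) /\ forall j, \int[Pr]_w (Z w * y t w j 0) = 0.
Proof.
move=> t1T cM sZ sy sb sa oa ob yE.
have [t10 t1T'] := andP t1T.
have sub t : 0 <= t <= t1 -> 0 <= t <= T.
  by move=> /andP[-> /le_trans ->].
have sg : sqproc (fun s w => M s *m y s w + b s w).
  by apply: sqprocD => //; exact: sqproc_mulmx.
have sti t : 0 <= t <= t1 ->
    sqvec (fun w => time_integral (fun s => M s *m y s w + b s w) t).
  by move=> tt; apply: sqvec_time_integral sg => //; exact: sub.
have ITt t : 0 <= t <= t1 -> IT t by move=> /sub; rewrite /= in_itv.
have my t j : 0 <= t <= t1 -> measurable_fun setT (fun w => y t w j 0).
  by move=> tt; exact: (measurable_slice_omega (ITt _ tt) (sqproc_measurable sy j)).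
have syt t : 0 <= t <= t1 -> sqvec (y t).
  move=> tt j; apply: (sqint_ae (my _ _ tt) (sqintD measurableT (sa t tt j) (sti t tt j))).
  by apply: filterS (yE t tt) => w ->; rewrite mxE.
pose m t : 'cV[K]_k := \col_j \int[Pr]_w (Z w * y t w j 0).
have mx1 (Y : Omega -> 'cV[K]_k) j : sqvec Y ->
    Pr.-integrable setT (EFin \o (fun w => Z w * Y w j 0)).
  by move=> sY; exact: sqintM (sY j).
pose G j s := \int[Pr]_w (Z w * (M s *m y s w + b s w) j 0).
have iG j : integ T (G j).
  exact: (exp_integ sZ (sg j)).
have im j : integ T (fun s => \int[Pr]_w (Z w * y s w j 0)).
  exact: (exp_integ sZ (sy j)).
have mE1 t j : 0 <= t <= t1 -> m t j 0 = \int[leb]_(s in `[0, t]) G j s.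
  move=> tt; rewrite mxE.
  transitivity (\int[Pr]_w (Z w * a t w j 0 +
     Z w * time_integral (fun s => M s *m y s w + b s w) t j 0)).
    apply: Rint_ae => //.
    - by apply: measurable_funM; [case: sZ|exact: my].
    - apply: measurable_funD; apply: measurable_funM; try by case: sZ.
        by case: (sa t tt j).
      by case: (sti t tt j).
    - by apply: filterS (yE t tt) => w -> _; rewrite mxE mulrDr.
  rewrite RintegralD//; [|exact: (mx1 _ j (sa t tt))|exact: (mx1 _ j (sti t tt))].
  rewrite oa// add0r -(exp_time_integral (sub _ tt) sZ (sg j)).
  by apply: eq_Rintegral => w _; rewrite mxE.
have GE j : {ae leb, forall s, 0 <= s <= t1 -> G j s = (M s *m m s) j 0}.
  apply: filterS2 (ae_sqvec sb) ob => s sbs obs ss; rewrite /G.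
  have {}sbs := sbs (ITt s ss).
  have iy l : Pr.-integrable setT (EFin \o (fun w => M s j l * (Z w * y s w l 0))).
    under [EFin \o _]eq_fun do rewrite /= EFinM.
    by apply: integrableZl => //; exact: (mx1 _ l (syt s ss)).
  transitivity (\int[Pr]_w (\sum_l M s j l * (Z w * y s w l 0) + Z w * b s w j 0)).
    apply: eq_Rintegral => w _; rewrite mxE mulrDr; congr (_ + _).
    by rewrite mxE mulr_sumr; apply: eq_bigr => l _; ring.
  rewrite RintegralD//; last 2 first.
  - rewrite (_ : _ \o _ = (fun w => \sum_l (M s j l * (Z w * y s w l 0))%:E)%E).
      by apply: integrable_sum => // l _; exact: iy.
    by apply/funext => w /=; rewrite sumEFin.
  - exact: (mx1 _ j sbs).
  rewrite obs// addr0 mxE.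
  transitivity (\sum_l \int[Pr]_w (M s j l * (Z w * y s w l 0))).
    by rewrite Rint_sum.
  apply: eq_bigr => l _; rewrite mxE RintegralZl//.
  exact: (mx1 _ l (syt s ss)).
(* By [mE1] each coordinate of [m] is a primitive, hence continuous and bounded on [0, t1]. *)
have sm : sqpath t1 m.
  move=> j.
  have := prim_continuous t10 (integS t1T (iG j)).
  move=> cG; have [C HC] := within_cont_bounded cG.
  have sG : sqint leb `[0, t1] (fun t => \int[leb]_(s in `[0, t]) G j s).
    apply: (sqint_le _ _ (sqint_cst_itv t1 C)).
    - exact: measurable_itv.
    - exact: within_cont_measurable.
    - move=> t; rewrite /= in_itv/= => tt.
      by rewrite (le_trans (HC _ tt))// ler_norm.
  by apply: eq_sqint sG => t; rewrite /= in_itv/= => tt; rewrite mE1.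
have cM1 : mxcont t1 M.
  move=> i j; apply: continuous_subspaceW (cM i j).
  by apply: subset_itvl; rewrite bnd_simp.
have [c c0 Mc] := mxcont_frob_bounded cM1.
have mE t : 0 <= t <= t1 -> m t = time_integral (fun s => M s *m m s) t.
  move=> tt; apply/matrixP => j i; rewrite ord1 mE1// [RHS]mxE.
  apply: (@Rint_ae _ (measurableTypeR K) leb) => //.
  - exact: (integ_measurable (integS (sub _ tt) (iG j))).
  - apply: (@measurable_funS _ _ _ _ `[0, t1]) => //.
      by apply: subset_itvl; rewrite bnd_simp; case/andP: tt.
    have := sqpath_integ j (sqpath_mulmx cM1 sm).
    by move=> /integ_measurable.
  - have := GE j; apply: negligibleS; apply: subsetC => s h; rewrite /= in_itv/= => /andP[s0 st].
    by rewrite h// s0 (le_trans st)//; case/andP: tt.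
have m0 t : 0 <= t <= t1 -> sqnorm (m t) <= 0 * expR (t1 * c * t).
  apply: (@gronwall K t1 (t1 * c) 0 (fun t => sqnorm (m t))).
  - exact: mulr_ge0.
  - exact: sqpath_sqnorm.
  - move=> {}t tt; rewrite add0r {1}mE//.
    apply: le_trans (sqnorm_time_integral t10 tt (sqpath_mulmx cM1 sm)) _.
    rewrite -mulrA ler_wpM2l//.
    have ism := sqpath_sqnorm sm.
    rewrite -RintegralZl//; last exact: (integS tt ism).
    apply: le_Rintegral => //.
    + exact: (integS tt (sqpath_sqnorm (sqpath_mulmx cM1 sm))).
    + exact: (integS tt (integZ c ism)).
    + move=> s; rewrite /= in_itv/= => /andP[s0 st].
      rewrite (le_trans (sqnorm_mulmx _ _))// ler_wpM2r ?sqnorm_ge0//.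
      by apply: Mc; rewrite s0 (le_trans st)//; case/andP: tt.
move=> t tt; split => [|j]; first exact: syt.
have := sqr_coord_le (m t) j; move=> /le_trans /(_ (m0 t tt)).
rewrite mul0r => h.
have : m t j 0 ^+ 2 = 0 by apply/eqP; rewrite eq_le h sqr_ge0.
by move=> /eqP; rewrite sqrf_eq0 => /eqP; rewrite mxE.
Qed.

(* Substitute for Ito's product rule: orthogonality of the increments of [a] to
   the past turns E[a(t) int_0^t h] into int_0^t E[a(u) h(u)] du, an absolutely
   continuous function of t. *)
Lemma noise_ibp (a h : measurableTypeR K * Omega -> K) (D D' : K -> K) :
  sqint tw ET a -> sqint tw ET h ->
  (forall t, 0 <= t <= T -> sqint Pr setT (fun w => a (t, w))) ->
  abscont T D D' -> {within `[0, T], continuous D'} -> D T = 0 ->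
  {ae leb, forall u, 0 <= u <= T -> forall t, u <= t <= T ->
     \int[Pr]_w ((a (t, w) - a (u, w)) * h (u, w)) = 0} ->
  \int[tw]_(p in ET) (D p.1 * (a p * h p)
     + D' p.1 * (a p * \int[leb]_(s in `[0, p.1]) h (s, p.2))) = 0.
Proof.
move=> sa sh sat aD cD' DT orth.
pose dl (p : measurableTypeR K * Omega) := \int[leb]_(s in `[0, p.1]) h (s, p.2).
have hv : sqproc (fun t w => const_mx (h (t, w)) : 'cV[K]_1).
  by move=> j; apply: eq_sqint sh => -[t w] _; rewrite mxE.
have sdl : sqint tw ET dl.
  have := sqproc_time_integral T0 hv ord0; apply: eq_sqint => p _.
  by rewrite mxE; apply: eq_Rintegral => s _; rewrite mxE.
have iah := sqintM mET sa sh; have iad := sqintM mET sa sdl.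
pose eta u := \int[Pr]_w (a (u, w) * h (u, w)).
pose N t := \int[Pr]_w (a (t, w) * dl (t, w)).
have ieta : integ T eta by exact: (integrable_rect1 mIT measurableT iah).
have iN : integ T N by exact: (integrable_rect1 mIT measurableT iad).
have NE t : 0 <= t <= T -> N t = \int[leb]_(u in `[0, t]) eta u.
  move=> tT; rewrite /N (exp_time_integral tT (sat t tT) sh).
  apply: Rint_ae => //.
  - exact: (integ_measurable (integS tT (exp_integ (sat t tT) sh))).
  - exact: (integ_measurable (integS tT ieta)).
  - apply: filterS2 (ae_sqvec hv) orth => u shu ou; rewrite /= in_itv/= => /andP[u0 ut].
    have uT : 0 <= u <= T by rewrite u0 (le_trans ut)//; case/andP: tT.
    have {}shu : sqint Pr setT (fun w => h (u, w)).
      have ITu : IT u by rewrite /= in_itv.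
      by have := shu ITu ord0; apply: eq_sqint => w _; rewrite mxE.
    apply/eqP; rewrite -subr_eq0 -RintegralB//; last 2 first.
    - exact: (sqintM measurableT (sat t tT) shu).
    - exact: (sqintM measurableT (sat u uT) shu).
    apply/eqP; rewrite -[RHS](ou uT t); last by rewrite ut; case/andP: tT.
    by apply: eq_Rintegral => w _; rewrite mulrBl.
have aN : abscont T N eta.
  split => // t tT; rewrite (NE 0) ?lexx// Rint_0_0 add0r; exact: NE.
(* Both boundary terms of the product D N vanish, since [D T = 0] and [N 0 = 0]. *)
have [_ /(_ T)] := abscontM T0 aD aN.
rewrite T0 lexx => /(_ isT); rewrite DT mul0r (NE 0) ?lexx// Rint_0_0 mulr0 add0r.
have cD := abscont_cont T0 aD.
have [CD HD] := within_cont_bounded cD.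
have [CD' HD'] := within_cont_bounded cD'.
have mbnd (E : K -> K) C f : {within `[0, T], continuous E} ->
    (forall t, 0 <= t <= T -> `|E t| <= C) -> tw.-integrable ET (EFin \o f) ->
    tw.-integrable ET (EFin \o (fun p => E p.1 * f p)).
  move=> cE HE fi; apply: (@integrable_le _ _ _ tw _ mET _ (fun p => C * `|f p|)).
  - apply: measurable_funM.
      by apply: (measurable_rect_fst (f := E)) => //; exact: within_cont_measurable.
    by apply/measurable_EFinP; exact: measurable_int fi.
  - have := integrable_norm fi; move=> fn.
    by under [EFin \o _]eq_fun do rewrite /= EFinM; exact: integrableZl.
  - move=> [t w] [/=]; rewrite in_itv/= => tT _; rewrite normrM ler_wpM2r//.
    exact: HE.
have i1 := mbnd D CD _ cD HD iah.
have i2 := mbnd D' CD' _ cD' HD' iad.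
move=> E0; rewrite RintegralD// (fubini_rect1 mIT measurableT i1) (fubini_rect1 mIT measurableT i2).
have iD : integ T (fun t => D' t * N t).
  by under eq_fun do rewrite mulrC; exact: (integM_bounded (within_cont_measurable cD') HD').
have iE : integ T (fun t => D t * eta t).
  by under eq_fun do rewrite mulrC; exact: (integM_bounded (within_cont_measurable cD) HD).
move: E0; rewrite RintegralD// => E0; rewrite [RHS]E0 addrC; congr (_ + _).
- apply: eq_Rintegral => t; rewrite mem_it => tT /=.
  rewrite /N RintegralZl//; apply: sqintM => //; first exact: sat.
  have := sqvec_time_integral T0 tT hv ord0; apply: eq_sqint => w _.
  by rewrite mxE; apply: eq_Rintegral => s _; rewrite mxE.
- apply: (@Rint_ae _ (measurableTypeR K) leb) => //.
  + exact: integ_measurable (integrable_rect1 mIT measurableT i1).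
  + exact: integ_measurable iE.
  + apply: negligibleS (ae_sqvec hv); apply: subsetC => t sht ITt /=.
    have tT : 0 <= t <= T by move: ITt; rewrite /= in_itv.
    rewrite /eta RintegralZl//; apply: sqintM => //; first exact: sat.
    by have := sht ITt ord0; apply: eq_sqint => w _; rewrite mxE.
Qed.
End Orthogonality.

(** * Brownian increments and independence *)

Section NormalMoments.
Context {d : measure_display} {Omega : measurableType d} {K : realType}.
Variable Pr : probability Omega K.
Local Notation leb := (@lebesgue_measure K).

(** The Radon-Nikodym derivative of the normal law and [normal_pdf] have the same integral over
    every measurable set, hence agree almost everywhere. *)
Lemma ge0_integral_normal_prob (s : K) (f : measurableTypeR K -> \bar K) :
  measurable_fun setT f -> (forall x, 0 <= f x)%E ->
  (\int[normal_prob 0 s]_x f x = \int[leb]_x (f x * (normal_pdf 0 s x)%:E))%E.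
Proof.
move=> mf f0; have dom := @normal_prob_dominates K 0 s.
have mpdf : measurable_fun setT (fun x : measurableTypeR K => (normal_pdf 0 s x)%:E).
  by apply/measurable_EFinP; exact: measurable_normal_pdf.
have iRN := Radon_Nikodym_SigmaFinite.f_integrable dom.
rewrite -(Radon_Nikodym_SigmaFinite.change_of_variables dom)//.
apply: ae_eq_integral => //.
- apply: emeasurable_funM => //; exact: measurable_int iRN.
- exact: emeasurable_funM.
- apply: ae_eqe_mul2l; apply: integral_ae_eq => //.
  by move=> E _ mE; rewrite -Radon_Nikodym_SigmaFinite.f_integral.
Qed.

Lemma ge0_integral_oppr (f : measurableTypeR K -> \bar K) :
  measurable_fun setT f -> (forall x, 0 <= f x)%E ->
  (\int[leb]_x f x = \int[leb]_x f (- x)%R)%E.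
Proof.
move=> mf f0.
rewrite -[RHS](@ge0_integral_pushforward _ _ (measurableTypeR K) (measurableTypeR K) K
   -%R _ leb setT f)//.
by apply: eq_measure_integral => //= A mA _; exact/esym/lebesgue_measureN.
Qed.

(** Compares the peaks of the Gaussian densities of variance s^2 and 2 s^2; it amounts to sqrt 2 <=
    2. *)
Lemma invsqrt_double (a : K) : 0 < a -> (Num.sqrt a)^-1 <= 2 * (Num.sqrt (2 * a))^-1.
Proof.
move=> a0; rewrite -ler_pdivrMl// -invfM lef_pV2 ?posrE ?mulr_gt0 ?sqrtr_gt0 ?mulr_gt0//.
rewrite sqrtrM// ler_wpM2r ?sqrtr_ge0//.
rewrite -[leRHS](ger0_norm (ler0n _ _)) -sqrtr_sqr ler_sqrt ?sqr_ge0//.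
by rewrite -natrX ler_nat.
Qed.

(* Only linearity of the bound in the variance matters; the constant comes from
   x^2 / (4 s^2) <= exp (x^2 / (4 s^2)), which trades the Gaussian density of
   variance s^2 for that of variance 2 s^2. *)
Lemma normal_law_moments (X : Omega -> K) (s : K) : 0 < s -> measurable_fun setT X ->
  (forall E : set K, measurable E -> Pr (X @^-1` E) = normal_prob 0 s E) ->
  [/\ sqint Pr setT X, \int[Pr]_w X w ^+ 2 <= 8 * s ^+ 2 & \int[Pr]_w X w = 0].
Proof.
move=> s0 mX lawX; have sn0 : s != 0 by rewrite gt_eqF.
have lawE (f : measurableTypeR K -> \bar K) : measurable_fun setT f -> (forall x, 0 <= f x)%E ->
    (\int[Pr]_w f (X w) = \int[leb]_x (f x * (normal_pdf 0 s x)%:E))%E.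
  move=> mf f0; rewrite -ge0_integral_normal_prob//.
  pose X' : {mfun Omega >-> measurableTypeR K} :=
    HB.pack X (isMeasurableFun.Build _ _ Omega (measurableTypeR K) X mX).
  transitivity (\int[pushforward Pr X']_x f x)%E.
    by rewrite (@ge0_integral_pushforward _ _ Omega (measurableTypeR K) K X'
      (measurable_funPT X') Pr setT f)//.
  by apply: eq_measure_integral => A mA _; exact: lawX.
have bnd : (\int[Pr]_w (X w ^+ 2)%:E <= (8 * s ^+ 2)%:E)%E.
  rewrite (lawE (fun x => (x ^+ 2)%:E)); last 2 first.
  - by apply/measurable_EFinP; exact: exprn_measurable.
  - by move=> x; rewrite lee_fin sqr_ge0.
  pose s2 := Num.sqrt 2 * s.
  have s20 : 0 < s2 by rewrite mulr_gt0// sqrtr_gt0.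
  have s2E : s2 ^+ 2 = 2 * s ^+ 2 by rewrite exprMn sqr_sqrtr.
  apply: (@le_trans _ _ (\int[leb]_x ((8 * s ^+ 2)%:E * (normal_pdf 0 s2 x)%:E))%E).
    apply: ge0_le_integral => //.
    - by move=> x _; rewrite -EFinM lee_fin mulr_ge0 ?sqr_ge0// normal_pdf_ge0.
    - under eq_fun do rewrite -EFinM.
      apply/measurable_EFinP; apply: measurable_funM; first exact: exprn_measurable.
      exact: measurable_normal_pdf.
    - by apply: emeasurable_funM => //; apply/measurable_EFinP; exact: measurable_normal_pdf.
    - move=> x _; rewrite -!EFinM lee_fin !normal_pdfE ?gt_eqF//.
      rewrite /normal_fun subr0.
      set u := x ^+ 2 / (4 * s ^+ 2).
      have sn : s ^+ 2 != 0 by rewrite sqrf_eq0.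
      have u0 : 0 <= u by rewrite divr_ge0 ?sqr_ge0// mulr_ge0// sqr_ge0.
      have -> : - x ^+ 2 / (s ^+ 2 *+ 2) = - u - u by rewrite /u -mulr_natl; field.
      have -> : - x ^+ 2 / (s2 ^+ 2 *+ 2) = - u by rewrite s2E /u -mulr_natl; field.
      have -> : x ^+ 2 = 4 * s ^+ 2 * u by rewrite /u; field.
      have pk : normal_peak s <= 2 * normal_peak s2.
        rewrite /normal_peak s2E -(mulrA 2) -[2 * (_ * _) *+ 2]mulrnAr.
        apply: invsqrt_double.
        by rewrite mulrn_wgt0// mulr_gt0 ?pi_gt0// exprn_gt0.
      have e0 := expR_ge0 (- u); have pk0 := normal_peak_ge0 s.
      have ue : u * expR (- u) <= 1.
        rewrite expRN ler_pdivrMr ?expR_gt0// mul1r.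
        by apply: le_trans (expR_ge1Dx u); rewrite lerDr.
      rewrite expRD.
      have -> : 4 * s ^+ 2 * u * (normal_peak s * (expR (- u) * expR (- u))) =
        4 * s ^+ 2 * ((u * expR (- u)) * (normal_peak s * expR (- u))) by ring.
      have -> : 8 * s ^+ 2 * (normal_peak s2 * expR (- u)) =
        4 * s ^+ 2 * (2 * normal_peak s2 * expR (- u)) by ring.
      apply: ler_wpM2l; first by rewrite mulr_ge0 ?sqr_ge0.
      apply: (@le_trans _ _ (normal_peak s * expR (- u))).
        by rewrite ler_piMl// mulr_ge0.
      by rewrite ler_wpM2r.
  rewrite ge0_integralZl//; last 3 first.
  - by apply/measurable_EFinP; exact: measurable_normal_pdf.
  - by move=> x _; rewrite lee_fin normal_pdf_ge0.
  - by rewrite lee_fin mulr_ge0 ?sqr_ge0.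
  by rewrite integral_normal_pdf mule1.
have sX : sqint Pr setT X by split => //; apply: le_lt_trans bnd _; rewrite ltry.
split => //.
  rewrite -lee_fin /Rintegral fineK//; exact: (integrable_fin_num measurableT (sqint_integrable2 sX)).
have mpos : measurable_fun setT (fun x : measurableTypeR K => (Num.max x 0)%:E).
  by apply/measurable_EFinP; apply: measurable_maxr.
have mneg : measurable_fun setT (fun x : measurableTypeR K => (Num.max (- x) 0)%:E).
  by apply/measurable_EFinP; apply: measurable_maxr => //; exact: oppr_measurable.
have mpdf : measurable_fun setT (fun x : measurableTypeR K => (normal_pdf 0 s x)%:E).
  by apply/measurable_EFinP; exact: measurable_normal_pdf.
(* Mean zero: since the density is even, the reflection x -> -x exchanges the integrals of the
   positive and the negative part. *)
rewrite /Rintegral integralE.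
have -> : (\int[Pr]_w (fun w => (X w)%:E)^\+ w =
    \int[Pr]_w ((fun x => (Num.max x 0)%:E) (X w)))%E.
  by apply: eq_integral => w _; rewrite funeposE /= EFin_max.
have -> : (\int[Pr]_w (fun w => (X w)%:E)^\- w =
    \int[Pr]_w ((fun x => (Num.max (- x)%R 0)%:E) (X w)))%E.
  by apply: eq_integral => w _; rewrite funenegE /= EFin_max.
rewrite (lawE _ mpos) ?(lawE _ mneg)//; last 2 first.
- by move=> x; rewrite lee_fin le_max lexx orbT.
- by move=> x; rewrite lee_fin le_max lexx orbT.
rewrite [X in (X - _)%E]ge0_integral_oppr//; last 2 first.
- exact: emeasurable_funM.
- by move=> x; rewrite mule_ge0 ?lee_fin ?normal_pdf_ge0// le_max lexx orbT.
have -> : (\int[leb]_x ((Num.max (- x)%R 0)%:E * (normal_pdf 0 s (- x)%R)%:E) =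
    \int[leb]_x ((Num.max (- x)%R 0)%:E * (normal_pdf 0 s x)%:E))%E.
  apply: eq_integral => x _; rewrite !normal_pdfE// /normal_fun !subr0 sqrrN//.
(* If the common integral were infinite, the difference would be infinite too and [fine] would send
   it to 0. *)
case: (\int[leb]_x _)%E => [x| |] //=.
by rewrite subrr.
Qed.

End NormalMoments.

(** * Generated sigma-algebras, measurability relative to them, and independence *)

Section SigmaAlgebras.
Context {d : measure_display} {Omega : measurableType d} {K : realType}.
Variable Pr : probability Omega K.
Implicit Types (F H : set (set Omega)) (X Y : Omega -> K).

(** Measurability for a sub-sigma-algebra given as a plain family of sets, so that several of them
    live on the same [Omega]; for generated families [fmeasP] translates it into
    [measurable_fun]. *)
Definition fmeas F X := forall B : set K, measurable B -> F (X @^-1` B).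

Lemma fmeas_measurable F X : F `<=` measurable -> fmeas F X -> measurable_fun setT X.
Proof. by move=> Fm fX _ B mB; rewrite setTI; exact/Fm/fX. Qed.

Lemma fmeas_sub F H X : F `<=` H -> fmeas F X -> fmeas H X.
Proof. by move=> FH fX B mB; exact/FH/fX. Qed.

Lemma sub_gen (G H : set (set Omega)) : G `<=` <<s H >> -> <<s G >> `<=` <<s H >>.
Proof. by move=> GH; apply: smallest_sub => //; exact: smallest_sigma_algebra. Qed.

Lemma gen_measurable (G : set (set Omega)) : G `<=` measurable -> <<s G >> `<=` measurable.
Proof. by move=> Gm; apply: smallest_sub => //; exact: sigma_algebra_measurable. Qed.

Lemma fmeas_sigma_gen (S : set (Omega -> K)) X : S X -> fmeas (sigma_gen S) X.
Proof.
move=> SX B mB; apply: sub_sigma_algebra; exists X => //.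
by exists B => //; rewrite setTI.
Qed.

Lemma sigma_gen_sub (S : set (Omega -> K)) (G : set (set Omega)) :
  (forall X, S X -> fmeas <<s G >> X) -> sigma_gen S `<=` <<s G >>.
Proof.
move=> SG; apply: sub_gen => _ [X SX] [B mB <-]; rewrite setTI; exact: SG.
Qed.

Lemma sigma_gen_measurable (S : set (Omega -> K)) :
  (forall X, S X -> measurable_fun setT X) -> sigma_gen S `<=` measurable.
Proof.
move=> Sm; apply: gen_measurable => _ [X SX] [B mB <-]; exact: Sm.
Qed.

Lemma sigma_gen_subset (S S' : set (Omega -> K)) : S `<=` S' ->
  sigma_gen S `<=` sigma_gen S'.
Proof.
move=> SS'; apply: sigma_gen_sub => X SX.
by apply: fmeas_sigma_gen; exact: SS'.
Qed.

Lemma fmeasP (G : set (set Omega)) X :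
  fmeas <<s G >> X <-> measurable_fun (setT : set (g_sigma_algebraType G)) X.
Proof.
split => [fX _ B mB|mX B mB]; first by rewrite setTI; exact: fX.
by have := mX measurableT B mB; rewrite setTI.
Qed.

Lemma fmeasB (G : set (set Omega)) X Y :
  fmeas <<s G >> X -> fmeas <<s G >> Y -> fmeas <<s G >> (X \- Y).
Proof.
by move=> /fmeasP mX /fmeasP mY; apply/fmeasP; exact: measurable_funB.
Qed.

Lemma fmeasD (G : set (set Omega)) X Y :
  fmeas <<s G >> X -> fmeas <<s G >> Y -> fmeas <<s G >> (fun w => X w + Y w).
Proof.
by move=> /fmeasP mX /fmeasP mY; apply/fmeasP; exact: measurable_funD.
Qed.

Lemma fmeas_cst (G : set (set Omega)) (c : K) : fmeas <<s G >> (fun=> c).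
Proof. by apply/fmeasP; exact: measurable_cst. Qed.

Lemma fmeasZ (G : set (set Omega)) c X :
  fmeas <<s G >> X -> fmeas <<s G >> (fun w => X w * c).
Proof.
by move=> /fmeasP mX; apply/fmeasP; exact: measurable_funM.
Qed.

Lemma fmeas_sum (G : set (set Omega)) (I : Type) (s : seq I) (X : I -> Omega -> K) :
  (forall i, fmeas <<s G >> (X i)) -> fmeas <<s G >> (fun w => \sum_(i <- s) X i w).
Proof.
move=> fX; elim: s => [|i s IH].
  by under eq_fun do rewrite big_nil; exact: fmeas_cst.
by under eq_fun do rewrite big_cons; exact: fmeasD.
Qed.

Lemma genI (G : set (set Omega)) A B : <<s G >> A -> <<s G >> B -> <<s G >> (A `&` B).
Proof. exact: (@measurableI _ (g_sigma_algebraType G)). Qed.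

Lemma genT (G : set (set Omega)) : <<s G >> setT.
Proof. exact: (@measurableT _ (g_sigma_algebraType G)). Qed.

Lemma gen_bigcap_seq (G : set (set Omega)) (s : seq nat) (E : nat -> set Omega) :
  (forall i, i \in s -> <<s G >> (E i)) -> <<s G >> (\bigcap_(i in [set` s]) E i).
Proof.
move=> GE; exact: (@fin_bigcap_measurable _ (g_sigma_algebraType G)).
Qed.

Lemma sqint_cst_omega (c : K) : sqint Pr setT (fun=> c).
Proof.
split; first exact: measurable_cst.
have := finite_measure_integrable_cst Pr (c ^+ 2) measurableT.
by move=> /(integrable_lty measurableT).
Qed.

(* The joint law is the product of the marginals, so this is Fubini's theorem. *)
Lemma indep_exp F H X Y : indep Pr F H -> F `<=` measurable -> H `<=` measurable ->
  fmeas F X -> fmeas H Y -> sqint Pr setT X -> sqint Pr setT Y ->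
  \int[Pr]_w (X w * Y w) = (\int[Pr]_w X w) * (\int[Pr]_w Y w).
Proof.
move=> FH Fm Hm fX fY sX sY.
have mX := fmeas_measurable Fm fX; have mY := fmeas_measurable Hm fY.
pose R := measurableTypeR K.
have s1 := sqint_cst_omega 1.
have iX : Pr.-integrable setT (EFin \o X).
  by have := sqintM measurableT sX s1; apply: eq_integrable => // w _ /=; rewrite mulr1.
have iY : Pr.-integrable setT (EFin \o Y).
  by have := sqintM measurableT sY s1; apply: eq_integrable => // w _ /=; rewrite mulr1.
have iXY := sqintM measurableT sX sY.
pose X' : {mfun Omega >-> R} := HB.pack X (isMeasurableFun.Build _ _ Omega R X mX).
pose Y' : {mfun Omega >-> R} := HB.pack Y (isMeasurableFun.Build _ _ Omega R Y mY).
have mXY : measurable_fun setT ((fun w => (X w, Y w)) : Omega -> (R * R)%type).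
  exact: measurable_fun_pair.
pose XY' : {mfun Omega >-> (R * R)%type} := HB.pack ((fun w => (X w, Y w)) : Omega -> (R * R)%type)
  (isMeasurableFun.Build _ _ Omega (R * R)%type _ mXY).
pose mu := distribution Pr X'; pose nu := distribution Pr Y'.
have joint (A : set (R * R)%type) : measurable A -> (mu \x nu)%E A = pushforward Pr XY' A.
  apply: product_measure_unique => B C mB mC.
  exact: FH (fX _ mB) (fY _ mC).
have mprod : measurable_fun setT (fun z : (R * R)%type => (z.1 * z.2)%:E).
  by apply/measurable_EFinP; apply: measurable_funM.
have ijoint : (mu \x nu)%E.-integrable setT (fun z : (R * R)%type => (z.1 * z.2)%:E).
  apply/integrableP; split => //.
  rewrite (eq_measure_integral (pushforward Pr XY')); last by move=> A mA _; exact: joint.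
  rewrite ge0_integral_pushforward//; last exact: measurableT_comp.
  by case/integrableP: iXY.
transitivity (\int[(mu \x nu)%E]_(z in setT `*` setT) ((z.1 : K) * z.2)).
  rewrite setXTT /Rintegral; congr fine.
  rewrite (eq_measure_integral (pushforward Pr XY')); last by move=> A mA _; exact: joint.
  by rewrite (integral_pushforward (measurable_funPT XY') mprod).
rewrite fubini_rect1//; last by rewrite setXTT.
have EX : \int[mu]_x (x : K) = \int[Pr]_w X w.
  rewrite /Rintegral; congr fine.
  by rewrite (integral_pushforward (measurable_funPT X') (f := EFin)).
have EY : \int[nu]_x (x : K) = \int[Pr]_w Y w.
  rewrite /Rintegral; congr fine.
  by rewrite (integral_pushforward (measurable_funPT Y') (f := EFin)).
have imu : mu.-integrable setT (EFin : R -> \bar K).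
  exact: (integrable_pushforward (measurable_funPT X')).
have inu : nu.-integrable setT (EFin : R -> \bar K).
  exact: (integrable_pushforward (measurable_funPT Y')).
transitivity (\int[mu]_x ((x : K) * \int[nu]_y (y : K))).
  by apply: eq_Rintegral => x _; rewrite /= RintegralZl.
by rewrite RintegralZr// EX EY.
Qed.

End SigmaAlgebras.

(** * Independence of Brownian increments from the joint past of all agents *)

Section BrownianFiltration.
Context {d : measure_display} {Omega : measurableType d} {K : realType}.
Variable Pr : probability Omega K.
Context {n : nat}.
Variables (W : nat -> K -> Omega -> K) (x0 : nat -> Omega -> 'cV[K]_n).
Hypothesis W_bm : forall i, brownian_motion Pr (W i).
Hypothesis W_indep : mutually_indep Pr (fun i => process_sigma (W i)).
Hypothesis x0_rv : forall i, random_vector (x0 i).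
Hypothesis x0_W_indep : indep Pr
      (<<s \bigcup_i sigma_gen (coords (x0 i)) >>)
      (<<s \bigcup_i process_sigma (W i) >>).

Let mW i t : 0 <= t -> measurable_fun setT (W i t).
Proof. by move=> t0; have [+ _ _ _ _] := W_bm i; exact. Qed.

Lemma incr_law i a b : 0 <= a -> a < b ->
  [/\ sqint Pr setT (W i b \- W i a),
      \int[Pr]_w (W i b w - W i a w) ^+ 2 <= 8 * (b - a) &
      \int[Pr]_w (W i b w - W i a w) = 0].
Proof.
move=> a0 ab; have [_ _ law _ _] := W_bm i.
have s0 : 0 < Num.sqrt (b - a) by rewrite sqrtr_gt0 subr_gt0.
have mD : measurable_fun setT (W i b \- W i a).
  apply: measurable_funB; first by apply: mW; rewrite (le_trans a0)// ltW.
  exact: mW.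
have [h1 h2 h3] := normal_law_moments s0 mD (law a b a0 ab).
split => //; apply: le_trans h2 _.
by rewrite sqr_sqrtr// subr_ge0 ltW.
Qed.

Lemma process_sigma_measurable i : process_sigma (W i) `<=` measurable.
Proof.
apply: sigma_gen_measurable => _ [t /= + <-]; rewrite in_itv/= andbT; exact: mW.
Qed.

Lemma W_process_fmeas i t : 0 <= t -> fmeas (process_sigma (W i)) (W i t).
Proof. by move=> t0; apply: fmeas_sigma_gen; exists t => //=; rewrite in_itv/= t0. Qed.

Lemma incr_process_fmeas i a b : 0 <= a -> 0 <= b ->
  fmeas (process_sigma (W i)) (W i b \- W i a).
Proof. by move=> a0 b0; apply: fmeasB; exact: W_process_fmeas. Qed.

Lemma filtration_measurable N t : 0 <= t -> filtration N x0 W t `<=` measurable.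
Proof.
move=> t0; apply: gen_measurable => A [i _].
apply: sigma_gen_measurable => X [[j _ <-]|[u /= + <-]]; first exact: x0_rv.
by rewrite in_itv/= => /andP[u0 _]; exact: mW.
Qed.

Lemma filtration_fmeas_W N (i : 'I_N) t u : 0 <= u <= t ->
  fmeas (filtration N x0 W t) (W i u).
Proof.
move=> ut B mB; apply: sub_sigma_algebra; exists i => //.
apply: (fmeas_sigma_gen (S := coords (x0 i) `|` W i @` `[0, t])) => //.
by right; exists u => //=; rewrite in_itv.
Qed.

Lemma filtration_fmeas_x0 N (i : 'I_N) t k :
  fmeas (filtration N x0 W t) (fun w => x0 i w k 0).
Proof.
move=> B mB; apply: sub_sigma_algebra; exists i => //.
apply: (fmeas_sigma_gen (S := coords (x0 i) `|` W i @` `[0, t])) => //.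
by left; exists k.
Qed.

Lemma filtration_mono N s t : s <= t -> filtration N x0 W s `<=` filtration N x0 W t.
Proof.
move=> st; apply: sub_gen => A [i _ iA]; apply: sub_sigma_algebra; exists i => //.
apply: sigma_gen_subset iA; apply: setUS => _ [u /= + <-].
by rewrite in_itv/= => /andP[u0 us]; exists u => //=; rewrite in_itv/= u0 (le_trans us).
Qed.

(* The sets E0 /\ E_0 /\ ... /\ E_(M-1), with E0 an event of the initial states
   and E_j one of the past of [W j], form a pi-system on which independence is
   the product rule. *)
Lemma filtration_incr_indep N s i a b : 0 <= s -> s <= a -> a < b ->
  indep Pr (filtration N x0 W s) (sigma_gen [set W i b \- W i a]).
Proof.
move=> s0 sa ab E E' FE HE'.
have a0 : 0 <= a by exact: le_trans sa.
have b0 : 0 <= b by rewrite (le_trans a0)// ltW.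
(* The index [i] of the increment may lie outside the first [N] agents, so the finite family of
   noises has to reach both. *)
pose M := maxn N i.+1.
pose L := iota 0 M.
have iL : i \in L by rewrite mem_iota /= add0n leq_max ltnSn orbT.
pose past j := sigma_gen (W j @` `[0, s]).
pose X0 := <<s \bigcup_i sigma_gen (coords (x0 i)) >>.
pose G := [set A | exists E0 (Ej : nat -> set Omega), [/\ X0 E0,
  (forall j, past j (Ej j)) & A = E0 `&` \bigcap_(j in [set` L]) Ej j]].
have X0m : X0 `<=` measurable.
  apply: gen_measurable => A [j _]; apply: sigma_gen_measurable => _ [k _ <-].
  exact: x0_rv.
have past_process j : past j `<=` process_sigma (W j).
  apply: sigma_gen_subset => _ [u /= + <-]; rewrite in_itv/= => /andP[u0 _].
  by exists u => //=; rewrite in_itv/= u0.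
have HE'm : process_sigma (W i) E'.
  by apply: sigma_gen_sub HE' => _ ->; exact: incr_process_fmeas.
have mE' : measurable E' by exact: process_sigma_measurable HE'm.
have Gm : G `<=` measurable.
  move=> _ [E0 [Ej [XE0 pEj ->]]]; apply: measurableI; first exact: X0m.
  apply: fin_bigcap_measurable => // j _.
  exact: (@process_sigma_measurable j _ (past_process j _ (pEj j))).
have GI : setI_closed G.
  move=> _ _ [E0 [Ej [XE0 pEj ->]]] [F0 [Fj [XF0 pFj ->]]].
  exists (E0 `&` F0), (fun j => Ej j `&` Fj j); split; first exact: genI.
    by move=> j; exact: (genI (pEj j) (pFj j)).
  by rewrite classical_sets.bigcapI setIACA.
have GT : G setT.
  exists setT, (fun=> setT); split; [exact: genT|by move=> j; exact: genT|].
  by apply/seteqP; split => // w _; split => // j _.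
have Gindep A : G A -> Pr (A `&` E') = (Pr A * Pr E')%E.
  move=> [E0 [Ej [XE0 pEj ->]]].
  (* The future event [E'] is absorbed into the factor of index [i]; the whole intersection then
     runs over events of mutually independent noises. *)
  pose X j := if j == i then Ej j `&` E' else Ej j.
  have pX j : process_sigma (W j) (X j).
    rewrite /X; case: eqP => [->|_]; last exact: (past_process j _ (pEj j)).
    by apply: genI => //; exact: (past_process i _ (pEj i)).
  have pE j : process_sigma (W j) (Ej j) by exact: (past_process j _ (pEj j)).
  have capE : \bigcap_(j in [set` L]) Ej j `&` E' = \bigcap_(j in [set` L]) X j.
    apply/seteqP; split => w.
      by move=> [wE wE'] j jL; rewrite /X; case: eqP => _; [split => //|]; exact: wE.
    move=> wX; split => [j jL|]; last by have := wX i iL; rewrite /X eqxx => -[].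
    by have := wX j jL; rewrite /X; case: eqP => // _ [].
  have gcap (Y : nat -> set Omega) : (forall j, process_sigma (W j) (Y j)) ->
      (<<s \bigcup_i process_sigma (W i) >>) (\bigcap_(j in [set` L]) Y j).
    move=> pY; apply: gen_bigcap_seq => j _; apply: sub_sigma_algebra.
    by exists j.
  rewrite -setIA capE (x0_W_indep XE0 (gcap _ pX)) (x0_W_indep XE0 (gcap _ pE)).
  rewrite -muleA; congr (_ * _)%E.
  rewrite !W_indep ?iota_uniq//.
  rewrite !(bigD1_seq i)//= ?iota_uniq// /X eqxx.
  have -> : Pr (Ej i `&` E') = (Pr (Ej i) * Pr E')%E.
    have [_ _ _ ind _] := W_bm i.
    rewrite setIC muleC; apply: (ind a b a0 ab) => //.
    apply: sigma_gen_subset (pEj i) => _ [u /= + <-]; rewrite in_itv/= => /andP[u0 us].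
    by exists u => //=; rewrite in_itv/= u0 (le_trans us).
  rewrite -!muleA; congr (_ * _)%E; rewrite muleC; congr (_ * _)%E.
  by apply: eq_bigr => j /negbTE ->.
have fE : Pr E' \is a fin_num by exact: fin_num_measure.
have r0 : 0 <= fine (Pr E') by exact: fine_ge0.
(* As functions of the past event the two sides are finite measures: [Pr] restricted to [E'], and
   [Pr] scaled by the probability of [E']. They agree on the pi-system, hence on the sigma-algebra
   generated by it, which contains [filtration]. *)
pose m1 := mrestr Pr mE'.
pose m2 := mscale (NngNum r0) Pr.
have mF : filtration N x0 W s `<=` <<s G >>.
  apply: sub_gen => A [j _ jA].
  have jL : (j : nat) \in L by rewrite mem_iota /= add0n leq_max ltn_ord.
  have pastG C : past j C -> G C.
    move=> pC; exists setT, (fun l : nat => if l == j :> nat then C else setT); split.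
    - exact: genT.
    - by move=> l; case: eqP => [->|_] //; exact: genT.
    - rewrite setTI; apply/seteqP; split => w; last by move=> /(_ j jL); rewrite eqxx.
      by move=> wC l _; case: eqP.
  have X0G C : X0 C -> G C.
    move=> XC; exists C, (fun=> setT); split => //; first by move=> l; exact: genT.
    by apply/seteqP; split => w => [wC|[]//]; split.
  apply: sigma_gen_sub jA => Y [Yx|[u us <-]] B mB; apply: sub_sigma_algebra.
    apply: X0G; apply: sub_sigma_algebra; exists (j : nat) => //.
    exact: fmeas_sigma_gen.
  by apply: pastG; apply: fmeas_sigma_gen => //; exists u.
have : m1 E = m2 E.
  apply: (@g_sigma_algebra_measure_unique _ K Omega G Gm (fun=> setT) (fun=> GT)
    _ m1 m2 GI _ _ E (mF _ FE)).
  - by apply/seteqP; split => // w _; exists 0%N.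
  - move=> A GA; transitivity (Pr A * Pr E')%E; first exact: Gindep.
    by rewrite muleC; congr (_ * _)%E; exact: esym (fineK fE).
  - move=> _; change (Pr (setT `&` E') < +oo)%E; rewrite setTI.
    by move: fE; rewrite ge0_fin_numE.
move=> mE; transitivity (m1 E) => //; rewrite mE.
by rewrite muleC; congr (_ * _)%E; exact: fineK fE.
Qed.

End BrownianFiltration.

(** * Wiener integrals *)

Section OrthogonalSums.
Context {d : measure_display} {Omega : measurableType d} {K : realType}.
Variable Pr : probability Omega K.
Implicit Types X Y : Omega -> K.
Let mT : measurable [set: Omega] := measurableT.

Lemma expD X Y : Pr.-integrable setT (EFin \o X) -> Pr.-integrable setT (EFin \o Y) ->
  \int[Pr]_w (X w + Y w) = \int[Pr]_w X w + \int[Pr]_w Y w.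
Proof. by move=> iX iY; rewrite RintegralD. Qed.

Lemma exp_sqrD X Y : sqint Pr setT X -> sqint Pr setT Y ->
  \int[Pr]_w (X w + Y w) ^+ 2 =
  \int[Pr]_w X w ^+ 2 + 2 * \int[Pr]_w (X w * Y w) + \int[Pr]_w Y w ^+ 2.
Proof.
move=> sX sY.
have iXY := sqintM mT sX sY.
have i2 : Pr.-integrable setT (EFin \o (fun w => 2 * (X w * Y w))).
  by under [EFin \o _]eq_fun do rewrite /= EFinM; exact: integrableZl.
rewrite -RintegralZl// -RintegralD//; [|exact: sqint_integrable2 sX].
rewrite -RintegralD//; last 2 first.
- under [EFin \o _]eq_fun do rewrite /= EFinD.
  by apply: integrableD => //; exact: sqint_integrable2 sX.
- exact: sqint_integrable2 sY.
by apply: eq_Rintegral => w _; ring.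
Qed.

Lemma exp_sqr_ge0 X : 0 <= \int[Pr]_w X w ^+ 2.
Proof. by apply: Rintegral_ge0 => w _; exact: sqr_ge0. Qed.

Lemma exp_sqrD_le X Y : sqint Pr setT X -> sqint Pr setT Y ->
  \int[Pr]_w (X w + Y w) ^+ 2 <= 2 * \int[Pr]_w X w ^+ 2 + 2 * \int[Pr]_w Y w ^+ 2.
Proof.
move=> sX sY; have := exp_sqrD sX (sqintN mT sY).
have -> : \int[Pr]_w (- Y w) ^+ 2 = \int[Pr]_w Y w ^+ 2.
  by apply: eq_Rintegral => w _; rewrite sqrrN.
have -> : \int[Pr]_w (X w * - Y w) = - \int[Pr]_w (X w * Y w).
  rewrite -mulN1r -RintegralZl//; last exact: sqintM.
  by apply: eq_Rintegral => w _; rewrite mulrN mulN1r.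
move=> E; have := exp_sqr_ge0 (fun w => X w - Y w); rewrite E (exp_sqrD sX sY).
lra.
Qed.

Lemma exp_sum_mul (I : eqType) (r : seq I) (xi : I -> Omega -> K) Y :
  (forall i, i \in r -> sqint Pr setT (xi i)) -> sqint Pr setT Y ->
  \int[Pr]_w ((\sum_(i <- r) xi i w) * Y w) = \sum_(i <- r) \int[Pr]_w (xi i w * Y w).
Proof.
move=> sxi sY; elim: r sxi => [|i r IH] sxi.
  rewrite big_nil; transitivity (\int[Pr]_w (0 : K)).
    by apply: eq_Rintegral => w _; rewrite big_nil mul0r.
  by rewrite /Rintegral integral0.
have sr : forall j, j \in r -> sqint Pr setT (xi j).
  by move=> j jr; apply: sxi; rewrite inE jr orbT.
have si : sqint Pr setT (xi i) by apply: sxi; rewrite mem_head.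
rewrite big_cons -IH// -RintegralD//.
- by apply: eq_Rintegral => w _; rewrite big_cons mulrDl.
- exact: sqintM.
- apply: sqintM => //; elim: r sr {IH sxi} => [|j r IH] sr.
    by under eq_fun do rewrite big_nil; exact: sqint0.
  under eq_fun do rewrite big_cons; apply: sqintD => //.
    by apply: sr; rewrite mem_head.
  by apply: IH => l lr; apply: sr; rewrite inE lr orbT.
Qed.

Lemma sqint_sum_seq (I : eqType) (r : seq I) (xi : I -> Omega -> K) :
  (forall i, i \in r -> sqint Pr setT (xi i)) ->
  sqint Pr setT (fun w => \sum_(i <- r) xi i w).
Proof.
elim: r => [|j r IH] sr.
  by under eq_fun do rewrite big_nil; exact: sqint0.
under eq_fun do rewrite big_cons; apply: sqintD => //.
  by apply: sr; rewrite mem_head.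
by apply: IH => l lr; apply: sr; rewrite inE lr orbT.
Qed.

Lemma exp_sqr_sum_orth (I : eqType) (r : seq I) (xi : I -> Omega -> K) : uniq r ->
  (forall i, i \in r -> sqint Pr setT (xi i)) ->
  (forall i j, i \in r -> j \in r -> i != j -> \int[Pr]_w (xi i w * xi j w) = 0) ->
  \int[Pr]_w (\sum_(i <- r) xi i w) ^+ 2 = \sum_(i <- r) \int[Pr]_w xi i w ^+ 2.
Proof.
elim: r => [|i r IH] /=.
  move=> _ _ _; rewrite big_nil; transitivity (\int[Pr]_w (0 : K)).
    by apply: eq_Rintegral => w _; rewrite big_nil expr0n.
  by rewrite /Rintegral integral0.
move=> /andP[ir ur] sxi oxi.
have sr : forall j, j \in r -> sqint Pr setT (xi j).
  by move=> j jr; apply: sxi; rewrite inE jr orbT.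
have si : sqint Pr setT (xi i) by apply: sxi; rewrite mem_head.
rewrite big_cons -IH//; last first.
  by move=> j l jr lr; apply: oxi; rewrite inE ?jr ?lr orbT.
transitivity (\int[Pr]_w ((\sum_(j <- r) xi j w) + xi i w) ^+ 2).
  by apply: eq_Rintegral => w _; rewrite big_cons addrC.
rewrite exp_sqrD//; last exact: sqint_sum_seq.
rewrite exp_sum_mul// big_seq big1 ?mulr0 ?addr0; first by rewrite addrC.
move=> j jr; apply: oxi; rewrite ?inE ?jr ?eqxx ?orbT//.
by apply: contra ir => /eqP <-.
Qed.

(** Orthogonality to [Y] survives mean-square limits by Cauchy-Schwarz. The tolerance is divided by
    E[Y^2] + 1, which is positive even when [Y] vanishes. *)
Lemma exp_lim_orth X Y : sqint Pr setT X -> sqint Pr setT Y ->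
  (forall e, 0 < e -> exists X', [/\ sqint Pr setT X',
     \int[Pr]_w (X w - X' w) ^+ 2 <= e & \int[Pr]_w (X' w * Y w) = 0]) ->
  \int[Pr]_w (X w * Y w) = 0.
Proof.
move=> sX sY H; apply/eqP; rewrite -sqrf_eq0; apply/eqP/le_anti.
rewrite sqr_ge0 andbT; apply/ler_addgt0Pl => e e0; rewrite addr0.
have D0 : 0 < \int[Pr]_w Y w ^+ 2 + 1 by rewrite ltr_wpDl// exp_sqr_ge0.
have [X' [sX' XX' oX']] := H (e / (\int[Pr]_w Y w ^+ 2 + 1)) (divr_gt0 e0 D0).
have -> : \int[Pr]_w (X w * Y w) = \int[Pr]_w ((X w - X' w) * Y w).
  apply/eqP; rewrite -subr_eq0 -RintegralB//; last 2 first.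
  - exact: sqintM.
  - by apply: sqintM => //; exact: sqintB.
  by apply/eqP; rewrite -[RHS]oX'; apply: eq_Rintegral => w _; ring.
apply: le_trans (Rint_CS mT (sqintB mT sX sX') sY) _.
apply: (@le_trans _ _ (e / (\int[Pr]_w Y w ^+ 2 + 1) * (\int[Pr]_w Y w ^+ 2 + 1))).
  by apply: ler_pM => //; rewrite ?exp_sqr_ge0// lerDl.
by rewrite divfK// gt_eqF.
Qed.

(** The factor 2 comes from (x + y)^2 <= 2 x^2 + 2 y^2; later only the linear dependence on [C]
    matters. *)
Lemma exp_lim_bound X C : sqint Pr setT X ->
  (forall e, 0 < e -> exists X', [/\ sqint Pr setT X',
     \int[Pr]_w (X w - X' w) ^+ 2 <= e & \int[Pr]_w X' w ^+ 2 <= C]) ->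
  \int[Pr]_w X w ^+ 2 <= 2 * C.
Proof.
move=> sX H; apply/ler_addgt0Pl => e e0.
have [X' [sX' XX' bX']] := H (e / 2) (divr_gt0 e0 (ltr0n _ 2)).
have -> : \int[Pr]_w X w ^+ 2 = \int[Pr]_w ((X w - X' w) + X' w) ^+ 2.
  by apply: eq_Rintegral => w _; rewrite subrK.
apply: le_trans (exp_sqrD_le (sqintB mT sX sX') sX') _.
apply: lerD; last by rewrite ler_wpM2l.
by rewrite -ler_pdivlMl// mulrC.
Qed.

End OrthogonalSums.

(** * Wiener sums on uniform partitions *)

Section WienerSums.
Context {d : measure_display} {Omega : measurableType d} {K : realType}.
Variable Pr : probability Omega K.
Context {n : nat}.
Variables (W : nat -> K -> Omega -> K) (x0 : nat -> Omega -> 'cV[K]_n).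
Hypothesis W_bm : forall i, brownian_motion Pr (W i).
Hypothesis W_indep : mutually_indep Pr (fun i => process_sigma (W i)).
Hypothesis x0_rv : forall i, random_vector (x0 i).
Hypothesis x0_W_indep : indep Pr
      (<<s \bigcup_i sigma_gen (coords (x0 i)) >>)
      (<<s \bigcup_i process_sigma (W i) >>).
Let mT : measurable [set: Omega] := measurableT.

(** Independence factors the expectation, and the increment has mean zero. *)
Lemma incr_orth N s i a b Y : 0 <= s -> s <= a -> a < b ->
  fmeas (filtration N x0 W s) Y -> sqint Pr setT Y ->
  \int[Pr]_w ((W i b w - W i a w) * Y w) = 0.
Proof.
move=> s0 sa ab fY sY; have a0 := le_trans s0 sa.
have [sD _ D0] := incr_law W_bm i a0 ab.
have iFD : indep Pr (filtration N x0 W s) (sigma_gen [set W i b \- W i a]).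
  exact: filtration_incr_indep.
have fD : fmeas (sigma_gen [set W i b \- W i a]) (W i b \- W i a).
  exact: fmeas_sigma_gen.
have mF := filtration_measurable (N := N) W_bm x0_rv s0.
have mD : sigma_gen [set W i b \- W i a] `<=` measurable.
  by apply: sigma_gen_measurable => _ ->; case: sD.
have := indep_exp iFD mF mD fY fD sY sD.
rewrite D0 mulr0 => <-; apply: eq_Rintegral => w _ /=; exact: mulrC.
Qed.

Lemma process_indep i j : i != j ->
  indep Pr (process_sigma (W i)) (process_sigma (W j)).
Proof.
move=> ij E E' Ei Ej.
have := W_indep (s := [:: i; j]) (E := fun l => if l == i then E else E').
rewrite /= inE ij => /(_ isT) H.
rewrite !big_cons big_nil mule1 eqxx eq_sym (negbTE ij) in H.
rewrite -H; last first.
  move=> l; rewrite !inE => /orP[|] /eqP ->; first by rewrite eqxx.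
  by rewrite eq_sym (negbTE ij).
congr (Pr _); apply/seteqP; split => w.
  by move=> [wE wE'] l /=; case: eqP.
move=> h; split; first by have := h i; rewrite /= !inE eqxx; exact.
by have := h j; rewrite /= !inE eqxx orbT eq_sym (negbTE ij); exact.
Qed.

Variables (T S : K) (sigma : K -> 'cV[K]_n).
Hypothesis sigma_le : forall t k, 0 <= t <= T -> sigma t k 0 ^+ 2 <= S.

Definition wterm i t m k j w : K :=
  (W i (t * (j.+1%:R / m%:R)) w - W i (t * (j%:R / m%:R)) w)
    * sigma (t * (j%:R / m%:R)) k 0.

Lemma wiener_sum_coord i t m k w :
  wiener_sum sigma (W i) t m w k 0 = \sum_(0 <= j < m) wterm i t m k j w.
Proof. by rewrite summxE big_mkord; apply: eq_bigr => j _; rewrite mxE. Qed.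

Section Grid.
Variables (t : K) (m : nat).
Hypotheses (t0 : 0 < t) (tT : t <= T) (m0 : (0 < m)%N).

Let g (j : nat) := t * (j%:R / m%:R).

Let mR : 0 < m%:R :> K. Proof. by rewrite ltr0n. Qed.

Lemma grid_lt j : g j < g j.+1.
Proof. by rewrite ltr_pM2l// ltr_pM2r ?invr_gt0// ltr_nat. Qed.

Lemma grid_le j l : (j <= l)%N -> g j <= g l.
Proof. by move=> jl; rewrite ler_pM2l// ler_pM2r ?invr_gt0// ler_nat. Qed.

Lemma grid_ge0 j : 0 <= g j.
Proof. by apply: mulr_ge0; [exact: ltW|exact: divr_ge0]. Qed.

Lemma grid_diff j : g j.+1 - g j = t / m%:R.
Proof. by rewrite /g -mulrBr -mulrBl -natrB// subSnn mul1r. Qed.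

Lemma grid_end : g m = t.
Proof. by rewrite /g divff ?mulr1// gt_eqF. Qed.

Lemma grid_le_t j : (j <= m)%N -> g j <= t.
Proof. by move=> jm; rewrite -[leRHS]grid_end; exact: grid_le. Qed.

Lemma wterm_sqint i k j : sqint Pr setT (wterm i t m k j).
Proof.
have [sD _ _] := incr_law W_bm i (grid_ge0 j) (grid_lt j).
apply: eq_sqint (sqintZ mT (sigma (g j) k 0) sD) => w _.
by rewrite /wterm mulrC.
Qed.

Lemma wterm_bound i k j : (j < m)%N -> \int[Pr]_w wterm i t m k j w ^+ 2 <= 8 * S * (t / m%:R).
Proof.
move=> jm.
have [sD bD _] := incr_law W_bm i (grid_ge0 j) (grid_lt j).
have gT : 0 <= g j <= T by rewrite grid_ge0 (le_trans (grid_le_t (ltnW jm))).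
have -> : \int[Pr]_w wterm i t m k j w ^+ 2 =
    sigma (g j) k 0 ^+ 2 * \int[Pr]_w (W i (g j.+1) w - W i (g j) w) ^+ 2.
  rewrite -RintegralZl//; last exact: (sqint_integrable2 sD).
  by apply: eq_Rintegral => w _; rewrite /wterm exprMn mulrC.
have S0 : 0 <= S by apply: le_trans (sigma_le k gT); exact: sqr_ge0.
apply: le_trans (ler_pM _ _ (sigma_le k gT) bD) _.
- exact: sqr_ge0.
- exact: exp_sqr_ge0.
- by rewrite grid_diff mulrCA mulrA.
Qed.

Lemma wterm_orth_past N s i k j Y : 0 <= s -> s <= g j ->
  fmeas (filtration N x0 W s) Y -> sqint Pr setT Y ->
  \int[Pr]_w (wterm i t m k j w * Y w) = 0.
Proof.
move=> s0 sg fY sY.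
have [sD _ _] := incr_law W_bm i (grid_ge0 j) (grid_lt j).
have iDY := sqintM mT sD sY.
transitivity (\int[Pr]_w (sigma (g j) k 0 * ((W i (g j.+1) w - W i (g j) w) * Y w))).
  by apply: eq_Rintegral => w _; rewrite /wterm -/(g j) -/(g j.+1); ring.
by rewrite RintegralZl// (incr_orth i s0 sg (grid_lt j) fY sY) mulr0.
Qed.

Lemma wterm_fmeas N (i : 'I_N) k j u : g j.+1 <= u ->
  fmeas (filtration N x0 W u) (wterm i t m k j).
Proof.
move=> gu; apply: fmeasZ; apply: fmeasB; apply: filtration_fmeas_W.
  by rewrite grid_ge0.
by rewrite grid_ge0 (le_trans _ gu)// ltW// grid_lt.
Qed.

Lemma wterm_orth i k j l : j != l -> \int[Pr]_w (wterm i t m k j w * wterm i t m k l w) = 0.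
Proof.
wlog jl : j l / (j < l)%N.
  move=> H jl; have := jl; rewrite neq_ltn => /orP[?|lj]; first exact: H.
  rewrite -(H l j lj); last by rewrite eq_sym.
  by apply: eq_Rintegral => w _; rewrite mulrC.
move=> _.
(* The filtration of [i.+1] agents is large enough to contain the noise of index [i]; the earlier
   term belongs to the past of the grid point where the later one begins, or of an earlier grid
   point. *)
rewrite -[RHS](@wterm_orth_past i.+1 (g j.+1) i k l (wterm i t m k j)).
- by apply: eq_Rintegral => w _; rewrite mulrC.
- exact: grid_ge0.
- exact: grid_le.
- exact: (@wterm_fmeas i.+1 ord_max).
- exact: wterm_sqint.
Qed.

(** A discrete Ito isometry: terms over different cells are orthogonal, so the second moments of the
    m - c terms add up, each at most 8 S t / m. The tail from cell c represents the increment of the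
    integral from that grid point to t. *)
Lemma wtail_bound i k c : (c <= m)%N ->
  \int[Pr]_w (\sum_(c <= j < m) wterm i t m k j w) ^+ 2
    <= 8 * S * (t * ((m - c)%:R / m%:R)).
Proof.
move=> cm; rewrite exp_sqr_sum_orth ?iota_uniq//; last 2 first.
- by move=> j _; exact: wterm_sqint.
- by move=> j l _ _; exact: wterm_orth.
rewrite big_seq; apply: (@le_trans _ _ (\sum_(c <= j < m) 8 * S * (t / m%:R))).
  rewrite [leRHS]big_seq; apply: ler_sum => j; rewrite mem_index_iota => /andP[_ jm].
  exact: wterm_bound.
by rewrite sumr_const_nat -mulr_natl le_eqVlt; apply/orP; left; apply/eqP; ring.
Qed.

Lemma wtail_sqint i k c : sqint Pr setT (fun w => \sum_(c <= j < m) wterm i t m k j w).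
Proof. by apply: sqint_sum_seq => j _; exact: wterm_sqint. Qed.

Lemma wtail_orth N s i k c Y : 0 <= s -> s <= g c ->
  fmeas (filtration N x0 W s) Y -> sqint Pr setT Y ->
  \int[Pr]_w ((\sum_(c <= j < m) wterm i t m k j w) * Y w) = 0.
Proof.
move=> s0 sc fY sY; rewrite exp_sum_mul//; last by move=> j _; exact: wterm_sqint.
rewrite big_seq big1// => j; rewrite mem_index_iota => /andP[cj _].
by apply: (wterm_orth_past _ _ s0 _ fY sY); rewrite (le_trans sc)// grid_le.
Qed.

Lemma wsum_fmeas N (i : 'I_N) k :
  fmeas (filtration N x0 W t) (fun w => \sum_(0 <= j < m) wterm i t m k j w).
Proof.
under eq_fun do rewrite big_mkord.
apply: fmeas_sum => j; apply: wterm_fmeas; exact: grid_le_t.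
Qed.

End Grid.

Lemma wterm_cross i i' t t' m m' k k' j j' : i != i' -> 0 < t -> 0 < t' ->
  (0 < m)%N -> (0 < m')%N ->
  \int[Pr]_w (wterm i t m k j w * wterm i' t' m' k' j' w) = 0.
Proof.
move=> ii' t0 t0' m0 m0'.
have ge l : 0 <= t * (l%:R / m%:R) by exact: grid_ge0.
have ge' l : 0 <= t' * (l%:R / m'%:R) by exact: grid_ge0.
have a0 := ge j; have b0 := ge j.+1; have a0' := ge' j'; have b0' := ge' j'.+1.
have [sD _ D0] := incr_law W_bm i a0 (grid_lt t0 m0 j).
have [sD' _ D0'] := incr_law W_bm i' a0' (grid_lt t0' m0' j').
have fD : fmeas (process_sigma (W i)) (W i (t * (j.+1%:R / m%:R)) \- W i (t * (j%:R / m%:R))).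
  exact: incr_process_fmeas.
have fD' : fmeas (process_sigma (W i')) (W i' (t' * (j'.+1%:R / m'%:R)) \- W i' (t' * (j'%:R / m'%:R))).
  exact: incr_process_fmeas.
have E := indep_exp (process_indep ii') (process_sigma_measurable W_bm (i:=i))
  (process_sigma_measurable W_bm (i:=i')) fD
  fD' sD sD'.
have iDD := sqintM mT sD sD'.
transitivity (\int[Pr]_w ((sigma (t * (j%:R / m%:R)) k 0 * sigma (t' * (j'%:R / m'%:R)) k' 0) *
    ((W i (t * (j.+1%:R / m%:R)) w - W i (t * (j%:R / m%:R)) w) *
     (W i' (t' * (j'.+1%:R / m'%:R)) w - W i' (t' * (j'%:R / m'%:R)) w)))).
  by apply: eq_Rintegral => w _; rewrite /wterm; ring.
by rewrite RintegralZl// [X in _ * X]E D0 mul0r mulr0.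
Qed.

(* The first [p * l] cells of the uniform partition of [0, t] into [q * l] cells
   form the uniform partition of [0, t * p / q]. *)
Lemma wsum_rat_split i t p q l k w : (0 < p)%N -> (p <= q)%N -> (0 < l)%N ->
  \sum_(0 <= j < q * l) wterm i t (q * l) k j w =
  \sum_(0 <= j < p * l) wterm i (t * (p%:R / q%:R)) (p * l) k j w +
  \sum_((p * l)%N <= j < q * l) wterm i t (q * l) k j w.
Proof.
move=> p0 pq l0; have q0 : (0 < q)%N by exact: leq_trans pq.
rewrite (@big_cat_nat _ _ _ (p * l)%N)//=; last by rewrite leq_mul2r pq orbT.
congr (_ + _); apply: eq_big_nat => j _; rewrite /wterm.
have E (c : nat) : t * (p%:R / q%:R) * (c%:R / (p * l)%:R) = t * (c%:R / (q * l)%:R) :> K.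
  by rewrite !natrM; field; rewrite !pnatr_eq0 -!lt0n p0 q0 l0.
by rewrite !E.
Qed.

End WienerSums.

(** * Wiener integrals as mean-square limits, and their increments *)

Section WienerIntegrals.
Context {d : measure_display} {Omega : measurableType d} {K : realType}.
Variable Pr : probability Omega K.
Context {n : nat}.
Variables (W : nat -> K -> Omega -> K) (x0 : nat -> Omega -> 'cV[K]_n).
Hypothesis W_bm : forall i, brownian_motion Pr (W i).
Hypothesis W_indep : mutually_indep Pr (fun i => process_sigma (W i)).
Hypothesis x0_rv : forall i, random_vector (x0 i).
Hypothesis x0_W_indep : indep Pr
      (<<s \bigcup_i sigma_gen (coords (x0 i)) >>)
      (<<s \bigcup_i process_sigma (W i) >>).
Variables (T S : K) (sigma : K -> 'cV[K]_n).
Hypothesis sigma_le : forall t k, 0 <= t <= T -> sigma t k 0 ^+ 2 <= S.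
Hypothesis S0 : 0 <= S.
Let mT : measurable [set: Omega] := measurableT.

Definition wsum i t m k w : K := \sum_(0 <= j < m) wterm W sigma i t m k j w.

Lemma wsum0 i m k w : wsum i 0 m k w = 0.
Proof. by rewrite /wsum big1// => j _; rewrite /wterm !mul0r subrr mul0r. Qed.

Lemma wsum_sqint i t m k : 0 <= t <= T -> (0 < m)%N -> sqint Pr setT (wsum i t m k).
Proof.
move=> /andP[t0 tT] m0; have [<-|tn0] := eqVneq 0 t.
  by apply: eq_sqint (sqint0 Pr setT) => w _; rewrite wsum0.
have t1 : 0 < t by rewrite lt_neqAle tn0.
exact: (wtail_sqint W_bm sigma t1 m0 i k 0).
Qed.

Lemma wsum_bound i t m k : 0 <= t <= T -> (0 < m)%N ->
  \int[Pr]_w wsum i t m k w ^+ 2 <= 8 * S * t.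
Proof.
move=> /andP[t0 tT] m0; have [<-|tn0] := eqVneq 0 t.
  rewrite mulr0; under eq_Rintegral do rewrite wsum0 expr0n.
  by rewrite /Rintegral integral0.
have t1 : 0 < t by rewrite lt_neqAle tn0.
have := wtail_bound W_bm W_indep x0_rv x0_W_indep sigma_le t1 tT m0 i k (leq0n m).
by rewrite subn0 divff ?mulr1// pnatr_eq0 -lt0n.
Qed.

Lemma wsum_filtration N (i : 'I_N) t m k : 0 <= t <= T -> (0 < m)%N ->
  fmeas (filtration N x0 W t) (wsum i t m k).
Proof.
move=> /andP[t0 tT] m0; have [<-|tn0] := eqVneq 0 t.
  rewrite (_ : wsum _ _ _ _ = fun=> 0); first exact: fmeas_cst.
  by apply/funext => w; rewrite wsum0.
by apply: wsum_fmeas => //; rewrite lt_neqAle tn0.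
Qed.

Lemma wsum_cross i i' t m m' k k' : i != i' -> 0 <= t <= T -> (0 < m)%N ->
  (0 < m')%N -> \int[Pr]_w (wsum i t m k w * wsum i' t m' k' w) = 0.
Proof.
move=> ii' /andP[t0 tT] m0 m0'; have [<-|tn0] := eqVneq 0 t.
  under eq_Rintegral do rewrite wsum0 mul0r.
  by rewrite /Rintegral integral0.
have t1 : 0 < t by rewrite lt_neqAle tn0.
have sw j : sqint Pr setT (wterm W sigma i t m k j) by exact: (wterm_sqint W_bm).
have sw' j : sqint Pr setT (wterm W sigma i' t m' k' j) by exact: (wterm_sqint W_bm).
have ss := wtail_sqint W_bm sigma t1 m0' i' k' 0.
rewrite /wsum exp_sum_mul// big1// => j _; under eq_Rintegral do rewrite mulrC.
rewrite exp_sum_mul// big1// => j' _; apply: (wterm_cross W_bm W_indep) => //.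
by rewrite eq_sym.
Qed.

(** The defining limit bounds the Euclidean norm of the error, which dominates each coordinate. Once
    a single error has finite second moment, the integral is that error plus a Wiener sum and is
    therefore square integrable. *)
Lemma wint_approx i t I : 0 <= t <= T -> is_wiener_integral Pr sigma (W i) t I ->
  sqvec Pr I /\ forall e, 0 < e -> exists2 m0, (0 < m0)%N & forall m k, (m0 <= m)%N ->
    \int[Pr]_w (I w k 0 - wsum i t m k w) ^+ 2 <= e.
Proof.
move=> tT [rvI cI].
have key e : 0 < e -> exists2 m0, (0 < m0)%N & forall m k, (m0 <= m)%N ->
    sqint Pr setT (fun w => I w k 0 - wsum i t m k w) /\
    \int[Pr]_w (I w k 0 - wsum i t m k w) ^+ 2 <= e.
  move=> e0.
  have e1 : (0%:E < e%:E)%E by rewrite lte_fin.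
  have [m0 _ Hm0] := cI _ (open_ereal_lt' e1).
  exists m0.+1 => // m k m0m.
  have m1 : (0 < m)%N by exact: leq_trans m0m.
  have mD l : measurable_fun setT (fun w => I w l 0 - wsum i t m l w).
    by apply: measurable_funB; [exact: rvI|case: (wsum_sqint i l tT m1)].
  have DE l w : (I w - wiener_sum sigma (W i) t m w) l 0 = I w l 0 - wsum i t m l w.
    by rewrite !mxE wiener_sum_coord.
  have le_int : (\int[Pr]_w ((I w k 0 - wsum i t m k w) ^+ 2)%:E <= e%:E)%E.
    apply: le_trans (ltW (Hm0 m (ltnW m0m))).
    apply: ge0_le_integral => //.
    - by move=> w _; rewrite lee_fin sqr_ge0.
    - by apply/measurable_EFinP; exact: measurable_funX.
    - apply/measurable_EFinP.
      under eq_fun do rewrite sqnormE.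
      apply: measurable_sum => l; apply: measurable_funX.
      by under eq_fun do rewrite DE; exact: mD.
    - by move=> w _; rewrite lee_fin -DE sqr_coord_le.
  have sD : sqint Pr setT (fun w => I w k 0 - wsum i t m k w).
    by split => //; apply: le_lt_trans le_int _; rewrite ltry.
  split => //; rewrite -lee_fin /Rintegral fineK//.
  rewrite ge0_fin_numE; first by case: sD.
  by apply: integral_ge0 => w _; rewrite lee_fin sqr_ge0.
split; last first.
  move=> e e0; have [m0 m1 H] := key e e0; exists m0 => // m k mm.
  by have [] := H m k mm.
move=> k; have [m0 m1 H] := key 1 ltr01.
have [sD _] := H m0 k (leqnn _).
by apply: eq_sqint (sqintD mT sD (wsum_sqint i k tT m1)) => w _; rewrite subrK.
Qed.

Lemma wint_sqvec i t I : 0 <= t <= T -> is_wiener_integral Pr sigma (W i) t I ->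
  sqvec Pr I.
Proof. by move=> tT /(wint_approx tT)[]. Qed.

(** The constant is twice that of [wsum_bound], the loss incurred in [exp_lim_bound]. *)
Lemma wint_sq_le i t I k : 0 <= t <= T -> is_wiener_integral Pr sigma (W i) t I ->
  \int[Pr]_w I w k 0 ^+ 2 <= 16 * S * t.
Proof.
move=> tT wI; have [sI ap] := wint_approx tT wI.
have -> : 16 * S * t = 2 * (8 * S * t) by ring.
apply: exp_lim_bound => // e e0; have [m0 m1 H] := ap e e0.
exists (wsum i t m0 k); split; [exact: wsum_sqint|exact: H|exact: wsum_bound].
Qed.

Lemma wint_cross i i' t I I' k k' : i != i' -> 0 <= t <= T ->
  is_wiener_integral Pr sigma (W i) t I -> is_wiener_integral Pr sigma (W i') t I' ->
  \int[Pr]_w (I w k 0 * I' w k' 0) = 0.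
Proof.
move=> ii' tT wI wI'; have [sI ap] := wint_approx tT wI.
have [sI' ap'] := wint_approx tT wI'.
apply: exp_lim_orth => // e e0; have [m0 m1 H] := ap e e0.
exists (wsum i t m0 k); split; [exact: wsum_sqint|exact: H|].
under eq_Rintegral do rewrite mulrC.
apply: exp_lim_orth => //; first exact: wsum_sqint.
move=> e' e'0; have [m0' m1' H'] := ap' e' e'0.
exists (wsum i' t m0' k'); split; [exact: wsum_sqint|exact: H'|].
by apply: wsum_cross => //; rewrite eq_sym.
Qed.

(** The integral up to s may fail to be measurable for the uncompleted past of s, but it is a
    mean-square limit of Wiener sums that are, and [Z] is orthogonal to those. *)
Lemma wint_past N (j : 'I_N) s I Z k : 0 <= s <= T ->
  is_wiener_integral Pr sigma (W j) s I -> sqint Pr setT Z ->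
  (forall Y, fmeas (filtration N x0 W s) Y -> sqint Pr setT Y ->
     \int[Pr]_w (Z w * Y w) = 0) ->
  \int[Pr]_w (Z w * I w k 0) = 0.
Proof.
move=> sT wI sZ oZ; have [sI ap] := wint_approx sT wI.
under eq_Rintegral do rewrite mulrC.
apply: exp_lim_orth => // e e0; have [m0 m1 H] := ap e e0.
exists (wsum j s m0 k); split; [exact: wsum_sqint|exact: H|].
under eq_Rintegral do rewrite mulrC.
by apply: oZ; [exact: wsum_filtration|exact: wsum_sqint].
Qed.

Lemma frac_in t p q : 0 < t -> t <= T -> (0 < p)%N -> (p <= q)%N ->
  0 <= t * (p%:R / q%:R) <= T.
Proof.
move=> t0 tT p0 pq; have q0 : (0 < q)%N by exact: leq_trans pq.
apply/andP; split; first by rewrite mulr_ge0 ?divr_ge0// ltW.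
apply: le_trans tT; rewrite ger_pMr// ler_pdivrMr ?ltr0n// mul1r ler_nat.
exact: pq.
Qed.

(** By [wsum_rat_split] the difference of the Wiener sums for t and t p / q is exactly the sum over
    the last cells. For large l each sum has mean-square error at most e / 4, and the factor 2 of
    [exp_sqrD_le] on both terms gives e. *)
Lemma wint_rat i t p q I J k : 0 < t <= T -> (0 < p)%N -> (p <= q)%N ->
  is_wiener_integral Pr sigma (W i) t I ->
  is_wiener_integral Pr sigma (W i) (t * (p%:R / q%:R)) J ->
  forall e, 0 < e -> exists2 l, (0 < l)%N &
    \int[Pr]_w ((I w k 0 - J w k 0) -
      \sum_((p * l)%N <= j < q * l) wterm W sigma i t (q * l) k j w) ^+ 2 <= e.
Proof.
move=> /andP[t0 tT] p0 pq wI wJ e e0; have q0 : (0 < q)%N by exact: leq_trans pq.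
have tT' : 0 <= t <= T by rewrite ltW.
have sT' : 0 <= t * (p%:R / q%:R) <= T by exact: frac_in.
have e4 : 0 < e / 4 by rewrite divr_gt0.
have [sI ap] := wint_approx tT' wI; have [sJ ap'] := wint_approx sT' wJ.
have [m m0 H] := ap _ e4; have [m' m0' H'] := ap' _ e4.
pose l := maxn m m'.
have l0 : (0 < l)%N by rewrite leq_max m0.
have ql : (m <= q * l)%N by rewrite (leq_trans (leq_maxl m m'))// leq_pmull.
have pl : (m' <= p * l)%N by rewrite (leq_trans (leq_maxr m m'))// leq_pmull.
exists l => //.
have sx : sqint Pr setT (fun w => I w k 0 - wsum i t (q * l) k w).
  by apply: sqintB => //; apply: wsum_sqint => //; rewrite muln_gt0 q0.
have sy : sqint Pr setT (fun w => - (J w k 0 - wsum i (t * (p%:R / q%:R)) (p * l) k w)).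
  by apply: sqintN => //; apply: sqintB => //; apply: wsum_sqint => //; rewrite muln_gt0 p0.
have := exp_sqrD_le sx sy.
have -> : \int[Pr]_w (I w k 0 - wsum i t (q * l) k w +
    - (J w k 0 - wsum i (t * (p%:R / q%:R)) (p * l) k w)) ^+ 2 =
  \int[Pr]_w ((I w k 0 - J w k 0) -
      \sum_((p * l)%N <= j < q * l) wterm W sigma i t (q * l) k j w) ^+ 2.
  apply: eq_Rintegral => w _; congr (_ ^+ 2).
  by rewrite /wsum (wsum_rat_split W sigma i t k w p0 pq l0); ring.
have -> : \int[Pr]_w (- (J w k 0 - wsum i (t * (p%:R / q%:R)) (p * l) k w)) ^+ 2 =
    \int[Pr]_w (J w k 0 - wsum i (t * (p%:R / q%:R)) (p * l) k w) ^+ 2.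
  by apply: eq_Rintegral => w _; rewrite sqrrN.
by move: (H _ k ql) (H' _ k pl); lra.
Qed.

(** The increment is a mean-square limit of sums over cells to the right of t p / q, each orthogonal
    to the past of that time. *)
Lemma wint_rat_orth N i t p q I J k Y : 0 < t <= T -> (0 < p)%N -> (p <= q)%N ->
  is_wiener_integral Pr sigma (W i) t I ->
  is_wiener_integral Pr sigma (W i) (t * (p%:R / q%:R)) J ->
  fmeas (filtration N x0 W (t * (p%:R / q%:R))) Y -> sqint Pr setT Y ->
  \int[Pr]_w ((I w k 0 - J w k 0) * Y w) = 0.
Proof.
move=> tT p0 pq wI wJ fY sY; have q0 : (0 < q)%N by exact: leq_trans pq.
have /andP[t0 tT'] := tT.
have sT : 0 <= t * (p%:R / q%:R) <= T by exact: frac_in.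
have sI : sqvec Pr I by apply: wint_sqvec wI; rewrite ltW.
have sJ : sqvec Pr J by exact: wint_sqvec wJ.
apply: exp_lim_orth => //; first exact: sqintB.
move=> e e0; have [l l0 H] := wint_rat k tT p0 pq wI wJ e0.
have ql0 : (0 < q * l)%N by rewrite muln_gt0 q0.
exists (fun w => \sum_((p * l)%N <= j < q * l) wterm W sigma i t (q * l) k j w).
split => //; first exact: (wtail_sqint W_bm).
apply: (wtail_orth W_bm W_indep x0_rv x0_W_indep sigma t0 ql0 i k _ _ fY sY).
  by have /andP[] := sT.
rewrite ler_pM2l// le_eqVlt; apply/orP; left; apply/eqP.
by rewrite !natrM; field; rewrite !pnatr_eq0 -!lt0n q0 l0.
Qed.

Lemma wint_rat_bound i t p q I J k : 0 < t <= T -> (0 < p)%N -> (p <= q)%N ->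
  is_wiener_integral Pr sigma (W i) t I ->
  is_wiener_integral Pr sigma (W i) (t * (p%:R / q%:R)) J ->
  \int[Pr]_w (I w k 0 - J w k 0) ^+ 2 <= 16 * S * (t * ((q - p)%:R / q%:R)).
Proof.
move=> tT p0 pq wI wJ; have q0 : (0 < q)%N by exact: leq_trans pq.
have /andP[t0 tT'] := tT.
have sT : 0 <= t * (p%:R / q%:R) <= T by exact: frac_in.
have sI : sqvec Pr I by apply: wint_sqvec wI; rewrite ltW.
have sJ : sqvec Pr J by exact: wint_sqvec wJ.
have -> : 16 * S * (t * ((q - p)%:R / q%:R)) = 2 * (8 * S * (t * ((q - p)%:R / q%:R))).
  by ring.
apply: exp_lim_bound => //; first exact: sqintB.
move=> e e0; have [l l0 H] := wint_rat k tT p0 pq wI wJ e0.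
have ql0 : (0 < q * l)%N by rewrite muln_gt0 q0.
exists (fun w => \sum_((p * l)%N <= j < q * l) wterm W sigma i t (q * l) k j w).
split => //; first exact: (wtail_sqint W_bm).
have pql : (p * l <= q * l)%N by rewrite leq_mul2r pq orbT.
have := wtail_bound W_bm W_indep x0_rv x0_W_indep sigma_le t0 tT' ql0 i k pql.
rewrite -mulnBl !natrM => /le_trans; apply; rewrite le_eqVlt; apply/orP; left; apply/eqP.
by field; rewrite !pnatr_eq0 -!lt0n q0 l0.
Qed.

(** The approximation is from above, so that the past of s is contained in the past of every
    approximating fraction. *)
Lemma frac_above (s u : K) : 0 <= s -> s < u -> exists p : nat -> nat, forall l,
  [/\ (0 < p l)%N, (p l <= l.+1)%N, s <= u * ((p l)%:R / l.+1%:R) &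
   u * ((p l)%:R / l.+1%:R) <= s + u * l.+1%:R^-1].
Proof.
move=> s0 su; have u0 : 0 < u by exact: le_lt_trans su.
(* The floor plus one: positive even for s = 0, and at most l + 1 because s < u. *)
exists (fun l => (Num.truncn (l.+1%:R * s / u)).+1) => l.
have l0 : 0 < l.+1%:R :> K by rewrite ltr0n.
have z0 : 0 <= l.+1%:R * s / u by rewrite divr_ge0 ?mulr_ge0// ltW.
have /andP[h1 h2] := truncn_itv z0.
split => //.
- by rewrite truncn_lt_nat// -mulrA gtr_pMr// ltr_pdivrMr// mul1r.
- move: h2; rewrite ltr_pdivrMr// => /ltW h2.
  by rewrite mulrA ler_pdivlMr// mulrC (le_trans h2)// mulrC.
- rewrite -addn1 natrD mulrDl mulrDr mul1r lerD2r.
  by move: h1; rewrite ler_pdivlMr// => h1; rewrite mulrA ler_pdivrMr// mulrC (mulrC s).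
Qed.

(* Fatou along the fractions of [u] given by [frac_above], where the bound follows
   from a common partition, using continuity of the paths. *)
Lemma wint_increment_bound i (s u : K) (I : K -> Omega -> 'cV[K]_n) k : 0 <= s -> s < u -> u <= T ->
  (forall u, 0 <= u <= T -> is_wiener_integral Pr sigma (W i) u (I u)) ->
  {ae Pr, forall w, mxcont T (I ^~ w)} ->
  \int[Pr]_w (I u w k 0 - I s w k 0) ^+ 2 <= 16 * S * (u - s).
Proof.
move=> s0 su uT wI cI; have u0 : 0 < u by exact: le_lt_trans su.
have [p Hp] := frac_above s0 su.
pose r l := u * ((p l)%:R / l.+1%:R).
have rT l : 0 <= r l <= T by have [p0 pl _ _] := Hp l; exact: frac_in.
have sT : 0 <= s <= T by rewrite s0 (le_trans (ltW su)).
have uT' : 0 <= u <= T by rewrite ltW.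
have sI v : 0 <= v <= T -> sqint Pr setT (fun w => I v w k 0).
  by move=> vT; apply: (wint_sqvec vT (wI _ vT)).
pose F v w : \bar K := ((I u w k 0 - I v w k 0) ^+ 2)%:E.
have mF v : 0 <= v <= T -> measurable_fun setT (F v).
  move=> vT; apply/measurable_EFinP; apply: measurable_funX; apply: measurable_funB.
    by case: (sI u uT').
  by case: (sI v vT).
have F0 v w : (0 <= F v w)%E by rewrite lee_fin sqr_ge0.
have sD v : 0 <= v <= T -> sqint Pr setT (fun w => I u w k 0 - I v w k 0).
  by move=> vT; apply: sqintB => //; exact: sI.
have iF v : 0 <= v <= T -> Pr.-integrable setT (F v).
  by move=> vT; apply: sqint_integrable2; exact: sD.
have Fle l : (\int[Pr]_w F (r l) w <= (16 * S * (u - s))%:E)%E.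
  have [p0 pl sr _] := Hp l.
  have := wint_rat_bound k (_ : 0 < u <= T) p0 pl (wI _ uT') (wI _ (rT l)).
  rewrite u0 uT => /(_ isT) H.
  have ff : (\int[Pr]_w F (r l) w)%E \is a fin_num.
    by apply: integrable_fin_num => //; exact: iF.
  rewrite -[X in (X <= _)%E]fineK// lee_fin.
  apply: le_trans H _; apply: ler_wpM2l; first by rewrite mulr_ge0.
  rewrite natrB// mulrBl mulrBr divff ?mulr1?pnatr_eq0// lerD2l lerN2.
  exact: sr.
have rs : r l @[l --> \oo] --> s.
  apply: (@squeeze_cvgr _ _ _ _ (fun=> s) (fun l => s + u * l.+1%:R^-1)).
  - by apply: nearW => l; have [_ _ -> ->] := Hp l.
  - exact: cvg_cst.
  - rewrite -[X in _ --> X](addr0 s); apply: cvgD; first exact: cvg_cst.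
    rewrite -[X in _ --> X](mulr0 u); apply: cvgM; first exact: cvg_cst.
    exact: cvg_harmonic.
(* [E] is a null set off which the paths are continuous; the pointwise limit is identified on its
   complement only. *)
have [E [mE PE HE]] := cI.
have PE0 : Pr E = 0%E by [].
have mD : measurable (setT `\` E) by exact: measurableD.
have lim w : (setT `\` E) w -> limn_einf (fun l => F (r l) w) = F s w.
  move=> [_ Ew]; have ck : mxcont T (I ^~ w).
    by apply: contrapT => ncw; apply: Ew; exact: HE.
  apply: (fun h => (cvg_limn_einf_sup h).1).
  apply: cvg_EFin; first exact: nearW.
  have cI' : I (r l) w k 0 @[l --> \oo] --> I s w k 0.
    have /subspace_continuousP /(_ s) H := ck k 0.
    have sI' : [set` `[0, T]] s by rewrite /= in_itv.
    apply: (cvg_comp r (fun v => I v w k 0) _ (H sI')).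
    move=> B /= nB; near=> l.
    have : [set` `[0, T]] (r l) -> B (r l).
      by near: l; exact: (rs _ nB).
    by apply; rewrite /= in_itv/=; exact: rT.
  apply: cvgM.
    by apply: cvgB; [exact: cvg_cst|exact: cI'].
  by apply: cvgB; [exact: cvg_cst|exact: cI'].
rewrite -lee_fin /Rintegral fineK; last by apply: integrable_fin_num => //; exact: iF.
rewrite (negligible_integral mE mT (iF s sT) PE0).
rewrite -(eq_integral _ (fun w => limn_einf (fun l => F (r l) w))); last first.
  by move=> w; rewrite inE => wD; rewrite lim.
apply: le_trans (fatou Pr mD _ _) _.
- by move=> l; apply: measurable_funTS; exact: mF.
- by move=> l w _.
rewrite limn_einf_lim; apply: lime_le; first exact: is_cvg_einfs.
apply: nearW => l; apply: le_trans (Fle l).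
apply: (@le_trans _ _ (\int[Pr]_(w in setT `\` E) F (r l) w)%E).
  by apply: ereal_inf_lbound; exists l => /=.
by apply: ge0_subset_integral => //; exact: mF.
Unshelve. all: by end_near.
Qed.

(** From a fraction r >= s of t up to t, [wint_rat_orth] gives orthogonality to the past of r, hence
    to that of s. The remaining increment from s to r is small in mean square by
    [wint_increment_bound]. *)
Lemma wint_orth N i (s t : K) (I : K -> Omega -> 'cV[K]_n) k Y : 0 <= s -> s <= t -> t <= T ->
  (forall u, 0 <= u <= T -> is_wiener_integral Pr sigma (W i) u (I u)) ->
  {ae Pr, forall w, mxcont T (I ^~ w)} ->
  fmeas (filtration N x0 W s) Y -> sqint Pr setT Y ->
  \int[Pr]_w ((I t w k 0 - I s w k 0) * Y w) = 0.
Proof.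
move=> s0; rewrite le_eqVlt => /orP[/eqP <- _ _ _ _ _|st tT wI cI fY sY].
  by under eq_Rintegral do rewrite subrr mul0r; rewrite /Rintegral integral0.
have t0 : 0 < t by exact: le_lt_trans st.
have [p Hp] := frac_above s0 st.
pose r l := t * ((p l)%:R / l.+1%:R).
have rT l : 0 <= r l <= T by have [p0 pl _ _] := Hp l; exact: frac_in.
have sT : 0 <= s <= T by rewrite s0 (le_trans (ltW st)).
have tT' : 0 <= t <= T by rewrite ltW.
have sI v : 0 <= v <= T -> sqint Pr setT (fun w => I v w k 0).
  by move=> vT; apply: (wint_sqvec vT (wI _ vT)).
apply: exp_lim_orth => //; first by apply: sqintB => //; exact: sI.
move=> e e0.
pose c := 16 * S * t.
have c0 : 0 <= c by rewrite !mulr_ge0// ltW.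
(* Then c / (l + 1) <= e, while r exceeds s by at most t / (l + 1). *)
pose l := Num.truncn (c / e).
have [p0 pl sr rle] := Hp l.
exists (fun w => I t w k 0 - I (r l) w k 0); split.
- by apply: sqintB => //; exact: sI.
- have -> : \int[Pr]_w (I t w k 0 - I s w k 0 - (I t w k 0 - I (r l) w k 0)) ^+ 2 =
      \int[Pr]_w (I (r l) w k 0 - I s w k 0) ^+ 2.
    by apply: eq_Rintegral => w _; congr (_ ^+ 2); ring.
  move: (sr); rewrite -/(r l) le_eqVlt => /orP[/eqP <-|sr'].
    under eq_Rintegral do rewrite subrr expr0n.
    by rewrite /Rintegral integral0 ltW.
  have rT' : r l <= T by have /andP[] := rT l.
  apply: le_trans (wint_increment_bound k s0 sr' rT' wI cI) _.
  apply: (@le_trans _ _ (16 * S * (t * l.+1%:R^-1))).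
    by apply: ler_wpM2l; rewrite ?mulr_ge0// lerBlDl.
  rewrite mulrA -/c ler_pdivrMr ?ltr0n// mulrC -ler_pdivrMr//.
  exact/ltW/truncnS_gt.
- have tT0 : 0 < t <= T by rewrite t0.
  apply: (wint_rat_orth (N := N) k tT0 p0 pl (wI _ tT') (wI _ (rT l)) _ sY).
  apply: fmeas_sub fY; exact: filtration_mono.
Qed.
End WienerIntegrals.

(** * Measurable processes and almost sure identities *)

Section ProcessCalculus.
Context {d : measure_display} {Omega : measurableType d} {K : realType}.
Variables (Pr : probability Omega K) (T : K).
Hypothesis T0 : 0 <= T.
Local Notation leb := (@lebesgue_measure K).
Local Notation IT := ([set` `[0, T]] : set (measurableTypeR K)).
Local Notation ET := (IT `*` [set: Omega]).
Local Notation tw := (leb \x Pr)%E.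
Local Notation process k := (K -> Omega -> 'cV[K]_k).
Local Notation sqproc := (sqproc Pr T).
Local Notation pnorm := (pnorm Pr T).
Local Notation sqvec := (sqvec Pr).
Local Notation mproc := (@measurable_process d Omega K _ T).

Let mT : measurable [set: Omega] := measurableT.
Let mIT : measurable IT. Proof. exact: measurable_itv. Qed.
Let mET : measurable ET. Proof. exact: measurableX. Qed.

Lemma eq_mproc k (X Y : process k) : (forall t w, X t w = Y t w) -> mproc X -> mproc Y.
Proof. by move=> XY mX j; apply: eq_measurable_fun (mX j) => p _; rewrite XY. Qed.

Lemma mprocD k (X Y : process k) : mproc X -> mproc Y -> mproc (fun t w => X t w + Y t w).
Proof.
move=> mX mY j; apply: eq_measurable_fun (measurable_funD (mX j) (mY j)) => p _.
by rewrite mxE.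
Qed.

Lemma mprocN k (X : process k) : mproc X -> mproc (fun t w => - X t w).
Proof.
move=> mX j; apply: eq_measurable_fun (measurable_funN (mX j)) => p _.
by rewrite mxE.
Qed.

Lemma mprocB k (X Y : process k) : mproc X -> mproc Y -> mproc (fun t w => X t w - Y t w).
Proof. by move=> mX mY; apply: mprocD => //; exact: mprocN. Qed.

Lemma mproc_sum (I : Type) (s : seq I) k (X : I -> process k) :
  (forall i, mproc (X i)) -> mproc (fun t w => \sum_(i <- s) X i t w).
Proof.
move=> mX j.
have : measurable_fun ET (fun p : measurableTypeR K * Omega => \sum_(i <- s) X i p.1 p.2 j 0).
  by apply: measurable_sum => i; exact: mX.
by apply: eq_measurable_fun => p _; rewrite summxE.
Qed.

Lemma mproc_mulmx m k (M : K -> 'M[K]_(m, k)) (X : process k) : mxcont T M ->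
  mproc X -> mproc (fun t w => M t *m X t w).
Proof.
move=> cM mX j.
have : measurable_fun ET (fun p : measurableTypeR K * Omega =>
    \sum_i M p.1 j i * X p.1 p.2 i 0).
  apply: measurable_sum => i; apply: measurable_funM; last exact: mX.
  apply: (measurable_rect_fst (f := fun t => M t j i)) => //.
  exact: within_cont_measurable.
by apply: eq_measurable_fun => p _; rewrite mxE.
Qed.

Lemma mprocZ k c (X : process k) : mproc X -> mproc (fun t w => c *: X t w).
Proof.
move=> mX; apply: (@eq_mproc _ (fun t w => c%:M *m X t w)).
  by move=> t w; rewrite mul_scalar_mx.
by apply: mproc_mulmx => //; exact: mxcont_cst.
Qed.

Lemma mproc_det k (f : K -> 'cV[K]_k) : mxcont T f -> mproc (fun t _ => f t).
Proof.
move=> cf j; apply: (measurable_rect_fst (f := fun t => f t j 0)) => //.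
exact: within_cont_measurable.
Qed.

Lemma sqproc_bounded k c (X : process k) : mproc X ->
  (forall t, 0 <= t <= T -> sqvec (X t)) ->
  (forall t j, 0 <= t <= T -> \int[Pr]_w X t w j 0 ^+ 2 <= c) ->
  sqproc X /\ pnorm X <= k%:R * (c * T).
Proof.
move=> mX sX bX.
have mS j : measurable_fun ET (fun p : measurableTypeR K * Omega => (X p.1 p.2 j 0 ^+ 2)%:E).
  by apply/measurable_EFinP/measurable_funX; exact: mX.
have le j : (\int[tw]_(p in ET) (X p.1 p.2 j 0 ^+ 2)%:E <= (c * T)%:E)%E.
  rewrite (@tonelli_rect1 _ _ _ _ _ leb Pr IT setT mIT mT (fun p => (X p.1 p.2 j 0 ^+ 2)%:E))//;
    last by move=> p _; rewrite lee_fin sqr_ge0.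
  apply: (@le_trans _ _ (\int[leb]_(t in IT) cst c%:E t)%E); last first.
    rewrite integral_cst//= lebesgue_measure_itv /= lte_fin.
    case: ltP => [_|T00]; first by rewrite sube0 -EFinM.
    have -> : T = 0 by apply/le_anti; rewrite T0 T00.
    by rewrite mule0 mulr0.
  apply: ge0_le_integral => //.
  - by move=> t _; apply: integral_ge0 => w _; rewrite lee_fin sqr_ge0.
  - apply: (@measurable_tonelli_rect1 _ _ _ _ _ Pr IT setT mIT mT
      (fun p => (X p.1 p.2 j 0 ^+ 2)%:E)) => //.
    by move=> p _; rewrite lee_fin sqr_ge0.
  - move=> t; rewrite /= in_itv/= => tT.
    rewrite -[leLHS]fineK ?lee_fin; first exact: bX.
    by apply: integrable_fin_num => //; exact: (sqint_integrable2 (sX t tT j)).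
have sP : sqproc X.
  by move=> j; split; [exact: mX|exact: le_lt_trans (le j) (ltry _)].
split => //.
have -> : pnorm X = \sum_j \int[tw]_(p in ET) X p.1 p.2 j 0 ^+ 2.
  rewrite -Rint_sum//; last by move=> j; exact: sqint_integrable2.
  by apply: eq_Rintegral => p _; rewrite sqnormE.
rewrite mulr_natl -[X in _ *+ X]card_ord -sumr_const; apply: ler_sum => j _.
rewrite -lee_fin /Rintegral fineK; first exact: le.
by apply: integrable_fin_num => //; exact: sqint_integrable2 (sP j).
Qed.

Lemma cont_sqpath k (X : K -> 'cV[K]_k) : mxcont T X -> sqpath T X.
Proof.
move=> cX j; have [c Hc] := within_cont_bounded (cX j 0).
apply: sqint_le (sqint_cst_itv T c) _ => //; first exact: within_cont_measurable.
move=> t; rewrite /= in_itv/= => tT; rewrite (le_trans (Hc t tT))//.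
exact: ler_norm.
Qed.

Lemma exp_sqr_eq0_ae (X : Omega -> K) : sqint Pr setT X ->
  \int[Pr]_w X w ^+ 2 = 0 -> {ae Pr, forall w, X w = 0}.
Proof.
move=> sX X0; have iX := sqint_integrable2 sX.
have : (\int[Pr]_w `|(X w ^+ 2)%:E| = 0)%E.
  under eq_integral do rewrite gee0_abs ?lee_fin ?sqr_ge0//.
  by rewrite -[LHS]fineK ?(integrable_fin_num mT iX)//; congr (_%:E); exact: X0.
move=> /(ae_eq_integral_abs Pr mT (measurable_int _ iX)).
apply: filterS => w /(_ Logic.I) [] /eqP.
by rewrite sqrf_eq0 => /eqP.
Qed.

Lemma ae_forall_ord N (P : 'I_N -> Omega -> Prop) :
  (forall j, {ae Pr, forall w, P j w}) -> {ae Pr, forall w, forall j, P j w}.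
Proof.
move=> H.
have : {ae Pr, forall w, forall m (j : 'I_N), m = j :> nat -> P j w}.
  apply: ae_foralln => m; have [mn|nm] := ltnP m N.
    have := H (Ordinal mn); apply: filterS => w E k mk.
    by rewrite (_ : k = Ordinal mn)//; exact: val_inj.
  by apply: aeW => w k mk; move: nm; rewrite mk leqNgt ltn_ord.
by apply: filterS => w E j; exact: (E j).
Qed.

(** The exceptional sets are united over the countably many rational multiples of T, and continuity
    of the paths extends the identity to all times off one null set. *)
Lemma ae_forall_time k (F : process k) :
  (forall t, 0 <= t <= T -> {ae Pr, forall w, F t w = 0}) ->
  {ae Pr, forall w, mxcont T (F ^~ w)} ->
  {ae Pr, forall w, forall t, 0 <= t <= T -> F t w = 0}.
Proof.
move=> F0 cF.
have [T00|Tn0] := eqVneq 0 T.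
  have := F0 0; rewrite lexx T0 => /(_ isT); apply: filterS => w Fw t.
  by rewrite -T00 => /le_anti <-.
have Tgt0 : 0 < T by rewrite lt_neqAle Tn0.
have : {ae Pr, forall w, forall l : nat, forall p : nat, (0 < p <= l.+1)%N ->
    F (T * (p%:R / l.+1%:R)) w = 0}.
  apply: ae_foralln => l; apply: ae_foralln => p.
  have [pl|pl] := boolP (0 < p <= l.+1)%N; last by apply: aeW => w //.
  have /andP[p0 pl'] := pl.
  have := F0 (T * (p%:R / l.+1%:R)) (frac_in Tgt0 (lexx T) p0 pl').
  by apply: filterS => w Fw _.
move: cF; apply: filterS2 => w cw Fw t tT.
(* [frac_above] requires t < T; the end point is itself the fraction 1 / 1 of T. *)
have [->|tnT] := eqVneq t T.
  by rewrite -(mulr1 T) -(divr1 1); apply: (Fw 0%N 1%N).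
have tT' : t < T by rewrite lt_neqAle tnT; case/andP: tT.
have t0 : 0 <= t by case/andP: tT.
have [p Hp] := frac_above t0 tT'.
pose r l := T * ((p l)%:R / l.+1%:R).
have rs : r l @[l --> \oo] --> t.
  apply: (@squeeze_cvgr _ _ _ _ (fun=> t) (fun l => t + T * l.+1%:R^-1)).
  - by apply: nearW => l; have [_ _ -> ->] := Hp l.
  - exact: cvg_cst.
  - rewrite -[X in _ --> X](addr0 t); apply: cvgD; first exact: cvg_cst.
    rewrite -[X in _ --> X](mulr0 T); apply: cvgM; first exact: cvg_cst.
    exact: cvg_harmonic.
apply/matrixP => i j; rewrite mxE.
have /subspace_continuousP /(_ t) H := cw i j.
have sI' : [set` `[0, T]] t by rewrite /= in_itv.
have L : F (r l) w i j @[l --> \oo] --> F t w i j.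
  apply: (cvg_comp r (fun v => F v w i j) _ (H sI')).
  move=> B /= nB; near=> l.
  have : [set` `[0, T]] (r l) -> B (r l).
    by near: l; exact: (rs _ nB).
  by apply; rewrite /= in_itv/=; have [p0 pl _ _] := Hp l; exact: frac_in.
have L0 : F (r l) w i j @[l --> \oo] --> (0 : K).
  rewrite (_ : (fun l => _) = fun=> 0); first exact: cvg_cst.
  by apply/funext => l; have [p0 pl _ _] := Hp l; rewrite Fw ?mxE// p0.
exact: (cvg_unique _ L L0).
Unshelve. all: by end_near.
Qed.

(** Turns the iterated extended-real integral of [cost] into a real integral over the product, where
    the cost gap is computed. *)
Lemma expected_time_integral (F : measurableTypeR K * Omega -> K) :
  tw.-integrable ET (EFin \o F) ->
  (\int[Pr]_w \int[leb]_(t in IT) (F (t, w))%:E =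
   (\int[tw]_(p in ET) F p)%R%:E)%E.
Proof.
move=> iF.
have i2 := integrable_rect2e mIT mT iF.
have [_ ->] := fine_integrable mT i2.
rewrite (fubini_rect2 mIT mT iF) /Rintegral fineK//.
apply: integrable_fin_num => //; exact: (integrable_rect2 mIT mT iF).
Qed.

Lemma sqproc_dotv k (X Y : process k) : sqproc X -> sqproc Y ->
  tw.-integrable ET (EFin \o (fun p => dotv (X p.1 p.2) (Y p.1 p.2))).
Proof.
move=> sX sY.
rewrite (_ : EFin \o _ = fun p => \sum_(j < k) (X p.1 p.2 j 0 * Y p.1 p.2 j 0)%:E)%E; last first.
  by apply/funext => p; rewrite /= dotvE sumEFin.
apply: integrable_sum => // j _.
exact: sqintM (sX j) (sY j).
Qed.

End ProcessCalculus.

Section WienerUniqueness.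
Context {d : measure_display} {Omega : measurableType d} {K : realType}.
Variable Pr : probability Omega K.
Context {n : nat}.
Variable W : nat -> K -> Omega -> K.
Hypothesis W_bm : forall i, brownian_motion Pr (W i).
Variables (T : K) (sigma : K -> 'cV[K]_n).
Let mT : measurable [set: Omega] := measurableT.

(** Both are mean-square limits of the same Wiener sums. This is why the noise cancels between two
    solutions driven by different controls. *)
Lemma wint_unique i t (I J : Omega -> 'cV[K]_n) : 0 <= t <= T ->
  is_wiener_integral Pr sigma (W i) t I -> is_wiener_integral Pr sigma (W i) t J ->
  {ae Pr, forall w, I w = J w}.
Proof.
move=> tT wI wJ.
have [sI aI] := wint_approx W_bm tT wI; have [sJ aJ] := wint_approx W_bm tT wJ.
have E0 k : \int[Pr]_w (I w k 0 - J w k 0) ^+ 2 = 0.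
  apply/le_anti; rewrite exp_sqr_ge0 andbT; apply/ler_addgt0Pl => e e0; rewrite addr0.
  have e4 : 0 < e / 4 by rewrite divr_gt0.
  have [m m0 H] := aI _ e4; have [m' m0' H'] := aJ _ e4.
  pose l := maxn m m'.
  have l0 : (0 < l)%N by rewrite leq_max m0.
  have s1 : sqint Pr setT (fun w => I w k 0 - wsum W sigma i t l k w).
    by apply: sqintB => //; exact: (wsum_sqint W_bm sigma i k tT).
  have s2 : sqint Pr setT (fun w => - (J w k 0 - wsum W sigma i t l k w)).
    by apply: sqintN => //; apply: sqintB => //; exact: (wsum_sqint W_bm sigma i k tT).
  have := exp_sqrD_le s1 s2.
  have -> : \int[Pr]_w (- (J w k 0 - wsum W sigma i t l k w)) ^+ 2 =
      \int[Pr]_w (J w k 0 - wsum W sigma i t l k w) ^+ 2.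
    by apply: eq_Rintegral => w _; rewrite sqrrN.
  have -> : \int[Pr]_w (I w k 0 - wsum W sigma i t l k w
        + - (J w k 0 - wsum W sigma i t l k w)) ^+ 2 =
      \int[Pr]_w (I w k 0 - J w k 0) ^+ 2.
    by apply: eq_Rintegral => w _; congr (_ ^+ 2); ring.
  by move: (H l k (leq_maxl _ _)) (H' l k (leq_maxr _ _)); lra.
have : forall k : 'I_n, {ae Pr, forall w, I w k 0 - J w k 0 = 0}.
  by move=> k; apply: exp_sqr_eq0_ae => //; exact: sqintB.
move=> /ae_forall_ord; apply: filterS => w E; apply/matrixP => k l; rewrite ord1.
by apply/eqP; rewrite -subr_eq0; apply/eqP; exact: E.
Qed.

End WienerUniqueness.

(** * The closed-loop system *)

Section DrivingNoise.
Context {d : measure_display} {Omega : measurableType d} {K : realType}.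
Variable Pr : probability Omega K.
Context {n : nat}.
Local Notation process k := (K -> Omega -> 'cV[K]_k).
Local Notation leb := (@lebesgue_measure K).
Variables (W : nat -> K -> Omega -> K) (x0 : nat -> Omega -> 'cV[K]_n) (C0 : K).
Hypothesis W_bm : forall i, brownian_motion Pr (W i).
Hypothesis W_indep : mutually_indep Pr (fun i => process_sigma (W i)).
Hypothesis x0_rv : forall i, random_vector (x0 i).
Hypothesis x0_bound : forall i, (\int[Pr]_w (sqnorm (x0 i w))%:E < C0%:E)%E.
Hypothesis x0_W_indep : indep Pr
      (<<s \bigcup_i sigma_gen (coords (x0 i)) >>)
      (<<s \bigcup_i process_sigma (W i) >>).
Variables (T S : K) (sigma : K -> 'cV[K]_n).
Hypothesis T0 : 0 <= T.
Hypothesis sigma_le : forall t k, 0 <= t <= T -> sigma t k 0 ^+ 2 <= S.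
Hypothesis S0 : 0 <= S.
Let mT : measurable [set: Omega] := measurableT.

Lemma init_sqint i k : sqint Pr setT (fun w => x0 i w k 0) /\
  \int[Pr]_w x0 i w k 0 ^+ 2 <= C0.
Proof.
have le : (\int[Pr]_w (x0 i w k 0 ^+ 2)%:E <= \int[Pr]_w (sqnorm (x0 i w))%:E)%E.
  apply: ge0_le_integral => //.
  - by move=> w _; rewrite lee_fin sqr_ge0.
  - by apply/measurable_EFinP/measurable_funX; exact: x0_rv.
  - apply/measurable_EFinP; under eq_fun do rewrite sqnormE.
    by apply: measurable_sum => l; apply: measurable_funX; exact: x0_rv.
  - by move=> w _; rewrite lee_fin sqr_coord_le.
have lt := le_lt_trans le (x0_bound i).
have sx : sqint Pr setT (fun w => x0 i w k 0).
  by split; [exact: x0_rv|exact: lt_trans lt (ltry _)].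
split => //; rewrite -lee_fin /Rintegral fineK; first exact: ltW.
by apply: integrable_fin_num => //; exact: sqint_integrable2 sx.
Qed.

(** The state with its drift integral removed, that is, initial state plus Wiener integral.
    Extracted from the solution itself, it has almost surely continuous paths without any choice of
    a version of the stochastic integral. *)
Definition noise (b X : process n) : process n :=
  fun t w => X t w - time_integral (b ^~ w) t.

Section SingleSolution.
Variables (i : nat) (b X : process n).
Hypothesis sde : sde_solution Pr T b sigma (W i) (x0 i) X.
Hypothesis mb : @measurable_process d Omega K n T b.

Lemma noise_wint t : 0 <= t <= T ->
  is_wiener_integral Pr sigma (W i) t (fun w => noise b X t w - x0 i w).
Proof.
have [_ _ _ H] := sde => /H; congr (is_wiener_integral _ _ _ _ _).
by apply/funext => w; rewrite /noise addrAC.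
Qed.

Lemma sde_mxcont : {ae Pr, forall w, mxcont T (X ^~ w)}.
Proof. by have [_ + _ _] := sde; apply: filterS => w; exact: mxcont_within. Qed.

Lemma sde_integ : {ae Pr, forall w, forall j, integ T (fun t => b t w j 0)}.
Proof. by have [_ _ + _] := sde; apply: filterS => w h j; exact: h. Qed.

Lemma noise_mxcont : {ae Pr, forall w, mxcont T (fun t => noise b X t w - x0 i w)}.
Proof.
move: sde_mxcont sde_integ; apply: filterS2 => w cX ib.
apply: mxcontB; last exact: mxcont_cst.
apply: mxcontB => // j l; rewrite ord1.
apply: eq_within_cont (prim_continuous T0 (ib j)) => t.
by rewrite /time_integral mxE.
Qed.

Lemma noise_mproc : @measurable_process d Omega K n T (noise b X).
Proof.
have [mX _ _ _] := sde.
by apply: mprocB => //; exact: measurable_time_integral.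
Qed.

(** The initial state contributes 2 C0 and the Wiener integral twice 16 S T. *)
Lemma noise_bound t k : 0 <= t <= T -> sqint Pr setT (fun w => noise b X t w k 0) /\
  \int[Pr]_w noise b X t w k 0 ^+ 2 <= 2 * C0 + 32 * S * T.
Proof.
move=> tT; have wI := noise_wint tT.
have [sx bx] := init_sqint i k.
have sI := wint_sqvec W_bm tT wI k.
have bI := wint_sq_le W_bm W_indep x0_rv x0_W_indep sigma_le k tT wI.
have NE w : noise b X t w k 0 = x0 i w k 0 + (noise b X t w - x0 i w) k 0.
  by rewrite [in RHS]mxE [in X in _ + (_ + X)]mxE addrC subrK.
split; first by apply: eq_sqint (sqintD mT sx sI) => w _; rewrite -NE.
have -> : \int[Pr]_w noise b X t w k 0 ^+ 2 =
    \int[Pr]_w (x0 i w k 0 + (noise b X t w - x0 i w) k 0) ^+ 2.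
  by apply: eq_Rintegral => w _; rewrite -NE.
apply: le_trans (exp_sqrD_le sx sI) _.
have : 16 * S * t <= 16 * S * T by rewrite ler_wpM2l ?mulr_ge0//; case/andP: tT.
by move: bx bI; lra.
Qed.

Lemma noise_sqproc : sqproc Pr T (noise b X) /\
  pnorm Pr T (noise b X) <= n%:R * ((2 * C0 + 32 * S * T) * T).
Proof.
apply: sqproc_bounded => //; first exact: noise_mproc.
  by move=> t tT k; have [] := noise_bound k tT.
by move=> t k tT; have [] := noise_bound k tT.
Qed.

Lemma noise_incr_orth N (s t : K) k Y : 0 <= s -> s <= t -> t <= T ->
  fmeas (filtration N x0 W s) Y -> sqint Pr setT Y ->
  \int[Pr]_w ((noise b X t w k 0 - noise b X s w k 0) * Y w) = 0.
Proof.
move=> s0 st tT fY sY.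
have := wint_orth W_bm W_indep x0_rv x0_W_indep sigma_le S0 (I := fun t w => noise b X t w - x0 i w)
  k s0 st tT (@noise_wint) noise_mxcont fY sY.
move=> <-; apply: eq_Rintegral => w _; congr (_ * _).
have E v : (noise b X v w - x0 i w) k 0 = noise b X v w k 0 - x0 i w k 0.
  by rewrite mxE [(- x0 i w) k 0]mxE.
by rewrite !E; ring.
Qed.

End SingleSolution.

(** The initial state is measurable for the past of s, and the Wiener part is covered by
    [wint_past]. *)
Lemma noise_past_orth N (i : 'I_N) (b X : process n) (s : K) Z k :
  sde_solution Pr T b sigma (W i) (x0 i) X -> 0 <= s <= T -> sqint Pr setT Z ->
  (forall Y, fmeas (filtration N x0 W s) Y -> sqint Pr setT Y ->
     \int[Pr]_w (Z w * Y w) = 0) ->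
  \int[Pr]_w (Z w * noise b X s w k 0) = 0.
Proof.
move=> sde sT sZ oZ; have wI := noise_wint sde sT.
have [sx _] := init_sqint i k.
have sI := wint_sqvec W_bm sT wI k.
have E2 := wint_past W_bm k sT wI sZ oZ.
have fx : fmeas (filtration N x0 W s) (fun w => x0 i w k 0).
  exact: filtration_fmeas_x0.
have E1 := oZ _ fx sx.
have i1 := sqintM mT sZ sx; have i2 := sqintM mT sZ sI.
transitivity (\int[Pr]_w (Z w * x0 i w k 0 +
    Z w * (noise b X s w - x0 i w) k 0)).
  by apply: eq_Rintegral => w _; rewrite [(_ - x0 i w) k 0]mxE [(- x0 i w) k 0]mxE; ring.
by rewrite expD// E1 E2 addr0.
Qed.

End DrivingNoise.

(** * Linearity of time integrals *)

Section TimeIntegralLinear.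
Context {K : realType} {k : nat}.
Local Notation leb := (@lebesgue_measure K).
Variable T : K.
Implicit Types b : K -> 'cV[K]_k.
Local Notation pinteg b := (forall j, integ T (fun t => b t j 0)).

Let mI t : measurable ([set` `[0, t]] : set (measurableTypeR K)).
Proof. exact: measurable_itv. Qed.

Lemma eq_time_integral b b' t : (forall s, b s = b' s) -> time_integral b t = time_integral b' t.
Proof. by move=> bb; congr time_integral; apply/funext. Qed.

Lemma time_integralD b b' t : 0 <= t <= T -> pinteg b -> pinteg b' ->
  time_integral (fun s => b s + b' s) t = time_integral b t + time_integral b' t.
Proof.
move=> tT ib ib'; apply/matrixP => j l; rewrite !mxE -RintegralD//; last 2 first.
- exact: integS tT (ib j).
- exact: integS tT (ib' j).
by apply: eq_Rintegral => s _; rewrite mxE.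
Qed.

Lemma time_integralZ c b t : 0 <= t <= T -> pinteg b ->
  time_integral (fun s => c *: b s) t = c *: time_integral b t.
Proof.
move=> tT ib; apply/matrixP => j l; rewrite !mxE -RintegralZl//; last first.
  exact: integS tT (ib j).
by apply: eq_Rintegral => s _; rewrite mxE.
Qed.

Lemma pintegZ c b : pinteg b -> pinteg (fun s => c *: b s).
Proof.
move=> ib j; have := integZ c (ib j); congr (integ T _).
by apply/funext => s; rewrite mxE.
Qed.

Lemma pintegD b b' : pinteg b -> pinteg b' -> pinteg (fun s => b s + b' s).
Proof.
move=> ib ib' j; have := integD (ib j) (ib' j); congr (integ T _).
by apply/funext => s; rewrite mxE.
Qed.

Lemma time_integralB b b' t : 0 <= t <= T -> pinteg b -> pinteg b' ->
  time_integral (fun s => b s - b' s) t = time_integral b t - time_integral b' t.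
Proof.
move=> tT ib ib'; rewrite -[- time_integral _ _]scaleN1r -time_integralZ//.
rewrite -time_integralD//; last exact: pintegZ.
by apply: eq_time_integral => s; rewrite scaleN1r.
Qed.

Lemma pinteg_sum (I : Type) (r : seq I) (b : I -> K -> 'cV[K]_k) :
  (forall i, pinteg (b i)) -> pinteg (fun s => \sum_(i <- r) b i s).
Proof.
move=> ib j; have := integ_sum r (fun i => ib i j); congr (integ T _).
by apply/funext => s; rewrite summxE.
Qed.

Lemma time_integral_sum (I : Type) (r : seq I) (b : I -> K -> 'cV[K]_k) t :
  0 <= t <= T -> (forall i, pinteg (b i)) ->
  time_integral (fun s => \sum_(i <- r) b i s) t = \sum_(i <- r) time_integral (b i) t.
Proof.
move=> tT ib; apply/matrixP => j l; rewrite summxE mxE.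
under [RHS]eq_bigr do rewrite mxE.
rewrite -Rint_sum//; last by move=> i; exact: integS tT (ib i j).
by apply: eq_Rintegral => s _; rewrite summxE.
Qed.

End TimeIntegralLinear.

(** * Mean-square law of large numbers for the noise *)

Section LawOfLargeNumbers.
Context {d : measure_display} {Omega : measurableType d} {K : realType}.
Variable Pr : probability Omega K.
Context {n : nat}.
Local Notation process k := (K -> Omega -> 'cV[K]_k).
Local Notation leb := (@lebesgue_measure K).
Variables (W : nat -> K -> Omega -> K) (x0 : nat -> Omega -> 'cV[K]_n) (C0 : K)
  (xbar0 : 'cV[K]_n).
Hypothesis W_bm : forall i, brownian_motion Pr (W i).
Hypothesis W_indep : mutually_indep Pr (fun i => process_sigma (W i)).
Hypothesis x0_rv : forall i, random_vector (x0 i).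
Hypothesis x0_indep : mutually_indep Pr (fun i => sigma_gen (coords (x0 i))).
Hypothesis x0_mean : forall i j, 'E_Pr[fun w => x0 i w j 0%R]%E = (xbar0 j 0)%:E.
Hypothesis x0_bound : forall i, (\int[Pr]_w (sqnorm (x0 i w))%:E < C0%:E)%E.
Hypothesis x0_W_indep : indep Pr
      (<<s \bigcup_i sigma_gen (coords (x0 i)) >>)
      (<<s \bigcup_i process_sigma (W i) >>).
Variables (T S : K) (sigma : K -> 'cV[K]_n).
Hypothesis T0 : 0 <= T.
Hypothesis sigma_le : forall t k, 0 <= t <= T -> sigma t k 0 ^+ 2 <= S.
Hypothesis S0 : 0 <= S.
Let mT : measurable [set: Omega] := measurableT.

(** By orthogonality the second moment of the sum is at most N V, and averaging divides it by
    N^2. *)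
Lemma exp_sqr_avg_orth N (xi : 'I_N -> Omega -> K) V : (0 < N)%N ->
  (forall j, sqint Pr setT (xi j)) ->
  (forall j, \int[Pr]_w xi j w ^+ 2 <= V) ->
  (forall j l, j != l -> \int[Pr]_w (xi j w * xi l w) = 0) ->
  \int[Pr]_w (N%:R^-1 * \sum_j xi j w) ^+ 2 <= V / N%:R.
Proof.
move=> N0 sx bx ox.
have E : \int[Pr]_w (\sum_j xi j w) ^+ 2 = \sum_j \int[Pr]_w xi j w ^+ 2.
  by apply: exp_sqr_sum_orth => //; [exact: index_enum_uniq|move=> j l _ _; exact: ox].
have -> : \int[Pr]_w (N%:R^-1 * \sum_j xi j w) ^+ 2 =
    N%:R^-1 ^+ 2 * \int[Pr]_w (\sum_j xi j w) ^+ 2.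
  rewrite -RintegralZl//; first by apply: eq_Rintegral => w _; rewrite exprMn.
  exact: sqint_integrable2 (sqint_sum mT _ sx).
rewrite E; have N1 : N%:R != 0 :> K by rewrite pnatr_eq0 -lt0n.
apply: (@le_trans _ _ (N%:R^-1 ^+ 2 * (N%:R * V))).
  apply: ler_wpM2l; first exact: sqr_ge0.
  rewrite mulr_natl -[X in _ *+ X]card_ord -sumr_const; exact: ler_sum.
by rewrite le_eqVlt; apply/orP; left; apply/eqP; field.
Qed.

Lemma init_centered i k :
  [/\ sqint Pr setT (fun w => x0 i w k 0 - xbar0 k 0),
      \int[Pr]_w (x0 i w k 0 - xbar0 k 0) ^+ 2 <= 2 * C0 + 2 * sqnorm xbar0 &
      \int[Pr]_w (x0 i w k 0 - xbar0 k 0) = 0].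
Proof.
have [sx bx] := init_sqint x0_rv x0_bound i k.
have sc : sqint Pr setT (fun=> - xbar0 k 0) by exact: sqint_cst_omega.
have c1 (c : K) : \int[Pr]_w c = c.
  by rewrite /Rintegral integral_cst//= probability_setT mule1.
split; first exact: sqintD.
- apply: le_trans (exp_sqrD_le sx sc) _.
  rewrite c1 sqrrN.
  have := sqr_coord_le xbar0 k; lra.
- have s1 : sqint Pr setT (fun=> 1 : K) by exact: sqint_cst_omega.
  have iX : Pr.-integrable setT (EFin \o (fun w => x0 i w k 0)).
    have := sqintM mT sx s1; congr (Pr.-integrable _ _).
    by apply/funext => w /=; rewrite mulr1.
  have ic : Pr.-integrable setT (EFin \o (fun=> - xbar0 k 0)).
    have := sqintM mT sc s1; congr (Pr.-integrable _ _).
    by apply/funext => w /=; rewrite mulr1.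
  rewrite expD// c1.
  have := x0_mean i k; rewrite unlock => E.
  by rewrite /Rintegral E /= subrr.
Qed.

Lemma init_orth i j k : i != j ->
  \int[Pr]_w ((x0 i w k 0 - xbar0 k 0) * (x0 j w k 0 - xbar0 k 0)) = 0.
Proof.
move=> ij.
have [si _ E0] := init_centered i k; have [sj _ _] := init_centered j k.
have f l : fmeas (sigma_gen (coords (x0 l))) (fun w => x0 l w k 0 - xbar0 k 0).
  apply: fmeasD; last exact: fmeas_cst.
  by apply: fmeas_sigma_gen; exists k.
have m l : sigma_gen (coords (x0 l)) `<=` measurable.
  by apply: sigma_gen_measurable => _ [k' _ <-]; exact: x0_rv.
rewrite (indep_exp _ (m i) (m j) (f i) (f j) si sj) ?E0 ?mul0r//.
move=> E E' Ei Ej.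
have := x0_indep (s := [:: i; j]) (E := fun l => if l == i then E else E').
rewrite /= inE ij => /(_ isT) H.
rewrite !big_cons big_nil mule1 eqxx eq_sym (negbTE ij) in H.
rewrite -H; last first.
  move=> l; rewrite !inE => /orP[|] /eqP ->; first by rewrite eqxx.
  by rewrite eq_sym (negbTE ij).
congr (Pr _); apply/seteqP; split => w.
  by move=> [wE wE'] l /=; case: eqP.
move=> h; split; first by have := h i; rewrite /= !inE eqxx; exact.
by have := h j; rewrite /= !inE eqxx orbT eq_sym (negbTE ij); exact.
Qed.

(** The deviation splits into the average of the centered initial states and the average of the
    Wiener integrals. Each family is pairwise orthogonal, and the two averages are combined by (x +
    y)^2 <= 2 x^2 + 2 y^2, which doubles both constants. *)
Lemma avg_noise_bound N (b X : 'I_N -> process n) t k : (0 < N)%N -> 0 <= t <= T ->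
  (forall j, sde_solution Pr T (b j) sigma (W j) (x0 j) (X j)) ->
  \int[Pr]_w (N%:R^-1 * (\sum_j noise (b j) (X j) t w k 0) - xbar0 k 0) ^+ 2 <=
    (4 * C0 + 4 * sqnorm xbar0 + 32 * S * T) / N%:R.
Proof.
move=> N0 tT sde; have N1 : N%:R != 0 :> K by rewrite pnatr_eq0 -lt0n.
pose xi (j : 'I_N) w := x0 j w k 0 - xbar0 k 0.
pose I (j : 'I_N) w := (noise (b j) (X j) t w - x0 j w) k 0.
have wI j := noise_wint (sde j) tT.
have sI j : sqint Pr setT (I j) by exact: (wint_sqvec W_bm tT (wI j) k).
have sxi j : sqint Pr setT (xi j) by have [] := init_centered j k.
have neq (j l : 'I_N) : j != l -> (j : nat) != l by [].
have B1 : \int[Pr]_w (N%:R^-1 * \sum_j xi j w) ^+ 2 <= (2 * C0 + 2 * sqnorm xbar0) / N%:R.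
  apply: exp_sqr_avg_orth => // [j|j l jl].
    by have [] := init_centered j k.
  by apply: init_orth; exact: neq.
have B2 : \int[Pr]_w (N%:R^-1 * \sum_j I j w) ^+ 2 <= (16 * S * T) / N%:R.
  apply: exp_sqr_avg_orth => // [j|j l jl].
    apply: le_trans (wint_sq_le W_bm W_indep x0_rv x0_W_indep sigma_le k tT (wI j)) _.
    by rewrite ler_wpM2l ?mulr_ge0//; case/andP: tT.
  exact: (wint_cross W_bm W_indep k k (neq _ _ jl) tT (wI j) (wI l)).
have s1 : sqint Pr setT (fun w => N%:R^-1 * \sum_j xi j w).
  by apply: sqintZ => //; exact: sqint_sum.
have s2 : sqint Pr setT (fun w => N%:R^-1 * \sum_j I j w).
  by apply: sqintZ => //; exact: sqint_sum.
have -> : \int[Pr]_w (N%:R^-1 * (\sum_j noise (b j) (X j) t w k 0) - xbar0 k 0) ^+ 2 =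
    \int[Pr]_w (N%:R^-1 * (\sum_j xi j w) + N%:R^-1 * \sum_j I j w) ^+ 2.
  apply: eq_Rintegral => w _; congr (_ ^+ 2).
  rewrite -mulrDr -big_split/=.
  have -> : \sum_(j < N) (xi j w + I j w) = \sum_(j < N) noise (b j) (X j) t w k 0 - N%:R * xbar0 k 0.
    rewrite mulr_natl -[X in _ *+ X]card_ord -sumr_const -sumrB; apply: eq_bigr => j _.
    by rewrite /xi /I [(_ - x0 j w) k 0]mxE [(- x0 j w) k 0]mxE; ring.
  by rewrite mulrBr mulrA mulVf// mul1r.
apply: le_trans (exp_sqrD_le s1 s2) _.
rewrite [leRHS](_ : _ = 2 * ((2 * C0 + 2 * sqnorm xbar0) / N%:R) + 2 * (16 * S * T / N%:R)).
  by apply: lerD; rewrite ler_wpM2l.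
by ring.
Qed.

End LawOfLargeNumbers.

(** * Population averages and stability of orthogonality under linear operations *)

Section Averages.
Context {d : measure_display} {Omega : measurableType d} {K : realType}.
Variables (Pr : probability Omega K) (T : K).
Hypothesis T0 : 0 <= T.
Context {n N : nat}.
Implicit Type X : 'I_N -> K -> Omega -> 'cV[K]_n.
Let mT : measurable [set: Omega] := measurableT.

Lemma avg_coord X t w k : avg X t w k 0 = N%:R^-1 * \sum_j X j t w k 0.
Proof. by rewrite mxE summxE. Qed.

Lemma mxcont_avg X w : (forall j, mxcont T (X j ^~ w)) -> mxcont T (avg X ^~ w).
Proof.
move=> cX; apply: mxcontZ; first exact: cst_continuous.
move=> k l; apply: (@eq_within_cont _ T _ (fun t => \sum_j X j t w k l)).
  by move=> t; rewrite summxE.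
by apply: within_cont_sum => j; exact: cX.
Qed.

Lemma mproc_avg X : (forall j, @measurable_process d Omega K n T (X j)) ->
  @measurable_process d Omega K n T (avg X).
Proof. by move=> mX; apply: mprocZ; exact: mproc_sum. Qed.

Lemma sqvec_avg X t : (forall j, sqvec Pr (X j t)) -> sqvec Pr (avg X t).
Proof.
move=> sX k; apply: eq_sqint (sqintZ mT N%:R^-1 (sqint_sum mT (index_enum _) (fun j => sX j k))) => w _.
by rewrite avg_coord.
Qed.

Lemma orth_avg X t (Z : Omega -> K) k : sqint Pr setT Z -> (forall j, sqvec Pr (X j t)) ->
  (forall j, \int[Pr]_w (Z w * X j t w k 0) = 0) -> \int[Pr]_w (Z w * avg X t w k 0) = 0.
Proof.
move=> sZ sX oX.
transitivity (\int[Pr]_w (N%:R^-1 * ((\sum_j X j t w k 0) * Z w))).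
  by apply: eq_Rintegral => w _; rewrite avg_coord; ring.
have sS : sqint Pr setT (fun w => \sum_j X j t w k 0).
  by apply: sqint_sum => // j; exact: sX.
rewrite RintegralZl//; last exact: sqintM.
rewrite (@exp_sum_mul _ _ _ Pr _ (index_enum _) (fun j w => X j t w k 0))//; last first.
  by move=> j _; exact: sX.
rewrite big1 ?mulr0// => j _; rewrite -[RHS](oX j).
by apply: eq_Rintegral => w _; exact: mulrC.
Qed.

Lemma sqvec_mulmx m k (M : 'M[K]_(m, k)) (Y : Omega -> 'cV[K]_k) :
  sqvec Pr Y -> sqvec Pr (fun w => M *m Y w).
Proof.
move=> sY i; have sM l : sqint Pr setT (fun w => M i l * Y w l 0) by exact: sqintZ.
by apply: eq_sqint (sqint_sum mT (index_enum _) sM) => w _; rewrite mxE.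
Qed.

Lemma sqvecD k (X Y : Omega -> 'cV[K]_k) : sqvec Pr X -> sqvec Pr Y ->
  sqvec Pr (fun w => X w + Y w).
Proof. by move=> sX sY j; apply: eq_sqint (sqintD mT (sX j) (sY j)) => w _; rewrite mxE. Qed.

Lemma orth_mulmx m k (M : 'M[K]_(m, k)) (Z : Omega -> K) (Y : Omega -> 'cV[K]_k) i :
  sqint Pr setT Z -> sqvec Pr Y -> (forall l, \int[Pr]_w (Z w * Y w l 0) = 0) ->
  \int[Pr]_w (Z w * (M *m Y w) i 0) = 0.
Proof.
move=> sZ sY oY.
have sM l : sqint Pr setT (fun w => M i l * Y w l 0) by exact: sqintZ.
transitivity (\int[Pr]_w ((\sum_l M i l * Y w l 0) * Z w)).
  by apply: eq_Rintegral => w _; rewrite mxE mulrC.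
rewrite (@exp_sum_mul _ _ _ Pr _ (index_enum _) (fun l w => M i l * Y w l 0))//.
rewrite big1// => l _.
transitivity (\int[Pr]_w (M i l * (Z w * Y w l 0))).
  by apply: eq_Rintegral => w _; ring.
by rewrite RintegralZl ?oY ?mulr0//; exact: sqintM.
Qed.

Lemma orthD k (Z : Omega -> K) (X Y : Omega -> 'cV[K]_k) i : sqint Pr setT Z ->
  sqvec Pr X -> sqvec Pr Y -> \int[Pr]_w (Z w * X w i 0) = 0 ->
  \int[Pr]_w (Z w * Y w i 0) = 0 -> \int[Pr]_w (Z w * (X w + Y w) i 0) = 0.
Proof.
move=> sZ sX sY oX oY.
transitivity (\int[Pr]_w (Z w * X w i 0 + Z w * Y w i 0)).
  by apply: eq_Rintegral => w _; rewrite [in LHS]mxE mulrDr.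
by rewrite expD ?oX ?oY ?addr0//; exact: sqintM.
Qed.

Lemma time_integral_avg (b : 'I_N -> K -> 'cV[K]_n) t : 0 <= t <= T ->
  (forall j k, integ T (fun s => b j s k 0)) ->
  N%:R^-1 *: (\sum_j time_integral (b j) t) =
  time_integral (fun s => N%:R^-1 *: \sum_j b j s) t.
Proof.
move=> tT ib; rewrite (@time_integralZ _ _ T)//; last exact: pinteg_sum.
by rewrite (@time_integral_sum _ _ T).
Qed.

Lemma mxcont_pinteg (b : K -> 'cV[K]_n) : mxcont T b ->
  forall j, integ T (fun t => b t j 0).
Proof. by move=> cb j; exact: within_cont_integ. Qed.

Lemma pnorm_zero k : pnorm Pr T (fun _ _ => 0 : 'cV[K]_k) = 0.
Proof.
rewrite /pnorm; under eq_Rintegral do rewrite sqnorm0.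
by rewrite /Rintegral integral0.
Qed.

End Averages.

(** * Uniform estimates for the closed loop and its mean-field limit *)

Section ClosedLoop.
Context {d : measure_display} {Omega : measurableType d} {K : realType}.
Variable Pr : probability Omega K.
Context {n : nat}.
Local Notation process k := (K -> Omega -> 'cV[K]_k).
Local Notation leb := (@lebesgue_measure K).
Variables (W : nat -> K -> Omega -> K) (x0 : nat -> Omega -> 'cV[K]_n) (C0 : K)
  (xbar0 : 'cV[K]_n).
Hypothesis W_bm : forall i, brownian_motion Pr (W i).
Hypothesis W_indep : mutually_indep Pr (fun i => process_sigma (W i)).
Hypothesis x0_rv : forall i, random_vector (x0 i).
Hypothesis x0_indep : mutually_indep Pr (fun i => sigma_gen (coords (x0 i))).
Hypothesis x0_mean : forall i j, 'E_Pr[fun w => x0 i w j 0%R]%E = (xbar0 j 0)%:E.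
Hypothesis x0_bound : forall i, (\int[Pr]_w (sqnorm (x0 i w))%:E < C0%:E)%E.
Hypothesis x0_W_indep : indep Pr
      (<<s \bigcup_i sigma_gen (coords (x0 i)) >>)
      (<<s \bigcup_i process_sigma (W i) >>).
Variables (T S : K) (sigma : K -> 'cV[K]_n).
Hypothesis T0 : 0 <= T.
Hypothesis sigma_le : forall t k, 0 <= t <= T -> sigma t k 0 ^+ 2 <= S.
Hypothesis S0 : 0 <= S.
Variables (M : K -> 'M[K]_n) (G : 'M[K]_n) (c xbar : K -> 'cV[K]_n).
Hypothesis M_cont : mxcont T M.
Hypothesis c_cont : mxcont T c.
Hypothesis xbar_cont : mxcont T xbar.
Hypothesis xbar_eq : forall t, 0 <= t <= T ->
  xbar t = xbar0 + time_integral (fun s => (M s + G) *m xbar s + c s) t.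
Let mT : measurable [set: Omega] := measurableT.

(** Later M is A - B R^-1 B^T P, and c collects the terms that are independent of the states. *)
Definition cl_drift N (X : 'I_N -> process n) (j : 'I_N) : process n :=
  fun t w => M t *m X j t w + G *m avg X t w + c t.

Let MG_cont : mxcont T (fun t => M t + G).
Proof. by apply: mxcontD => //; exact: mxcont_cst. Qed.

Section System.
Variables (N : nat) (X : 'I_N -> process n).
Hypothesis N0 : (0 < N)%N.
Hypothesis sde : forall j, sde_solution Pr T (cl_drift X j) sigma (W j) (x0 j) (X j).

Lemma cl_mproc j : @measurable_process d Omega K n T (X j).
Proof. by have [] := sde j. Qed.

Lemma cl_avg_mproc : @measurable_process d Omega K n T (avg X).
Proof. by apply: mproc_avg; exact: cl_mproc. Qed.

Lemma cl_drift_mproc j : @measurable_process d Omega K n T (cl_drift X j).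
Proof.
apply: mprocD; last exact: mproc_det.
apply: mprocD; first by apply: mproc_mulmx => //; exact: cl_mproc.
apply: (@mproc_mulmx _ _ _ T _ _ (fun=> G)); first exact: mxcont_cst.
exact: cl_avg_mproc.
Qed.

Lemma cl_mxcont : {ae Pr, forall w, forall j, mxcont T (X j ^~ w)}.
Proof. by apply: ae_forall_ord => j; exact: (sde_mxcont (sde j)). Qed.

Local Notation noises := (fun j => noise (cl_drift X j) (X j)).

(** The coupling term is common to all agents and the drift is linear, so averaging gives a closed
    equation for the mean, with matrix M + G and the averaged noise as source. *)
Lemma cl_avg_eq : {ae Pr, forall w, forall t, 0 <= t <= T ->
  avg X t w = avg noises t w + time_integral (fun s => (M s + G) *m avg X s w + c s) t}.
Proof.
have : {ae Pr, forall w, forall j k, integ T (fun t => cl_drift X j t w k 0)}.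
  by apply: ae_forall_ord => j; exact: (sde_integ (sde j)).
apply: filterS => w ib t tT.
have N1 : N%:R != 0 :> K by rewrite pnatr_eq0 -lt0n.
have -> : time_integral (fun s => (M s + G) *m avg X s w + c s) t =
    time_integral (fun s => N%:R^-1 *: \sum_j cl_drift X j s w) t.
  apply: eq_time_integral => s; rewrite /cl_drift 2!big_split/= !sumr_const card_ord.
  rewrite -mulmx_sumr -[(G *m _) *+ _]scaler_nat -[c s *+ _]scaler_nat !scalerDr scalemxAr -/(avg X s w) !scalerA mulVf// !scale1r.
  by rewrite mulmxDl.
rewrite -(@time_integral_avg _ T _ _ (fun j => cl_drift X j ^~ w))//.
rewrite /avg -scalerDr -big_split/=; congr (_ *: _); apply: eq_bigr => j _.
by rewrite /noise subrK.
Qed.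

Lemma cl_state_eq j t w :
  X j t w = noise (cl_drift X j) (X j) t w +
    time_integral (fun s => M s *m X j s w + (G *m avg X s w + c s)) t.
Proof.
rewrite /noise -[LHS](subrK (time_integral (cl_drift X j ^~ w) t)); congr (_ + _).
by apply: eq_time_integral => s; rewrite /cl_drift addrA.
Qed.

Let C1 := 4 * C0 + 4 * sqnorm xbar0 + 32 * S * T.

Lemma cl_avg_noise : sqproc Pr T (fun t w => avg noises t w - xbar0) /\
  pnorm Pr T (fun t w => avg noises t w - xbar0) <= n%:R * (C1 / N%:R * T).
Proof.
have nb j := noise_bound W_bm W_indep x0_rv x0_bound x0_W_indep sigma_le S0 (sde j).
apply: sqproc_bounded => //.
- apply: mprocB; last by apply: (mproc_det (f := fun=> xbar0)); exact: mxcont_cst.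
  apply: mproc_avg => j; apply: noise_mproc (sde j) _; exact: cl_drift_mproc.
- move=> t tT k.
  have sa : sqint Pr setT (fun w => avg noises t w k 0).
    by apply: sqvec_avg => j l; have [] := nb j t l tT.
  apply: eq_sqint (sqintB mT sa (sqint_cst_omega Pr (xbar0 k 0))) => w _.
  by rewrite [RHS]mxE [(- xbar0) k 0]mxE.
- move=> t k tT.
  apply: le_trans (avg_noise_bound W_bm W_indep x0_rv x0_indep x0_mean x0_bound
    x0_W_indep sigma_le S0 k N0 tT sde).
  rewrite le_eqVlt; apply/orP; left; apply/eqP; apply: eq_Rintegral => w _.
  by rewrite [(_ - xbar0) k 0]mxE [(- xbar0) k 0]mxE avg_coord.
Qed.

(** Stands in for adaptedness of the states. The mean comes first because its equation is closed; it
    then enters the equation of each state as an input already known to be orthogonal to [Z]. *)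
Lemma cl_orth (u : K) (Z : Omega -> K) : 0 <= u <= T -> sqint Pr setT Z ->
  sqproc Pr T (avg X) -> (forall j, sqproc Pr T (X j)) ->
  (forall Y, fmeas (filtration N x0 W u) Y -> sqint Pr setT Y ->
     \int[Pr]_w (Z w * Y w) = 0) ->
  (forall t, 0 <= t <= u -> sqvec Pr (avg X t) /\
     forall k, \int[Pr]_w (Z w * avg X t w k 0) = 0) /\
  (forall j t, 0 <= t <= u -> sqvec Pr (X j t) /\
     forall k, \int[Pr]_w (Z w * X j t w k 0) = 0).
Proof.
move=> uT sZ sA sX oZ.
have tuT t : 0 <= t <= u -> 0 <= t <= T.
  by move=> /andP[-> tu]; case/andP: uT => _; exact: le_trans.
have nb j := noise_bound W_bm W_indep x0_rv x0_bound x0_W_indep sigma_le S0 (sde j).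
have sN j t : 0 <= t <= u -> sqvec Pr (noise (cl_drift X j) (X j) t).
  by move=> /tuT tT k; have [] := nb j t k tT.
have oN (j : 'I_N) t k : 0 <= t <= u -> \int[Pr]_w (Z w * noise (cl_drift X j) (X j) t w k 0) = 0.
  move=> tu; apply: (noise_past_orth W_bm x0_rv x0_bound k (sde j) (tuT _ tu) sZ) => Y fY sY.
  apply: oZ => //; apply: fmeas_sub fY; apply: filtration_mono.
  by case/andP: tu.
have oc (a : K) : \int[Pr]_w (Z w * a) = 0.
  by apply: oZ; [exact: fmeas_cst|exact: sqint_cst_omega].
have oA : forall t, 0 <= t <= u -> sqvec Pr (avg X t) /\
     forall k, \int[Pr]_w (Z w * avg X t w k 0) = 0.
  apply: (orth_volterra (M := fun t => M t + G) (a := avg noises) (b := fun t _ => c t) T0 uT) => //.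
  - exact: sqproc_det.
  - by move=> t tu; apply: sqvec_avg => j; exact: sN.
  - by move=> t k tu; apply: orth_avg => // j; [exact: sN|exact: oN].
  - by apply: aeW => t _ j; exact: oc.
  - move=> t tu; move: cl_avg_eq; apply: filterS => w; apply; exact: tuT.
split => // j.
apply: (orth_volterra (M := M) (a := noise (cl_drift X j) (X j))
  (b := fun t w => G *m avg X t w + c t) T0 uT) => //.
- apply: sqprocD; last exact: sqproc_det.
  apply: (sqproc_mulmx (M := fun=> G)) => //; exact: mxcont_cst.
- exact: sN.
- by move=> t k; exact: oN.
- apply: aeW => t tu k; have [sAt oAt] := oA t tu.
  apply: orthD => //; [exact: sqvec_mulmx|by move=> l; exact: sqint_cst_omega|].
  exact: orth_mulmx.
- by move=> t tu; apply: aeW => w; exact: cl_state_eq.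
Qed.

End System.

(** The constant is fixed before N. The error avg X - xbar solves a Volterra equation whose source
    is the averaged noise minus its mean, of squared norm O(1 / N); adding xbar bounds the mean,
    which is then an input for each state. *)
Lemma cl_estimates : exists2 C, 0 <= C &
  forall N (X : 'I_N -> process n), (0 < N)%N ->
  (forall j, sde_solution Pr T (cl_drift X j) sigma (W j) (x0 j) (X j)) ->
  [/\ sqproc Pr T (avg X), forall j, sqproc Pr T (X j),
    pnorm Pr T (fun t w => avg X t w - xbar t) <= C / N%:R &
    pnorm Pr T (avg X) <= C /\ forall j, pnorm Pr T (X j) <= C].
Proof.
have [m1 m10 Hm1] := mxcont_frob_bounded MG_cont.
have [m2 m20 Hm2] := mxcont_frob_bounded M_cont.
have C00 : 0 <= C0.
  rewrite -lee_fin; apply: le_trans (ltW (x0_bound 0%N)).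
  by apply: integral_ge0 => w _; rewrite lee_fin sqnorm_ge0.
pose C1 := 4 * C0 + 4 * sqnorm xbar0 + 32 * S * T.
have C10 : 0 <= C1 by rewrite !addr_ge0 ?mulr_ge0 ?sqnorm_ge0.
pose C2 := 2 * C0 + 32 * S * T.
have C20 : 0 <= C2 by rewrite !addr_ge0 ?mulr_ge0.
pose CE := volterra_const T m1 * (n%:R * (C1 * T)).
have CE0 : 0 <= CE by rewrite mulr_ge0 ?volterra_const_ge0 ?mulr_ge0.
pose pxb := pnorm Pr T (fun t _ => xbar t); pose pc := pnorm Pr T (fun t _ => c t).
have pxb0 : 0 <= pxb by exact: pnorm_ge0.
have pc0 : 0 <= pc by exact: pnorm_ge0.
pose CA := 2 * CE + 2 * pxb.
have CA0 : 0 <= CA by apply: addr_ge0; apply: mulr_ge0.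
pose CX := volterra_const T m2 * (n%:R * (C2 * T) + (2 * (mxfrob G * CA) + 2 * pc)).
have CX0 : 0 <= CX.
  apply: mulr_ge0; first exact: volterra_const_ge0.
  apply: addr_ge0; first by rewrite !mulr_ge0.
  by apply: addr_ge0; apply: mulr_ge0 => //; apply: mulr_ge0 => //; exact: mxfrob_ge0.
exists (CE + CA + CX); first by apply: addr_ge0 => //; exact: addr_ge0.
move=> N X N0 sde; have N1 : 0 < N%:R :> K by rewrite ltr0n.
have N1' : 1 <= N%:R :> K by rewrite ler1n.
have cX := cl_mxcont sde.
have [san pan] := cl_avg_noise N0 sde.
have sxb : sqproc Pr T (fun t _ => xbar t) by exact: sqproc_det.
have sc : sqproc Pr T (fun t _ => c t) by exact: sqproc_det.
have [se pe] : sqproc Pr T (fun t w => avg X t w - xbar t) /\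
    pnorm Pr T (fun t w => avg X t w - xbar t) <= volterra_const T m1 *
      (pnorm Pr T (fun t w => avg (fun j => noise (cl_drift X j) (X j)) t w - xbar0)
       + pnorm Pr T (fun _ _ => 0 : 'cV[K]_n)).
  apply: (volterra_proc T0 MG_cont m10 Hm1) => //.
  - by apply: mprocB; [exact: cl_avg_mproc sde|exact: mproc_det].
  - move: cX; apply: filterS => w cXw; apply: cont_sqpath => //.
    by apply: mxcontB => //; apply: mxcont_avg.
  - by apply: (@sqproc_det _ _ _ Pr T _ (fun=> 0)); exact: mxcont_cst.
  - have ibx : {ae Pr, forall w, forall k, integ T (fun t => ((M t + G) *m avg X t w + c t) k 0)}.
      move: cX; apply: filterS => w cXw; apply: mxcont_pinteg.
      by apply: mxcontD => //; apply: mxcontM => //; exact: mxcont_avg.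
    move: (cl_avg_eq N0 sde) ibx; apply: filterS2 => w E ib t tT.
    rewrite (E t tT) (xbar_eq tT) opprD addrACA; congr (_ + _).
    rewrite -(@time_integralB _ _ T)//; last first.
      by apply: mxcont_pinteg; apply: mxcontD => //; exact: mxcontM.
    apply: eq_time_integral => s; rewrite addr0 mulmxBr opprD addrACA subrr addr0.
    by [].
rewrite pnorm_zero addr0 in pe.
have pe' : pnorm Pr T (fun t w => avg X t w - xbar t) <= CE / N%:R.
  apply: le_trans pe _; rewrite /CE -mulrA; apply: ler_wpM2l; first exact: volterra_const_ge0.
  by apply: le_trans pan _; rewrite le_eqVlt; apply/orP; left; apply/eqP; rewrite /C1; ring.
have pe1 : pnorm Pr T (fun t w => avg X t w - xbar t) <= CE.
  by apply: le_trans pe' _; rewrite ler_pdivrMr// ler_peMr.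
have eA : avg X = (fun t w => (avg X t w - xbar t) + xbar t).
  by apply/funext => t; apply/funext => w; rewrite subrK.
have sA : sqproc Pr T (avg X) by rewrite eA; exact: sqprocD.
have pA : pnorm Pr T (avg X) <= CA.
  rewrite eA; apply: le_trans (pnormD_le se sxb) _.
  by rewrite lerD2r ler_wpM2l.
have sGA : sqproc Pr T (fun t w => G *m avg X t w).
  by apply: (sqproc_mulmx (M := fun=> G)) => //; exact: mxcont_cst.
have pGA : pnorm Pr T (fun t w => G *m avg X t w) <= mxfrob G * CA.
  apply: le_trans (pnorm_mulmx_le (c := mxfrob G) (M := fun=> G) _ _ sA) _ => //.
    exact: mxcont_cst.
  by rewrite ler_wpM2l ?mxfrob_ge0.
have HX j : sqproc Pr T (X j) /\ pnorm Pr T (X j) <= CX.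
  have [sn pn] := noise_sqproc W_bm W_indep x0_rv x0_bound x0_W_indep T0 sigma_le S0 (sde j)
    (cl_drift_mproc sde j).
  have sb : sqproc Pr T (fun t w => G *m avg X t w + c t) by exact: sqprocD.
  have [] // := @volterra_proc _ _ _ Pr T T0 _ m2 M (X j) (noise (cl_drift X j) (X j))
    (fun t w => G *m avg X t w + c t) M_cont m20 Hm2 (cl_mproc sde j) _ sn sb _.
  - by move: cX; apply: filterS => w cXw; exact: cont_sqpath.
  - by apply: aeW => w t _; exact: cl_state_eq.
  - move=> sXj /le_trans pX; split => //; apply: pX.
    apply: ler_wpM2l; first exact: volterra_const_ge0.
    apply: lerD => //; apply: le_trans (pnormD_le sGA sc) _.
    by rewrite lerD2r ler_wpM2l.
split => //.
- by move=> j; have [] := HX j.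
- apply: le_trans pe' _; rewrite ler_wpM2r ?invr_ge0//.
  by rewrite -addrA lerDl; exact: addr_ge0.
- split; first by apply: le_trans pA _; rewrite addrAC lerDr; exact: addr_ge0.
  by move=> j; have [_ pX] := HX j; apply: le_trans pX _; rewrite lerDr; exact: addr_ge0.
Qed.

End ClosedLoop.

(** * A unilateral deviation *)

Section Deviation.
Context {d : measure_display} {Omega : measurableType d} {K : realType}.
Variable Pr : probability Omega K.
Context {n r : nat}.
Local Notation process k := (K -> Omega -> 'cV[K]_k).
Local Notation leb := (@lebesgue_measure K).
Variables (W : nat -> K -> Omega -> K) (x0 : nat -> Omega -> 'cV[K]_n).
Hypothesis W_bm : forall i, brownian_motion Pr (W i).
Variables (T : K) (A G : 'M[K]_n) (B : 'M[K]_(n, r)) (f sigma : K -> 'cV[K]_n).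
Hypothesis T0 : 0 <= T.
Let mT : measurable [set: Omega] := measurableT.

Section System.
Variables (N : nat) (i : 'I_N) (u : 'I_N -> process r) (v : process r)
  (Y X : 'I_N -> process n).
Hypothesis sY : states Pr T A B G f sigma x0 W u Y.
Hypothesis sX : states Pr T A B G f sigma x0 W (deviate u i v) X.

Definition dstate (j : 'I_N) : process n := fun t w => X j t w - Y j t w.
Definition dctrl : process r := fun t w => v t w - u i t w.

Lemma dstate_mproc j : @measurable_process d Omega K n T (dstate j).
Proof. by have [mX _ _ _] := sX j; have [mY _ _ _] := sY j; exact: mprocB. Qed.

Lemma dstate_mxcont : {ae Pr, forall w, forall j, mxcont T (dstate j ^~ w)}.
Proof.
apply: ae_forall_ord => j; move: (sde_mxcont (sX j)) (sde_mxcont (sY j)).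
by apply: filterS2 => w; exact: mxcontB.
Qed.

Lemma avg_dstate t w : avg dstate t w = avg X t w - avg Y t w.
Proof. by rewrite /avg -scalerBr -sumrB. Qed.

(** The states with their drift integrals removed are, for both systems, versions of the same Wiener
    integral shifted by the same initial state. They agree almost surely at each time, and by
    continuity at all times together. *)
Lemma dstate_eq : {ae Pr, forall w, forall j t, 0 <= t <= T ->
  dstate j t w = time_integral (fun s =>
    A *m dstate j s w + ((if j == i then B *m dctrl s w else 0) + G *m avg dstate s w)) t}.
Proof.
apply: ae_forall_ord => j.
pose bX t w := A *m X j t w + B *m deviate u i v j t w + G *m avg X t w + f t.
pose bY t w := A *m Y j t w + B *m u j t w + G *m avg Y t w + f t.
have r0 : {ae Pr, forall w, forall t, 0 <= t <= T ->
    (noise bX (X j) t w - x0 j w) - (noise bY (Y j) t w - x0 j w) = 0}.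
  apply: (@ae_forall_time _ _ _ Pr T T0 _
    (fun t w => (noise bX (X j) t w - x0 j w) - (noise bY (Y j) t w - x0 j w))).
    move=> t tT.
    have wX : is_wiener_integral Pr sigma (W j) t (fun w => noise bX (X j) t w - x0 j w).
      exact: (noise_wint (sX j) tT).
    have wY : is_wiener_integral Pr sigma (W j) t (fun w => noise bY (Y j) t w - x0 j w).
      exact: (noise_wint (sY j) tT).
    move: (wint_unique W_bm tT wX wY); apply: filterS => w E.
    by apply/eqP; rewrite subr_eq0; apply/eqP; exact: E.
  move: (noise_mxcont T0 (sX j)) (noise_mxcont T0 (sY j)).
  by apply: filterS2 => w; exact: mxcontB.
move: r0 (sde_integ (sX j)) (sde_integ (sY j)); apply: filterS3 => w r0 iX iY t tT.
have bE s : bX s w - bY s w =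
    A *m dstate j s w + ((if j == i then B *m dctrl s w else 0) + G *m avg dstate s w).
  rewrite /bX /bY avg_dstate /dstate /dctrl !mulmxBr /deviate.
  by case: eqP => [->|_]; rewrite ?mulmxBr; mx_abelian.
rewrite -(eq_time_integral _ bE) (@time_integralB _ _ T)//.
rewrite -[LHS](addrNK (time_integral (bX ^~ w) t - time_integral (bY ^~ w) t)).
rewrite [X in X + _](_ : _ = 0) ?add0r// -(r0 t tT) /noise /dstate.
move: (time_integral _ t) (time_integral _ t) => p q.
by mx_abelian.
Qed.

Hypothesis N0 : (0 < N)%N.

(** Only one of the N equations contains the control difference, so averaging leaves it with the
    weight 1 / N. *)
Lemma avg_dstate_eq : {ae Pr, forall w, forall t, 0 <= t <= T ->
  avg dstate t w = time_integral (fun s =>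
    (A + G) *m avg dstate s w + N%:R^-1 *: (B *m dctrl s w)) t}.
Proof.
have N1 : N%:R != 0 :> K by rewrite pnatr_eq0 -lt0n.
pose bd j s w := A *m dstate j s w + ((if j == i then B *m dctrl s w else 0) + G *m avg dstate s w).
have ib : {ae Pr, forall w, forall j k, integ T (fun s => bd j s w k 0)}.
  apply: ae_forall_ord => j; move: (sde_integ (sX j)) (sde_integ (sY j)).
  apply: filterS2 => w iX iY k.
  have := pintegD iX (pintegZ (-1) iY) k; congr (integ T _); apply/funext => s.
  congr ((_ : 'cV[K]_n) k 0); rewrite scaleN1r.
  rewrite /bd avg_dstate /dstate /dctrl !mulmxBr /deviate.
  by case: eqP => [->|_]; rewrite ?mulmxBr; mx_abelian.
move: dstate_eq ib; apply: filterS2 => w E ib t tT.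
have -> : avg dstate t w = N%:R^-1 *: (\sum_j time_integral (bd j ^~ w) t).
  by rewrite /avg; congr (_ *: _); apply: eq_bigr => j _; exact: E.
rewrite (@time_integral_avg _ T _ _ (fun j => bd j ^~ w))//.
apply: eq_time_integral => s; rewrite /bd 2!big_split/= sumr_const card_ord.
rewrite -big_mkcond/= big_pred1_eq -mulmx_sumr -[(G *m _) *+ _]scaler_nat.
rewrite !scalerDr scalemxAr -/(avg dstate s w) scalerA mulVf// scale1r mulmxDl.
by rewrite -!addrA; congr (_ + _); rewrite addrC.
Qed.

(** The first summand controls the mean deviation (matrix A + G, input B zeta / N), the second that
    of the deviating agent (matrix A, inputs B zeta and G times the mean deviation). Neither N nor
    the control enters. *)
Definition dev_const := volterra_const T (mxfrob (A + G)) * mxfrob B +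
  volterra_const T (mxfrob A) * (2 * mxfrob B +
    2 * (mxfrob G * (volterra_const T (mxfrob (A + G)) * mxfrob B))).

Lemma dev_const_ge0 : 0 <= dev_const.
Proof.
have v0 c : 0 <= volterra_const T c by exact: volterra_const_ge0.
rewrite /dev_const; do ?[exact: ler0n|exact: v0|exact: mxfrob_ge0|apply: addr_ge0|apply: mulr_ge0].
Qed.

Let mxc m k (M : 'M[K]_(m, k)) : mxcont T (fun=> M).
Proof. exact: mxcont_cst. Qed.

Lemma dev_estimates : sqproc Pr T dctrl ->
  [/\ sqproc Pr T (avg dstate), sqproc Pr T (dstate i),
   pnorm Pr T (avg dstate) <= dev_const * pnorm Pr T dctrl / N%:R ^+ 2 &
   pnorm Pr T (dstate i) <= dev_const * pnorm Pr T dctrl].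
Proof.
move=> sz; have N1 : 1 <= N%:R :> K by rewrite ler1n.
have z0 : 0 <= pnorm Pr T dctrl by exact: pnorm_ge0.
have v0 c : 0 <= volterra_const T c by exact: volterra_const_ge0.
have sB : sqproc Pr T (fun t w => B *m dctrl t w).
  exact: (sqproc_mulmx (M := fun=> B)).
have pB : pnorm Pr T (fun t w => B *m dctrl t w) <= mxfrob B * pnorm Pr T dctrl.
  by apply: (pnorm_mulmx_le (M := fun=> B)).
have sNB : sqproc Pr T (fun t w => N%:R^-1 *: (B *m dctrl t w)) by exact: sqprocZ.
have pNB : pnorm Pr T (fun t w => N%:R^-1 *: (B *m dctrl t w)) <=
    mxfrob B * pnorm Pr T dctrl / N%:R ^+ 2.
  by rewrite pnormZ// exprVn mulrC ler_wpM2r// invr_ge0 exprn_ge0.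
have s0 : sqproc Pr T (fun _ _ => 0 : 'cV[K]_n) by exact: (@sqproc_det _ _ _ Pr T _ (fun=> 0)).
have [sA] : sqproc Pr T (avg dstate) /\ pnorm Pr T (avg dstate) <=
    volterra_const T (mxfrob (A + G)) * (pnorm Pr T (fun _ _ => 0 : 'cV[K]_n) +
      pnorm Pr T (fun t w => N%:R^-1 *: (B *m dctrl t w))).
  apply: (volterra_proc (M := fun=> A + G) T0) => //.
  - exact: mxfrob_ge0.
  - by apply: mproc_avg; exact: dstate_mproc.
  - by move: dstate_mxcont; apply: filterS => w c; apply: cont_sqpath => //; exact: mxcont_avg.
  - by move: avg_dstate_eq; apply: filterS => w E t tT; rewrite add0r; exact: E.
rewrite pnorm_zero add0r => pA.
have {}pA : pnorm Pr T (avg dstate) <=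
    volterra_const T (mxfrob (A + G)) * mxfrob B * pnorm Pr T dctrl / N%:R ^+ 2.
  by apply: le_trans pA _; rewrite -2!mulrA; apply: ler_wpM2l; [exact: v0|rewrite mulrA].
have N2 : N%:R ^- 2 <= 1 :> K by rewrite invf_le1 ?exprn_ege1// exprn_gt0// ltr0n.
have pA1 : pnorm Pr T (avg dstate) <= volterra_const T (mxfrob (A + G)) * mxfrob B * pnorm Pr T dctrl.
  apply: le_trans pA _; rewrite ler_piMr//.
  by do ?[exact: v0|exact: mxfrob_ge0|exact: z0|apply: mulr_ge0].
have sGA : sqproc Pr T (fun t w => G *m avg dstate t w).
  exact: (sqproc_mulmx (M := fun=> G)).
have pGA : pnorm Pr T (fun t w => G *m avg dstate t w) <= mxfrob G * pnorm Pr T (avg dstate).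
  by apply: (pnorm_mulmx_le (M := fun=> G)).
have sh : sqproc Pr T (fun t w => B *m dctrl t w + G *m avg dstate t w) by exact: sqprocD.
have [sI] : sqproc Pr T (dstate i) /\ pnorm Pr T (dstate i) <=
    volterra_const T (mxfrob A) * (pnorm Pr T (fun _ _ => 0 : 'cV[K]_n) +
      pnorm Pr T (fun t w => B *m dctrl t w + G *m avg dstate t w)).
  apply: (volterra_proc (M := fun=> A) T0) => //.
  - exact: mxfrob_ge0.
  - exact: dstate_mproc.
  - by move: dstate_mxcont; apply: filterS => w c; exact: cont_sqpath.
  - by move: dstate_eq; apply: filterS => w E t tT; rewrite add0r (E i t tT) eqxx.
rewrite pnorm_zero add0r => pI.
split => //.
- apply: le_trans pA _; rewrite ler_wpM2r ?invr_ge0 ?exprn_ge0// ler_wpM2r//.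
  rewrite /dev_const lerDl.
  by do ?[exact: ler0n|exact: v0|exact: mxfrob_ge0|apply: addr_ge0|apply: mulr_ge0].
- apply: le_trans pI _.
  pose q := 2 * mxfrob B + 2 * (mxfrob G * (volterra_const T (mxfrob (A + G)) * mxfrob B)).
  apply: (@le_trans _ _ (volterra_const T (mxfrob A) * q * pnorm Pr T dctrl)).
    rewrite -[leRHS]mulrA; apply: ler_wpM2l; first exact: v0.
    apply: le_trans (pnormD_le sB sGA) _.
    apply: (@le_trans _ _ (2 * (mxfrob B * pnorm Pr T dctrl) + 2 * (mxfrob G *
        (volterra_const T (mxfrob (A + G)) * mxfrob B * pnorm Pr T dctrl)))).
      apply: lerD; apply: ler_wpM2l => //; apply: le_trans pGA _.
      by apply: ler_wpM2l => //; exact: mxfrob_ge0.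
    by rewrite le_eqVlt; apply/orP; left; apply/eqP; rewrite /q; ring.
  rewrite ler_wpM2r// /dev_const lerDr.
  by do ?[exact: v0|exact: mxfrob_ge0|exact: z0|apply: mulr_ge0].
Qed.

(** As for the closed loop, the mean deviation is treated first and then serves as input for agent
    i. The condition on the control is asked for almost every time only, since its values are square
    integrable only there. *)
Lemma dev_orth (s1 : K) (Z : Omega -> K) : 0 <= s1 <= T -> sqint Pr setT Z ->
  sqproc Pr T dctrl ->
  {ae leb, forall t, 0 <= t <= s1 -> sqvec Pr (dctrl t) /\
    forall k, \int[Pr]_w (Z w * dctrl t w k 0) = 0} ->
  forall t, 0 <= t <= s1 ->
  [/\ sqvec Pr (avg dstate t), sqvec Pr (dstate i t),
    forall k, \int[Pr]_w (Z w * avg dstate t w k 0) = 0 &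
    forall k, \int[Pr]_w (Z w * dstate i t w k 0) = 0].
Proof.
move=> sT sZ sz oz; have [sA sI _ _] := dev_estimates sz.
have tsT t : 0 <= t <= s1 -> 0 <= t <= T.
  by move=> /andP[-> tu]; case/andP: sT => _; exact: le_trans.
have sB : sqproc Pr T (fun t w => B *m dctrl t w).
  exact: (sqproc_mulmx (M := fun=> B)).
have s0 k : sqint Pr setT (fun w => (0 : 'cV[K]_n) k 0) by exact: sqint_cst_omega.
have o0 (k : 'I_n) : \int[Pr]_w (Z w * (0 : 'cV[K]_n) k 0) = 0.
  under eq_Rintegral do rewrite mxE mulr0; by rewrite /Rintegral integral0.
have oA : forall t, 0 <= t <= s1 -> sqvec Pr (avg dstate t) /\
     forall k, \int[Pr]_w (Z w * avg dstate t w k 0) = 0.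
  apply: (orth_volterra (M := fun=> A + G) (a := fun _ _ => 0)
    (b := fun t w => N%:R^-1 *: (B *m dctrl t w)) T0 sT) => //.
  - exact: sqprocZ.
  - apply: negligibleS oz; apply: subsetC => t H ts k; have [szt ozt] := H ts.
    transitivity (\int[Pr]_w (N%:R^-1 * (Z w * (B *m dctrl t w) k 0))).
      by apply: eq_Rintegral => w _; rewrite [in LHS]mxE; ring.
    rewrite RintegralZl//; last by apply: (sqintM mT sZ); exact: sqvec_mulmx.
    by rewrite orth_mulmx ?mulr0.
  - move=> t ts; move: avg_dstate_eq; apply: filterS => w E.
    by rewrite add0r; apply: E; exact: tsT.
have oI : forall t, 0 <= t <= s1 -> sqvec Pr (dstate i t) /\
     forall k, \int[Pr]_w (Z w * dstate i t w k 0) = 0.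
  apply: (orth_volterra (M := fun=> A) (a := fun _ _ => 0)
    (b := fun t w => B *m dctrl t w + G *m avg dstate t w) T0 sT) => //.
  - by apply: sqprocD => //; exact: (sqproc_mulmx (M := fun=> G)).
  - apply: negligibleS oz; apply: subsetC => t H ts k; have [szt ozt] := H ts.
    have [sAt oAt] := oA t ts.
    apply: orthD => //; [exact: sqvec_mulmx|exact: sqvec_mulmx| |].
      exact: orth_mulmx.
    exact: orth_mulmx.
  - move=> t ts; move: dstate_eq; apply: filterS => w E.
    by rewrite add0r (E i t (tsT _ ts)) eqxx.
by move=> t ts; have [? ?] := oA t ts; have [? ?] := oI t ts; split.
Qed.

End System.
End Deviation.

(** * The adjoint identity and the cost gap *)

Section AdjointIdentity.
Context {d : measure_display} {Omega : measurableType d} {K : realType}.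
Variable Pr : probability Omega K.
Context {n : nat}.
Local Notation process k := (K -> Omega -> 'cV[K]_k).
Local Notation leb := (@lebesgue_measure K).
Variable T : K.
Hypothesis T0 : 0 <= T.
Local Notation IT := ([set` `[0, T]] : set (measurableTypeR K)).
Local Notation ET := (IT `*` [set: Omega]).
Local Notation tw := (leb \x Pr)%E.
Let mT : measurable [set: Omega] := measurableT.
Let mIT : measurable IT. Proof. exact: measurable_itv. Qed.
Let mET : measurable ET. Proof. exact: measurableX. Qed.

Variables (D D' : K -> 'M[K]_n) (l l' : K -> 'cV[K]_n).
Hypothesis D_ac : mxabscont T D D'.
Hypothesis D'_cont : mxcont T D'.
Hypothesis D_T : D T = 0.
Hypothesis l_ac : mxabscont T l l'.
Hypothesis l'_cont : mxcont T l'.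
Hypothesis l_T : l T = 0.
Variables (a b h dx : process n).
Hypothesis a_sq : sqproc Pr T a.
Hypothesis b_sq : sqproc Pr T b.
Hypothesis h_sq : sqproc Pr T h.
Hypothesis dx_sq : sqproc Pr T dx.
Hypothesis a_vec : forall t, 0 <= t <= T -> sqvec Pr (a t).
Hypothesis a_orth : {ae leb, forall u, 0 <= u <= T -> forall t, u <= t <= T ->
  forall i j, \int[Pr]_w ((a t w i 0 - a u w i 0) * h u w j 0) = 0}.
Hypothesis dx_eq : {ae Pr, forall w, forall t, 0 <= t <= T ->
  dx t w = time_integral (h ^~ w) t}.

Let D_cont : mxcont T D.
Proof. by move=> i j; apply: abscont_cont (D_ac i j). Qed.

Let l_cont : mxcont T l.
Proof. by move=> i j; apply: abscont_cont (l_ac i j). Qed.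

Let y : process n := fun t w => time_integral (b ^~ w) t.
Let h1 : process n := fun t w => time_integral (h ^~ w) t.

Let y_sq : sqproc Pr T y. Proof. exact: sqproc_time_integral. Qed.
Let h1_sq : sqproc Pr T h1. Proof. exact: sqproc_time_integral. Qed.

Lemma sqint_cont_mul (c : K -> K) (g : measurableTypeR K * Omega -> K) :
  {within `[0, T], continuous c} -> sqint tw ET g -> sqint tw ET (fun p => c p.1 * g p).
Proof.
move=> cc sg; have [k Hk] := within_cont_bounded cc.
apply: (@sqintM_bounded _ _ _ tw _ mET k) => //.
- apply: (measurable_rect_fst (f := c)) => //; exact: within_cont_measurable.
- by move=> [t w] [/=]; rewrite in_itv/= => tT _; exact: Hk.
Qed.

(* The state is the sum of the driving noise [a] and the absolutely continuous
   part [y]: the adjoint identity is [noise_ibp] on the former and the product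
   rule, path by path, on the latter. *)
Lemma noise_part : \int[tw]_(p in ET) (dotv (D p.1 *m a p.1 p.2) (h p.1 p.2) +
  dotv (D' p.1 *m a p.1 p.2) (h1 p.1 p.2)) = 0.
Proof.
pose t1 i j (p : measurableTypeR K * Omega) := D p.1 i j * (a p.1 p.2 j 0 * h p.1 p.2 i 0)
  + D' p.1 i j * (a p.1 p.2 j 0 * \int[leb]_(s in `[0, p.1]) h s p.2 i 0).
have it1 i j : tw.-integrable ET (EFin \o t1 i j).
  have s1 : tw.-integrable ET (EFin \o (fun p => D p.1 i j * (a p.1 p.2 j 0 * h p.1 p.2 i 0))).
    have := sqintM mET (sqint_cont_mul (@D_cont i j) (a_sq j)) (h_sq i).
    by congr (tw.-integrable _ _); apply/funext => p /=; rewrite mulrA.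
  have s2 : tw.-integrable ET (EFin \o (fun p => D' p.1 i j *
      (a p.1 p.2 j 0 * \int[leb]_(s in `[0, p.1]) h s p.2 i 0))).
    have := sqintM mET (sqint_cont_mul (@D'_cont i j) (a_sq j)) (h1_sq i).
    by congr (tw.-integrable _ _); apply/funext => p /=; rewrite mulrA /h1 /time_integral mxE.
  by have := integrableD mET s1 s2.
have z i j : \int[tw]_(p in ET) t1 i j p = 0.
  apply: (@noise_ibp _ _ _ Pr T T0 (fun p => a p.1 p.2 j 0) (fun p => h p.1 p.2 i 0)
    (fun t => D t i j) (fun t => D' t i j)) => //.
  - by move=> t tT; exact: a_vec.
  - by rewrite D_T mxE.
  - by apply: negligibleS a_orth; apply: subsetC => u H uT t ut; exact: H.
transitivity (\int[tw]_(p in ET) \sum_i \sum_j t1 i j p).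
  apply: eq_Rintegral => p _; rewrite !dotvE -big_split/=; apply: eq_bigr => i _.
  rewrite !mxE !big_distrl -big_split/=; apply: eq_bigr => j _.
  by rewrite /t1; ring.
have its i : tw.-integrable ET (EFin \o (fun p => \sum_j t1 i j p)).
  rewrite (_ : EFin \o _ = fun p => (\sum_j (t1 i j p)%:E)%E); last first.
    by apply/funext => p; rewrite /= sumEFin.
  by apply: integrable_sum => // j _; exact: it1.
rewrite Rint_sum//; apply: big1 => i _; rewrite Rint_sum//; exact: big1.
Qed.

Let V t w := D t *m y t w + l t.
Let V' t w := D' t *m y t w + D t *m b t w + l' t.

Lemma drift_part : \int[tw]_(p in ET) (dotv (V p.1 p.2) (h p.1 p.2) +
  dotv (V' p.1 p.2) (h1 p.1 p.2)) = 0.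
Proof.
have V_sq : sqproc Pr T V.
  by apply: sqprocD; [exact: sqproc_mulmx|exact: sqproc_det].
have V'_sq : sqproc Pr T V'.
  apply: sqprocD; last exact: sqproc_det.
  by apply: sqprocD; exact: sqproc_mulmx.
have i1 := sqproc_dotv V_sq h_sq; have i2 := sqproc_dotv V'_sq h1_sq.
have i12 : tw.-integrable ET (EFin \o (fun p => dotv (V p.1 p.2) (h p.1 p.2) +
  dotv (V' p.1 p.2) (h1 p.1 p.2))) by have := integrableD mET i1 i2.
rewrite (fubini_rect2 mIT mT i12).
transitivity (\int[Pr]_(w in [set: Omega]) (0 : K)); last by rewrite /Rintegral integral0.
apply: Rint_ae => //.
  by have /measurable_int/measurable_EFinP := integrable_rect2 mIT mT i12.
move: (ae_sqpath b_sq) (ae_sqpath h_sq); apply: filterS2 => w sb sh _.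
have ib j : integ T (fun t => b t w j 0) by exact: sqpath_integ.
have ih j : integ T (fun t => h t w j 0) by exact: sqpath_integ.
have acV : mxabscont T (V ^~ w) (V' ^~ w).
  apply: mxabscontD => //; apply: mxabscontM => //; exact: time_integral_prim.
have [_ H] := mxabscontM T0 (mxabscont_trmx acV) (time_integral_prim ih) 0 0.
have := H T; rewrite T0 lexx => /(_ isT).
rewrite {1}/V D_T l_T mul0mx addr0 trmx0 mul0mx mxE time_integral0 mulmx0 mxE add0r.
move=> E; rewrite [RHS]E; apply: eq_Rintegral => t _.
by rewrite mxE addrC.
Qed.

(** With x = a + int b, this is the expected product rule for the pairing of D x + l with [dx]: one
    summand pairs D x + l with the drift [h] of [dx], the other pairs the drift of D x + l with
    [dx]. The end terms vanish since D and l are 0 at T and [dx] is almost surely 0 at 0. *)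
Lemma adjoint_identity : \int[tw]_(p in ET)
   (dotv (D p.1 *m (a p.1 p.2 + time_integral (b ^~ p.2) p.1) + l p.1) (h p.1 p.2) +
    dotv (D' p.1 *m (a p.1 p.2 + time_integral (b ^~ p.2) p.1) + D p.1 *m b p.1 p.2 + l' p.1)
      (dx p.1 p.2)) = 0.
Proof.
pose pi t w := D t *m (a t w + y t w) + l t.
pose g t w := D' t *m (a t w + y t w) + D t *m b t w + l' t.
have pi_sq : sqproc Pr T pi.
  by apply: sqprocD; [apply: sqproc_mulmx => //; exact: sqprocD|exact: sqproc_det].
have g_sq : sqproc Pr T g.
  apply: sqprocD; last exact: sqproc_det.
  by apply: sqprocD; apply: sqproc_mulmx => //; exact: sqprocD.
have i1 := sqproc_dotv pi_sq h_sq.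
have i2 := sqproc_dotv g_sq h1_sq; have i2' := sqproc_dotv g_sq dx_sq.
have i12 : tw.-integrable ET (EFin \o (fun p => dotv (pi p.1 p.2) (h p.1 p.2) +
  dotv (g p.1 p.2) (h1 p.1 p.2))) by have := integrableD mET i1 i2.
have i12' : tw.-integrable ET (EFin \o (fun p => dotv (pi p.1 p.2) (h p.1 p.2) +
  dotv (g p.1 p.2) (dx p.1 p.2))) by have := integrableD mET i1 i2'.
have V_sq : sqproc Pr T V.
  by apply: sqprocD; [exact: sqproc_mulmx|exact: sqproc_det].
have V'_sq : sqproc Pr T V'.
  apply: sqprocD; last exact: sqproc_det.
  by apply: sqprocD; exact: sqproc_mulmx.
have j1 := integrableD mET (sqproc_dotv V_sq h_sq) (sqproc_dotv V'_sq h1_sq).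
have j2 := integrableD mET (sqproc_dotv (sqproc_mulmx D_cont a_sq) h_sq)
  (sqproc_dotv (sqproc_mulmx D'_cont a_sq) h1_sq).
transitivity (\int[tw]_(p in ET) (dotv (pi p.1 p.2) (h p.1 p.2) +
  dotv (g p.1 p.2) (h1 p.1 p.2))).
  rewrite (fubini_rect2 mIT mT i12) (fubini_rect2 mIT mT i12').
  apply: Rint_ae => //.
  - by have /measurable_int/measurable_EFinP := integrable_rect2 mIT mT i12'.
  - by have /measurable_int/measurable_EFinP := integrable_rect2 mIT mT i12.
  move: dx_eq; apply: filterS => w E _; apply: eq_Rintegral => t.
  by rewrite inE/= in_itv/= => tT; rewrite (E t tT).
rewrite -[RHS](addr0 0) -[X in _ = X + _]noise_part -[X in _ = _ + X]drift_part.
rewrite -RintegralD//.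
apply: eq_Rintegral => p _; rewrite /pi /g /V /V' !mulmxDr !dotvDl; ring.
Qed.

End AdjointIdentity.

(** * Algebra of the Riccati equations and of the quadratic cost *)

Section Riccati.
Context {K : realType} {n r : nat}.
Variables (A G Gamma Q : 'M[K]_n) (B : 'M[K]_(n, r)) (R : 'M[K]_r) (rho : K)
  (eta : 'cV[K]_n).
Local Notation SS := (B *m invmx R *m B^T).

Definition riccati_rhs (P : 'M[K]_n) : 'M[K]_n :=
  rho *: P - A^T *m P - P *m A + P *m B *m invmx R *m B^T *m P - Q.

Definition riccati_bar_rhs (Pb : 'M[K]_n) : 'M[K]_n :=
  rho *: Pb - A^T *m Pb - Pb *m (A + G) + Pb *m B *m invmx R *m B^T *m Pb
    - Q + Q *m Gamma.

Definition offset_rhs (Pb : 'M[K]_n) (s f : 'cV[K]_n) : 'cV[K]_n :=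
  rho *: s - (A^T - Pb *m B *m invmx R *m B^T) *m s - Pb *m f + Q *m eta.

Definition mean_rhs (Pb : 'M[K]_n) (s f x : 'cV[K]_n) : 'cV[K]_n :=
  A *m x - SS *m (Pb *m x + s) + G *m x + f.

(** With p = P x + (Pb - P) xb + s, the left side is the drift of p along the closed loop, minus rho
    p from the discount, plus A^T p. The Riccati equations leave only the cost gradient with the
    mean frozen at xb, and the mean-field error P G (y - xb). *)
Lemma riccati_cancel (P Pb : 'M[K]_n) (xb s f x y : 'cV[K]_n) :
  (riccati_rhs P - rho *: P) *m x
  + P *m ((A - SS *m P) *m x + G *m y + (f - SS *m ((Pb - P) *m xb + s)))
  + ((riccati_bar_rhs Pb - riccati_rhs P) *m xb + (Pb - P) *m mean_rhs Pb s f xb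
     + offset_rhs Pb s f - rho *: ((Pb - P) *m xb + s))
  + A^T *m (P *m x + ((Pb - P) *m xb + s)) =
  - (Q *m (x - Gamma *m xb - eta) - P *m (G *m (y - xb))).
Proof.
rewrite /riccati_rhs /riccati_bar_rhs /offset_rhs /mean_rhs.
rewrite !(mulmxDl, mulmxDr, mulNmx, mulmxN, scalerDr, scalerN) -!scalemxAl -!mulmxA.
mx_abelian.
Qed.

Lemma wsqnorm_shift k (M : 'M[K]_k) u v : mxsym M ->
  wsqnorm M (u + v) - wsqnorm M u = wsqnorm M v + 2 * dotv (M *m u) v.
Proof. by move=> sM; rewrite wsqnormD//; ring. Qed.

(* [idn] is the integrand of the adjoint identity; adding twice it to the cost
   gap removes the terms that are linear in the deviation and not small in N. *)
Lemma cost_gap (e : K) (P : 'M[K]_n) (l g2 x y xb dx dy p : 'cV[K]_n) (u z : 'cV[K]_r) :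
  mxsym Q -> mxsym R -> R *m u = - (B^T *m p) -> e *: p = e *: (P *m x) + l ->
  g2 + A^T *m (e *: (P *m x) + l) =
    - (e *: (Q *m (x - Gamma *m xb - eta) - P *m (G *m (y - xb)))) ->
  let q := x - Gamma *m y - eta in
  let pi := e *: (P *m x) + l in
  e * (wsqnorm Q ((x + dx) - Gamma *m (y + dy) - eta) + wsqnorm R (u + z))
  - e * (wsqnorm Q q + wsqnorm R u)
  + 2 * (dotv pi (A *m dx + (B *m z + G *m dy)) + dotv g2 dx) =
  e * wsqnorm Q (dx - Gamma *m dy) + e * wsqnorm R z
  + 2 * dotv (e *: ((P *m G - Q *m Gamma) *m (y - xb))) dx
  + 2 * dotv (G^T *m pi - e *: (Gamma^T *m (Q *m q))) dy.
Proof.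
move=> sQ sR Ru ep g2E q pi.
have -> : (x + dx) - Gamma *m (y + dy) - eta = q + (dx - Gamma *m dy).
  by rewrite /q mulmxDr; mx_abelian.
have h1 := wsqnorm_shift q (dx - Gamma *m dy) sQ.
have h2 := wsqnorm_shift u z sR.
have -> : g2 = - (e *: (Q *m (x - Gamma *m xb - eta) - P *m (G *m (y - xb)))) - A^T *m pi.
  by rewrite -g2E addrK.
(* The first-order condition R u = - B^T p trades the linear control term of the cost for the
   control term in the drift of the deviation. *)
have h3 : e * dotv (R *m u) z = - dotv pi (B *m z).
  by rewrite Ru dotvNl /pi -ep dotvZl dotv_mulmxr mulrN.
have h4 : dotv (A^T *m pi) dx = dotv pi (A *m dx) by rewrite dotv_mulmxr.
have h5 : dotv (G^T *m pi) dy = dotv pi (G *m dy) by rewrite dotv_mulmxr.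
have h6 : dotv (Gamma^T *m (Q *m q)) dy = dotv (Q *m q) (Gamma *m dy).
  by rewrite [RHS]dotv_mulmxr.
have h7 : dotv ((P *m G - Q *m Gamma) *m (y - xb)) dx =
    dotv (Q *m q) dx - dotv (Q *m (x - Gamma *m xb - eta) - P *m (G *m (y - xb))) dx.
  rewrite -dotvBl; congr (dotv _ dx); rewrite /q.
  by rewrite !(mulmxDl, mulmxDr, mulNmx, mulmxN) -!mulmxA; mx_abelian.
rewrite !dotvDr !dotvBl !dotvNl !dotvZl h4 h5 h6 h7.
have -> : wsqnorm Q (q + (dx - Gamma *m dy)) =
    wsqnorm Q q + (wsqnorm Q (dx - Gamma *m dy) + 2 * dotv (Q *m q) (dx - Gamma *m dy)).
  by rewrite -h1; ring.
have -> : wsqnorm R (u + z) = wsqnorm R u + (wsqnorm R z + 2 * dotv (R *m u) z).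
  by rewrite -h2; ring.
rewrite dotvBr -/pi.
move: h3; move: (dotv (R *m u) z) (dotv pi (B *m z)) => a1 a2 h3.
have -> : a2 = - (e * a1) by rewrite h3 opprK.
by ring.
Qed.

End Riccati.

Section HasIntegral.
Context {dd : measure_display} {S : measurableType dd} {K : realType}.
Variables (mu : {measure set S -> \bar K}) (D : set S).
Hypothesis mD : measurable D.

(** Integrability and value travel together, so that a comparison of long linear combinations of
    integrals reduces to one pointwise inequality. *)
Definition hasint (f : S -> K) (v : K) :=
  mu.-integrable D (EFin \o f) /\ \int[mu]_(x in D) f x = v.

Lemma hasint_integrable f : mu.-integrable D (EFin \o f) ->
  hasint f (\int[mu]_(x in D) f x).
Proof. by []. Qed.

Lemma hasintD f g v w : hasint f v -> hasint g w -> hasint (fun x => f x + g x) (v + w).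
Proof.
move=> [jf <-] [jg <-]; split; first by have := integrableD mD jf jg.
by rewrite RintegralD.
Qed.

Lemma hasintZ c f v : hasint f v -> hasint (fun x => c * f x) (c * v).
Proof.
move=> [jf <-]; split; last by rewrite RintegralZl.
by under [EFin \o _]eq_fun do rewrite /= EFinM; exact: integrableZl.
Qed.

Lemma hasint_le f g v w : (forall x, D x -> f x <= g x) -> hasint f v -> hasint g w -> v <= w.
Proof. by move=> fg [jf <-] [jg <-]; exact: le_Rintegral. Qed.

End HasIntegral.

(** * Regularity of P, Pbar, shat, xbar and of the discounted adjoint coefficients *)

Section Coefficients.
Context {K : realType} {n r : nat}.
Local Notation leb := (@lebesgue_measure K).
Variables (T rho : K) (A G Gamma Q : 'M[K]_n) (B : 'M[K]_(n, r)) (R : 'M[K]_r)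
  (eta : 'cV[K]_n) (f : K -> 'cV[K]_n) (xbar0 : 'cV[K]_n)
  (P Pbar : K -> 'M[K]_n) (shat xbar : K -> 'cV[K]_n).
Hypothesis T0 : 0 <= T.
Hypothesis f_cont : mxcont T f.
Hypothesis Pbar_ode : [/\ ode_regular T Pbar,
      forall t, 0 < t < T ->
        rho *: Pbar t = derive1 Pbar t + A^T *m Pbar t + Pbar t *m (A + G)
          - Pbar t *m B *m invmx R *m B^T *m Pbar t + Q - Q *m Gamma &
      Pbar T = 0].
Hypothesis P_ode : [/\ ode_regular T P,
      forall t, 0 < t < T ->
        rho *: P t = derive1 P t + A^T *m P t + P t *m A
          - P t *m B *m invmx R *m B^T *m P t + Q &
      P T = 0].
Hypothesis shat_ode : [/\ ode_regular T shat,
      forall t, 0 < t < T ->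
        rho *: shat t = derive1 shat t
          + (A^T - Pbar t *m B *m invmx R *m B^T) *m shat t
          + Pbar t *m f t - Q *m eta &
      shat T = 0].
Hypothesis xbar_ode : [/\ ode_regular T xbar,
      forall t, 0 < t < T ->
        derive1 xbar t = A *m xbar t
          - B *m invmx R *m B^T *m (Pbar t *m xbar t + shat t)
          + G *m xbar t + f t &
      xbar 0 = xbar0].
Local Notation SS := (B *m invmx R *m B^T).

Let cc m k (M : 'M[K]_(m, k)) : mxcont T (fun=> M).
Proof. exact: mxcont_cst. Qed.

Lemma P_cont : mxcont T P.
Proof. by have [[c _] _ _] := P_ode; exact: mxcont_within. Qed.

Lemma Pbar_cont : mxcont T Pbar.
Proof. by have [[c _] _ _] := Pbar_ode; exact: mxcont_within. Qed.

Lemma shat_cont : mxcont T shat.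
Proof. by have [[c _] _ _] := shat_ode; exact: mxcont_within. Qed.

Lemma xbar_cont : mxcont T xbar.
Proof. by have [[c _] _ _] := xbar_ode; exact: mxcont_within. Qed.

Let rho_cont m k (X : K -> 'M[K]_(m, k)) : mxcont T X -> mxcont T (fun t => rho *: X t).
Proof. by apply: mxcontZ; exact: cst_continuous. Qed.

Ltac mxc := repeat lazymatch goal with
  | |- mxcont _ (fun t => _ - _) => apply: mxcontB
  | |- mxcont _ (fun t => _ + _) => apply: mxcontD
  | |- mxcont _ (fun t => rho *: _) => apply: rho_cont
  | |- mxcont _ (fun t => _ *m _) => apply: mxcontM
  | |- mxcont _ _ => first [exact: P_cont | exact: Pbar_cont | exact: shat_cont
      | exact: xbar_cont | exact: f_cont | exact: cc]
  end.

Lemma riccati_cont : mxcont T (fun t => riccati_rhs A Q B R rho (P t)).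
Proof. by rewrite /riccati_rhs; mxc. Qed.

Lemma riccati_bar_cont : mxcont T (fun t => riccati_bar_rhs A G Gamma Q B R rho (Pbar t)).
Proof. by rewrite /riccati_bar_rhs; mxc. Qed.

Lemma offset_cont : mxcont T (fun t => offset_rhs A Q B R rho eta (Pbar t) (shat t) (f t)).
Proof. by rewrite /offset_rhs; mxc. Qed.

Lemma mean_cont : mxcont T (fun t => mean_rhs A G B R (Pbar t) (shat t) (f t) (xbar t)).
Proof. by rewrite /mean_rhs; mxc. Qed.

Lemma P_ac : mxabscont T P (fun t => riccati_rhs A Q B R rho (P t)).
Proof.
have [reg ode _] := P_ode; apply: mxabscont_ode => //; first exact: riccati_cont.
move=> t tT; rewrite /riccati_rhs (ode t tT); move: (derive1 P t) => p.
by mx_abelian.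
Qed.

Lemma Pbar_ac : mxabscont T Pbar (fun t => riccati_bar_rhs A G Gamma Q B R rho (Pbar t)).
Proof.
have [reg ode _] := Pbar_ode; apply: mxabscont_ode => //; first exact: riccati_bar_cont.
move=> t tT; rewrite /riccati_bar_rhs (ode t tT); move: (derive1 Pbar t) => p.
by mx_abelian.
Qed.

Lemma shat_ac : mxabscont T shat (fun t => offset_rhs A Q B R rho eta (Pbar t) (shat t) (f t)).
Proof.
have [reg ode _] := shat_ode; apply: mxabscont_ode => //; first exact: offset_cont.
move=> t tT; rewrite /offset_rhs (ode t tT); move: (derive1 shat t) => p.
by mx_abelian.
Qed.

Lemma xbar_ac : mxabscont T xbar (fun t => mean_rhs A G B R (Pbar t) (shat t) (f t) (xbar t)).
Proof.
have [reg ode _] := xbar_ode; apply: mxabscont_ode => //; exact: mean_cont.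
Qed.

Definition cl_matrix t : 'M[K]_n := A - SS *m P t.
Definition cl_offset t : 'cV[K]_n := f t - SS *m ((Pbar t - P t) *m xbar t + shat t).

Lemma cl_matrix_cont : mxcont T cl_matrix.
Proof. by rewrite /cl_matrix; mxc. Qed.

Lemma cl_offset_cont : mxcont T cl_offset.
Proof. by rewrite /cl_offset; mxc. Qed.

(** Splitting Pbar xbar as P xbar + (Pbar - P) xbar puts the limit equation into the form of
    [cl_avg_eq] without noise, so that the two can be subtracted. *)
Lemma xbar_integral t : 0 <= t <= T ->
  xbar t = xbar0 + time_integral (fun s => (cl_matrix s + G) *m xbar s + cl_offset s) t.
Proof.
move=> tT; have [_ _ x0E] := xbar_ode.
apply/matrixP => j k; rewrite ord1 [RHS]mxE; have [_ ac] := xbar_ac j 0.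
rewrite (ac t tT) x0E; congr (_ + _); rewrite mxE; apply: eq_Rintegral => s _.
congr ((_ : 'cV[K]_n) j 0).
rewrite /mean_rhs /cl_matrix /cl_offset.
by rewrite !(mulmxDl, mulmxDr, mulNmx, mulmxN) -!mulmxA; mx_abelian.
Qed.

Definition disc t : K := expR (- (rho * t)).

Lemma disc_ac : abscont T disc (fun t => - rho * disc t).
Proof.
by apply: eq_abscont (abscont_expR T (- rho)) => // t _; rewrite /disc -(mulNr rho t).
Qed.

Lemma disc_cont : {within `[0, T], continuous disc}.
Proof. exact: abscont_cont disc_ac. Qed.

Lemma disc_mx m k (X X' : K -> 'M[K]_(m, k)) : mxabscont T X X' ->
  mxabscont T (fun t => disc t *: X t) (fun t => disc t *: (X' t - rho *: X t)).
Proof.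
move=> acX; apply: eq_mxabscont (mxabscontZ T0 disc_ac acX) => // t _.
by rewrite scalerBr scalerA addrC mulNr scaleNr (mulrC rho).
Qed.

Definition offset t : 'cV[K]_n := (Pbar t - P t) *m xbar t + shat t.
Definition offset' t : 'cV[K]_n :=
  (riccati_bar_rhs A G Gamma Q B R rho (Pbar t) - riccati_rhs A Q B R rho (P t)) *m xbar t
  + (Pbar t - P t) *m mean_rhs A G B R (Pbar t) (shat t) (f t) (xbar t)
  + offset_rhs A Q B R rho eta (Pbar t) (shat t) (f t).

Lemma offset_ac : mxabscont T offset offset'.
Proof.
apply: mxabscontD shat_ac; apply: mxabscontM xbar_ac => //.
by apply: mxabscontD Pbar_ac _; exact: mxabscontN P_ac.
Qed.

Lemma offset_mxcont : mxcont T offset.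
Proof. by rewrite /offset; mxc. Qed.

Lemma offset'_mxcont : mxcont T offset'.
Proof.
rewrite /offset'; apply: mxcontD offset_cont; apply: mxcontD.
  by apply: mxcontM xbar_cont => //; apply: mxcontB riccati_cont => //; exact: riccati_bar_cont.
by apply: mxcontM mean_cont => //; mxc.
Qed.

Lemma adjoint_cancel t (x y : 'cV[K]_n) :
  (disc t *: (riccati_rhs A Q B R rho (P t) - rho *: P t)) *m x
  + (disc t *: P t) *m (cl_matrix t *m x + G *m y + cl_offset t)
  + disc t *: (offset' t - rho *: offset t)
  + A^T *m (disc t *: (P t *m x) + disc t *: offset t) =
  - (disc t *: (Q *m (x - Gamma *m xbar t - eta) - P t *m (G *m (y - xbar t)))).
Proof.
rewrite -[RHS]scalerN -(riccati_cancel A G Gamma Q B R rho eta (P t) (Pbar t) (xbar t) (shat t) (f t)).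
rewrite -!scalemxAl -!scalerDr -scalemxAr -!scalerDr.
by rewrite /offset' /offset /cl_matrix /cl_offset.
Qed.

End Coefficients.

(** * Comparison of the costs *)

Section Equilibrium.
Context (d : measure_display) (Omega : measurableType d) (K : realType).
Variables (Pr : probability Omega K) (n r : nat)
  (T rho : K) (A G Gamma Q : 'M[K]_n) (B : 'M[K]_(n, r)) (R : 'M[K]_r)
  (eta : 'cV[K]_n) (f sigma : K -> 'cV[K]_n)
  (W : nat -> K -> Omega -> K) (x0 : nat -> Omega -> 'cV[K]_n)
  (xbar0 : 'cV[K]_n) (C0 : K)
  (P Pbar : K -> 'M[K]_n) (shat xbar : K -> 'cV[K]_n)
  (xh : forall N : nat, 'I_N -> K -> Omega -> 'cV[K]_n)
  (uh : forall N : nat, 'I_N -> K -> Omega -> 'cV[K]_r).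
Hypotheses (T_gt0 : 0 < T)
  (Q_sym : mxsym Q) (Q_psd : mxpsd Q) (R_sym : mxsym R) (R_pos : mxposdef R)
  (f_cont : mxcont T f)
  (W_bm : forall i, brownian_motion Pr (W i))
  (W_indep : mutually_indep Pr (fun i => process_sigma (W i)))
  (x0_rv : forall i, random_vector (x0 i))
  (x0_indep : mutually_indep Pr (fun i => sigma_gen (coords (x0 i))))
  (x0_mean : forall i j, 'E_Pr[fun w => x0 i w j 0%R]%E = (xbar0 j 0)%:E)
  (x0_bound : forall i, (\int[Pr]_w (sqnorm (x0 i w))%:E < C0%:E)%E)
  (x0_W_indep : indep Pr
      (<<s \bigcup_i sigma_gen (coords (x0 i)) >>)
      (<<s \bigcup_i process_sigma (W i) >>))
  (Pbar_ode : [/\ ode_regular T Pbar,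
      forall t, 0 < t < T ->
        rho *: Pbar t = derive1 Pbar t + A^T *m Pbar t + Pbar t *m (A + G)
          - Pbar t *m B *m invmx R *m B^T *m Pbar t + Q - Q *m Gamma &
      Pbar T = 0])
  (P_ode : [/\ ode_regular T P,
      forall t, 0 < t < T ->
        rho *: P t = derive1 P t + A^T *m P t + P t *m A
          - P t *m B *m invmx R *m B^T *m P t + Q &
      P T = 0])
  (shat_ode : [/\ ode_regular T shat,
      forall t, 0 < t < T ->
        rho *: shat t = derive1 shat t
          + (A^T - Pbar t *m B *m invmx R *m B^T) *m shat t
          + Pbar t *m f t - Q *m eta &
      shat T = 0])
  (xbar_ode : [/\ ode_regular T xbar,
      forall t, 0 < t < T ->
        derive1 xbar t = A *m xbar t
          - B *m invmx R *m B^T *m (Pbar t *m xbar t + shat t)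
          + G *m xbar t + f t &
      xbar 0 = xbar0])
  (xh_sde : forall (N : nat) (i : 'I_N),
      sde_solution Pr T
        (fun t w =>
           (A - B *m invmx R *m B^T *m P t) *m xh i t w
           - B *m invmx R *m B^T *m ((Pbar t - P t) *m xbar t + shat t)
           + G *m avg (xh (N := N)) t w + f t)
        sigma (W i) (x0 i) (xh i))
  (uh_def : forall (N : nat) (i : 'I_N) (t : K) (w : Omega),
      uh i t w = - (invmx R *m B^T *m
        (P t *m xh i t w + (Pbar t - P t) *m xbar t + shat t))).
Variable S : K.
Hypothesis S0 : 0 <= S.
Hypothesis sigma_le : forall t k, 0 <= t <= T -> sigma t k 0 ^+ 2 <= S.

Local Notation leb := (@lebesgue_measure K).
Local Notation IT := ([set` `[0, T]] : set (measurableTypeR K)).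
Local Notation ET := (IT `*` [set: Omega]).
Local Notation tw := (leb \x Pr)%E.
Local Notation process k := (K -> Omega -> 'cV[K]_k).
Local Notation cM := (cl_matrix A B R P).
Local Notation cc := (cl_offset B R f P Pbar shat xbar).
Local Notation e_ := (disc rho).
Local Notation off := (offset P Pbar shat xbar).
Let mT : measurable [set: Omega] := measurableT.
Let mIT : measurable IT. Proof. exact: measurable_itv. Qed.
Let mET : measurable ET. Proof. exact: measurableX. Qed.
Let T0 : 0 <= T. Proof. exact: ltW. Qed.
Let cst_cont m k (M : 'M[K]_(m, k)) : mxcont T (fun=> M).
Proof. exact: mxcont_cst. Qed.
Let e_cont : {within `[0, T], continuous e_}.
Proof. exact: disc_cont. Qed.
Let P_c : mxcont T P. Proof. exact: (P_cont P_ode). Qed.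
Let off_c : mxcont T off. Proof. exact: (offset_mxcont Pbar_ode P_ode shat_ode xbar_ode). Qed.
Let cM_c : mxcont T cM. Proof. exact: (cl_matrix_cont P_ode). Qed.
Let cc_c : mxcont T cc. Proof. exact: (cl_offset_cont f_cont Pbar_ode P_ode shat_ode xbar_ode). Qed.
Let xbar_c : mxcont T xbar. Proof. exact: (xbar_cont xbar_ode). Qed.
Let eZ_cont m k (M : K -> 'M[K]_(m, k)) : mxcont T M -> mxcont T (fun t => e_ t *: M t).
Proof. exact: mxcontZ. Qed.

Let rho_cont m k (M : K -> 'M[K]_(m, k)) : mxcont T M -> mxcont T (fun t => rho *: M t).
Proof. by apply: mxcontZ; exact: cst_continuous. Qed.

Lemma xh_closed_loop N (i : 'I_N) :
  sde_solution Pr T (cl_drift cM G cc (xh (N := N)) i) sigma (W i) (x0 i) (xh i).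
Proof.
have := xh_sde i; congr (sde_solution Pr T _ _ _ _ _).
apply/funext => t; apply/funext => w; rewrite /cl_drift /cl_matrix /cl_offset.
by mx_abelian.
Qed.

(** Substituting the feedback into the controlled dynamics reproduces the closed-loop equation, so
    the xh_i can be compared with the states after a deviation. *)
Lemma xh_states N : states Pr T A B G f sigma x0 W (uh (N := N)) (xh (N := N)).
Proof.
move=> i; have := xh_sde i; congr (sde_solution Pr T _ _ _ _ _).
apply/funext => t; apply/funext => w; rewrite uh_def.
rewrite !(mulmxDl, mulmxDr, mulNmx, mulmxN) -!mulmxA.
by mx_abelian.
Qed.

Lemma R_uh N (i : 'I_N) t w :
  R *m uh i t w = - (B^T *m (P t *m xh i t w + off t)).
Proof.
by rewrite uh_def mulmxN -mulmxA mulKVmx ?posdef_unit// /offset addrA.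
Qed.

Definition running_cost (x y : process n) (u : process r) (p : measurableTypeR K * Omega) : K :=
  e_ p.1 * (wsqnorm Q (x p.1 p.2 - Gamma *m y p.1 p.2 - eta) + wsqnorm R (u p.1 p.2)).

Lemma running_cost_integrable x y u : sqproc Pr T x -> sqproc Pr T y -> sqproc Pr T u ->
  tw.-integrable ET (EFin \o running_cost x y u).
Proof.
move=> sx sy su.
have sq : sqproc Pr T (fun t w => x t w - Gamma *m y t w - eta).
  apply: sqprocB; last exact: (sqproc_det Pr (@cst_cont _ _ eta)).
  by apply: sqprocB => //; exact: (sqproc_mulmx (@cst_cont _ _ Gamma)).
have i1 := sqproc_dotv sq (sqproc_mulmx (eZ_cont (@cst_cont _ _ Q)) sq).
have i2 := sqproc_dotv su (sqproc_mulmx (eZ_cont (@cst_cont _ _ R)) su).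
have := integrableD mET i1 i2; congr (tw.-integrable _ _); apply/funext => p /=.
by rewrite /running_cost !wsqnormE -!scalemxAl !dotvZr -EFinD mulrDr.
Qed.

Lemma costE N (i : 'I_N) (u : 'I_N -> process r) (X : 'I_N -> process n) :
  sqproc Pr T (X i) -> sqproc Pr T (avg X) -> sqproc Pr T (u i) ->
  cost Pr T rho Gamma Q R eta i u X =
  (\int[tw]_(p in ET) running_cost (X i) (avg X) (u i) p)%:E.
Proof.
move=> sX sA su.
by rewrite -(expected_time_integral (running_cost_integrable sX sA su)).
Qed.

Lemma uh_sqproc N (i : 'I_N) : sqproc Pr T (xh i) -> sqproc Pr T (uh i).
Proof.
move=> sx.
have sp : sqproc Pr T (fun t w => P t *m xh i t w + off t).
  by apply: sqprocD; [exact: sqproc_mulmx|exact: sqproc_det].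
have := sqprocN (sqproc_mulmx (@cst_cont _ _ (invmx R *m B^T)) sp).
congr (sqproc _ _ _); apply/funext => t; apply/funext => w.
by rewrite uh_def /offset addrA.
Qed.

Section Gap.
Variables (N : nat) (i : 'I_N) (v : process r) (X : 'I_N -> process n).
Hypothesis v_adapted : L2_adapted Pr T (filtration N x0 W) v.
Hypothesis X_states : states Pr T A B G f sigma x0 W (deviate (uh (N := N)) i v) X.
Hypothesis xh_sq : forall j : 'I_N, sqproc Pr T (xh j).
Hypothesis avg_sq : sqproc Pr T (avg (xh (N := N))).
Let N0 : (0 < N)%N. Proof. by case: N i => // -[]. Qed.

Local Notation z := (dctrl i (uh (N := N)) v).
Local Notation dx := (dstate (xh (N := N)) X i).
Local Notation dy := (avg (dstate (xh (N := N)) X)).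
Local Notation drift := (cl_drift cM G cc (xh (N := N)) i).

Let v_sq : sqproc Pr T v.
Proof. by have [mv _ iv] := v_adapted; exact: sqprocP. Qed.

Let z_sq : sqproc Pr T z.
Proof. by apply: sqprocB => //; exact: uh_sqproc. Qed.

Let dev := dev_estimates W_bm T0 (@xh_states N) X_states N0 z_sq.
Let dx_sq : sqproc Pr T dx. Proof. by case: dev. Qed.
Let dy_sq : sqproc Pr T dy. Proof. by case: dev. Qed.

Definition dev_drift : process n := fun t w => A *m dx t w + (B *m z t w + G *m dy t w).

Let dev_drift_sq : sqproc Pr T dev_drift.
Proof.
apply: sqprocD; first exact: (sqproc_mulmx (@cst_cont _ _ A)).
by apply: sqprocD; [exact: (sqproc_mulmx (@cst_cont _ _ B))|exact: (sqproc_mulmx (@cst_cont _ _ G))].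
Qed.

(** With [Z] the noise increment from u to t, [v s] for s <= u is orthogonal to [Z] by adaptedness
    and xh_i s by [cl_orth]; hence so is the control difference, and by [dev_orth] both deviations
    at u. Almost every u is needed because [v u] must be square integrable. *)
Lemma noise_dev_orth : {ae leb, forall u, 0 <= u <= T -> forall t, u <= t <= T ->
  forall k l, \int[Pr]_w ((noise drift (xh i) t w k 0 - noise drift (xh i) u w k 0)
    * dev_drift u w l 0) = 0}.
Proof.
have vv := ae_sqvec v_sq.
apply: negligibleS (vv); apply: subsetC => u /= vU uT t ut k l.
have u0 : 0 <= u by case/andP: uT.
have tT : 0 <= t <= T by case/andP: ut => ut -> ; rewrite (le_trans u0).
pose Z w := noise drift (xh i) t w k 0 - noise drift (xh i) u w k 0.
have nb s (sT : 0 <= s <= T) := noise_bound W_bm W_indep x0_rv x0_bound x0_W_indep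
  sigma_le S0 (xh_closed_loop i) k sT.
have sZ : sqint Pr setT Z.
  by apply: sqintB => //; [case: (nb t tT)|case: (nb u uT)].
have oZ : forall Y, fmeas (filtration N x0 W u) Y -> sqint Pr setT Y ->
     \int[Pr]_w (Z w * Y w) = 0.
  move=> Y fY sY; have /andP[ut' tT'] := ut.
  exact: (noise_incr_orth W_bm W_indep x0_rv x0_W_indep T0 sigma_le S0
    (xh_closed_loop i) k u0 ut' tT' fY sY).
have [oA oX] := cl_orth W_bm W_indep x0_rv x0_bound x0_W_indep T0 sigma_le S0 cM_c cc_c
  N0 (@xh_closed_loop N) uT sZ avg_sq xh_sq oZ.
have oz s : 0 <= s <= u -> sqvec Pr (v s) -> sqvec Pr (z s) /\
    forall k, \int[Pr]_w (Z w * z s w k 0) = 0.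
  move=> su sv.
  have sT : 0 <= s <= T.
    by case/andP: su => -> /le_trans; apply; case/andP: uT.
  have [sx ox] := oX i s su.
  have soff : sqvec Pr (fun _ => off s) by move=> j; exact: sqint_cst_omega.
  have sPx : sqvec Pr (fun w => P s *m xh i s w) by exact: sqvec_mulmx.
  have sp : sqvec Pr (fun w => P s *m xh i s w + off s) by exact: sqvecD.
  have op j : \int[Pr]_w (Z w * (P s *m xh i s w + off s) j 0) = 0.
    apply: orthD => //; first exact: orth_mulmx.
    by apply: oZ; [exact: fmeas_cst|exact: sqint_cst_omega].
  have su' : sqvec Pr (fun w => (invmx R *m B^T) *m (P s *m xh i s w + off s)).
    exact: sqvec_mulmx.
  have ou j : \int[Pr]_w (Z w * ((invmx R *m B^T) *m (P s *m xh i s w + off s)) j 0) = 0.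
    exact: orth_mulmx.
  (* Adaptedness of the deviating control enters here: [v s] is measurable for the past of s, which
     is contained in that of u. *)
  have ov j : \int[Pr]_w (Z w * v s w j 0) = 0.
    apply: oZ => //; have [_ av _] := v_adapted.
    have fv : fmeas (filtration N x0 W s) (fun w => v s w j 0).
      by move=> D mD; apply: (av s sT); apply: fmeas_sigma_gen mD; exists j.
    by apply: fmeas_sub fv; apply: filtration_mono; case/andP: su.
  have zE : z s = fun w => v s w + (invmx R *m B^T) *m (P s *m xh i s w + off s).
    by apply/funext => w; rewrite /dctrl uh_def opprK /offset addrA.
  by rewrite zE; split; [exact: sqvecD|move=> j; exact: orthD].
have oz' : {ae leb, forall s, 0 <= s <= u -> sqvec Pr (z s) /\
    forall k, \int[Pr]_w (Z w * z s w k 0) = 0}.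
  apply: negligibleS vv; apply: subsetC => s /= vs su; apply: oz => //; apply: vs.
  by rewrite in_itv/=; case/andP: su => -> /le_trans; apply; case/andP: uT.
have uu : 0 <= u <= u by rewrite u0 lexx.
have [sdy sdx ody odx] := dev_orth W_bm T0 (@xh_states N) X_states N0 uT sZ z_sq oz' uu.
have vu : sqvec Pr (v u) by apply: vU; rewrite in_itv/=.
have [sz ozu] := oz u uu vu.
apply: orthD => //; first exact: sqvec_mulmx.
- by apply: sqvecD; exact: sqvec_mulmx.
- exact: orth_mulmx.
- by apply: orthD; [exact: sZ|exact: sqvec_mulmx|exact: sqvec_mulmx|exact: orth_mulmx|exact: orth_mulmx].
Qed.

(** The drift of the discounted costate e^(-rho t) (P xh_i + offset) along the closed loop, left in
    the shape produced by [adjoint_identity]; [adjoint_cancel] evaluates it. *)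
Definition adj_drift : process n := fun t w =>
  (e_ t *: (riccati_rhs A Q B R rho (P t) - rho *: P t)) *m xh i t w
  + (e_ t *: P t) *m drift t w
  + e_ t *: (offset' rho A G Gamma Q B R eta f P Pbar shat xbar t - rho *: off t).

Lemma adj_identity : \int[tw]_(p in ET)
   (dotv (e_ p.1 *: (P p.1 *m xh i p.1 p.2) + e_ p.1 *: off p.1) (dev_drift p.1 p.2) +
    dotv (adj_drift p.1 p.2) (dx p.1 p.2)) = 0.
Proof.
have drift_sq : sqproc Pr T drift.
  apply: sqprocD; last exact: sqproc_det.
  by apply: sqprocD; [exact: sqproc_mulmx|exact: (sqproc_mulmx (@cst_cont _ _ G))].
have [noise_sq _] := noise_sqproc W_bm W_indep x0_rv x0_bound x0_W_indep T0 sigma_le S0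
  (xh_closed_loop i) (cl_drift_mproc cM_c cc_c (@xh_closed_loop N) i).
have nv t : 0 <= t <= T -> sqvec Pr (noise drift (xh i) t).
  move=> tT k; have [] // := noise_bound W_bm W_indep x0_rv x0_bound x0_W_indep
    sigma_le S0 (xh_closed_loop i) k tT.
have [_ _ PT] := P_ode; have [_ _ PbT] := Pbar_ode; have [_ _ sT] := shat_ode.
have off_T : off T = 0 by rewrite /offset PT PbT sT subrr mul0mx addr0.
have dxE : {ae Pr, forall w, forall t, 0 <= t <= T ->
    dx t w = time_integral (dev_drift ^~ w) t}.
  move: (dstate_eq W_bm T0 (@xh_states N) X_states); apply: filterS => w H t tT.
  by rewrite (H i t tT); apply: eq_time_integral => s; rewrite eqxx.
have := adjoint_identity T0 (disc_mx rho T0 (P_ac P_ode))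
  (eZ_cont (mxcontB (riccati_cont P_ode) (rho_cont P_c)))
  (_ : e_ T *: P T = 0)
  (disc_mx rho T0 (offset_ac T0 f_cont Pbar_ode P_ode shat_ode xbar_ode))
  (eZ_cont (mxcontB (offset'_mxcont f_cont Pbar_ode P_ode shat_ode xbar_ode)
     (rho_cont off_c)))
  (_ : e_ T *: off T = 0) noise_sq drift_sq dev_drift_sq dx_sq nv noise_dev_orth dxE.
rewrite PT off_T !scaler0 => /(_ erefl erefl) H; apply: etrans H.
apply: eq_Rintegral => p _.
have xE : noise drift (xh i) p.1 p.2 + time_integral (drift ^~ p.2) p.1 = xh i p.1 p.2.
  by rewrite /noise subrK.
by rewrite xE -scalemxAl.
Qed.

Lemma X_E : X i = fun t w => xh i t w + dx t w.
Proof. by apply/funext => t; apply/funext => w; rewrite /dstate addrC subrK. Qed.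

Lemma avg_X_E : avg X = fun t w => avg (xh (N := N)) t w + dy t w.
Proof. by apply/funext => t; apply/funext => w; rewrite avg_dstate addrC subrK. Qed.

Lemma v_E : v = fun t w => uh i t w + z t w.
Proof. by apply/funext => t; apply/funext => w; rewrite /dctrl addrC subrK. Qed.

(** The coefficient of the agent's own deviation in the cost gap. It is linear in the mean-field
    error, so its squared norm is O(1 / N). *)
Definition mean_gap : process n := fun t w =>
  e_ t *: ((P t *m G - Q *m Gamma) *m (avg (xh (N := N)) t w - xbar t)).

(** The coefficient of the mean deviation in the cost gap, through the dynamics (G) and the cost
    (Gamma). It is only bounded, but is paired with a deviation of size 1 / N. *)
Definition coupling : process n := fun t w =>
  G^T *m (e_ t *: (P t *m xh i t w) + e_ t *: off t)
  - e_ t *: (Gamma^T *m (Q *m (xh i t w - Gamma *m avg (xh (N := N)) t w - eta))).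

(** The quadratic part of the gap is at least the R-term, as Q >= 0, and Young's inequality is
    applied to the two remaining pairings. The weight [eps * N ^ 2] for the mean deviation offsets
    its squared size 1 / N^2. *)
Lemma gap_bound (kap eps : K) : 0 < eps -> sqproc Pr T mean_gap -> sqproc Pr T coupling ->
  (forall t (y : 'cV[K]_r), 0 <= t <= T -> kap * sqnorm y <= e_ t * wsqnorm R y) ->
  (cost Pr T rho Gamma Q R eta i (uh (N := N)) (xh (N := N)) +
    (kap * pnorm Pr T z)%R%:E <=
  cost Pr T rho Gamma Q R eta i (deviate (uh (N := N)) i v) X +
    (eps * pnorm Pr T dx + eps^-1 * pnorm Pr T mean_gap
     + (eps * N%:R ^+ 2 * pnorm Pr T dy
        + (eps * N%:R ^+ 2)^-1 * pnorm Pr T coupling))%R%:E)%E.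
Proof.
move=> eps0 sm sc Hk.
have N1 : 0 < N%:R :> K by rewrite ltr0n.
have eN0 : 0 < eps * N%:R ^+ 2 by rewrite mulr_gt0// exprn_gt0.
have sX : sqproc Pr T (X i) by rewrite X_E; exact: sqprocD.
have sA : sqproc Pr T (avg X) by rewrite avg_X_E; exact: sqprocD.
have su : sqproc Pr T (uh i) by exact: uh_sqproc.
have devi : deviate (uh (N := N)) i v i = v by rewrite /deviate eqxx.
have sdev : sqproc Pr T (deviate (uh (N := N)) i v i) by rewrite devi.
rewrite (costE (xh_sq i) avg_sq su) (costE sX sA sdev) -!EFinD lee_fin devi.
pose pi : process n := fun t w => e_ t *: (P t *m xh i t w) + e_ t *: off t.
have pi_sq : sqproc Pr T pi.
  apply: sqprocD; last by apply: sqproc_det; exact: eZ_cont.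
  have := sqproc_mulmx (eZ_cont P_c) (xh_sq i); congr (sqproc _ _ _).
  by apply/funext => t; apply/funext => w; rewrite -scalemxAl.
have drift_sq : sqproc Pr T drift.
  apply: sqprocD; last exact: sqproc_det.
  by apply: sqprocD; [exact: sqproc_mulmx|exact: (sqproc_mulmx (@cst_cont _ _ G))].
have adj_sq : sqproc Pr T adj_drift.
  apply: sqprocD; last first.
    apply: sqproc_det; apply: eZ_cont; apply: mxcontB; last exact: rho_cont.
    exact: (offset'_mxcont f_cont Pbar_ode P_ode shat_ode xbar_ode).
  apply: sqprocD; apply: sqproc_mulmx => //; apply: eZ_cont => //.
  by apply: mxcontB; [exact: (riccati_cont P_ode)|exact: rho_cont].
have hid : hasint tw ET (fun p => dotv (pi p.1 p.2) (dev_drift p.1 p.2) +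
    dotv (adj_drift p.1 p.2) (dx p.1 p.2)) 0.
  split; last exact: adj_identity.
  by have := integrableD mET (sqproc_dotv pi_sq dev_drift_sq) (sqproc_dotv adj_sq dx_sq).
have hU := hasint_integrable (running_cost_integrable (xh_sq i) avg_sq su).
have hV := hasint_integrable (running_cost_integrable sX sA v_sq).
have hs k (Y : process k) (sY : sqproc Pr T Y) := hasint_integrable (sqproc_sqnorm sY).
have hL := hasintD mET hU (hasintZ mET kap (hs _ _ z_sq)).
have hR := hasintD mET (hasintD mET hV
  (hasintD mET (hasintD mET (hasintZ mET eps (hs _ _ dx_sq)) (hasintZ mET eps^-1 (hs _ _ sm)))
    (hasintD mET (hasintZ mET (eps * N%:R ^+ 2) (hs _ _ dy_sq))
      (hasintZ mET (eps * N%:R ^+ 2)^-1 (hs _ _ sc)))))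
  (hasintZ mET 2 hid).
(* Twice the adjoint identity, whose integral is 0, is added to the larger side; after that the
   inequality holds pointwise in (t, w). *)
rewrite -[leRHS]addr0 -[X in _ <= _ + X](mulr0 2).
apply: (hasint_le mET _ hL hR) => -[t w] [/=]; rewrite in_itv/= => tT _.
have Ru := R_uh i t w.
have ep : e_ t *: (P t *m xh i t w + off t) = e_ t *: (P t *m xh i t w) + e_ t *: off t.
  by rewrite scalerDr.
have gE : adj_drift t w + A^T *m (e_ t *: (P t *m xh i t w) + e_ t *: off t) =
   - (e_ t *: (Q *m (xh i t w - Gamma *m xbar t - eta)
      - P t *m (G *m (avg (xh (N := N)) t w - xbar t)))).
  exact: adjoint_cancel.
have /= gap := cost_gap (dx t w) (dy t w) (z t w) Q_sym R_sym Ru ep gE.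
have q0 : 0 <= e_ t * wsqnorm Q (dx t w - Gamma *m dy t w).
  by rewrite mulr_ge0 ?expR_ge0//; exact: Q_psd.
have k0 := Hk t (z t w) tT.
have einv : 0 < eps^-1 by rewrite invr_gt0.
have eNinv : 0 < (eps * N%:R ^+ 2)^-1 by rewrite invr_gt0.
have y1 := dotv_young (mean_gap t w) (dx t w) einv.
have y2 := dotv_young (coupling t w) (dy t w) eNinv.
rewrite !invrK in y1 y2.
move: gap; rewrite -/(mean_gap t w) -/(coupling t w) -/(pi t w) -/(dev_drift t w) => gap.
have xE : X i t w = xh i t w + dx t w by rewrite X_E.
have aE : avg X t w = avg (xh (N := N)) t w + dy t w by rewrite avg_X_E.
have vE : v t w = uh i t w + z t w by rewrite [in LHS]v_E.
rewrite /running_cost /= xE aE vE.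
by move: gap q0 k0 y1 y2; lra.
Qed.

End Gap.
Hypothesis rho_ge0 : 0 <= rho.

(** The constant precedes N, i, v and X: it involves only the coefficients and the uniform bounds of
    [cl_estimates] and [dev_estimates], since every term depending on the size of the deviation is
    absorbed. *)
Lemma nash_gap : exists2 C, 0 <= C &
  forall N (i : 'I_N) (v : process r) (X : 'I_N -> process n),
    L2_adapted Pr T (filtration N x0 W) v ->
    states Pr T A B G f sigma x0 W (deviate (uh (N := N)) i v) X ->
    (cost Pr T rho Gamma Q R eta i (uh (N := N)) (xh (N := N)) - (C / N%:R)%:E <=
     cost Pr T rho Gamma Q R eta i (deviate (uh (N := N)) i v) X)%E.
Proof.
have xbarE := xbar_integral P f_cont Pbar_ode shat_ode xbar_ode.
have [Cl Cl0 Hcl] := cl_estimates W_bm W_indep x0_rv x0_indep x0_mean x0_bound x0_W_indep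
  T0 sigma_le S0 cM_c cc_c xbar_c xbarE.
have [cR cR0 HcR] := posdef_coercive R_sym R_pos.
(* As rho >= 0, the discount factor on [0, T] is smallest at T. *)
pose kap := e_ T * cR.
have kap0 : 0 < kap by rewrite mulr_gt0// expR_gt0.
have Hk t (y : 'cV[K]_r) : 0 <= t <= T -> kap * sqnorm y <= e_ t * wsqnorm R y.
  move=> /andP[t0 tT]; rewrite /kap -mulrA; apply: ler_pM.
  - exact: expR_ge0.
  - by rewrite mulr_ge0 ?sqnorm_ge0// ltW.
  - by rewrite /disc ler_expR lerN2 ler_wpM2l.
  - exact: HcR.
pose Cd := dev_const T A G B.
have Cd0 : 0 <= Cd by exact: dev_const_ge0.
have D0 : 0 < 2 * Cd + 1 by rewrite ltr_wpDl// mulr_ge0.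
(* The two deviation terms are at most eps Cd |zeta|^2 each, so they are absorbed once 2 eps Cd <=
   kap; the added 1 keeps the denominator positive. *)
pose eps := kap / (2 * Cd + 1).
have eps0 : 0 < eps by rewrite divr_gt0.
have einv0 : 0 < eps^-1 by rewrite invr_gt0.
have epsE : eps * (2 * Cd + 1) = kap by rewrite /eps divfK// gt_eqF.
have m2_c : mxcont T (fun t => e_ t *: (P t *m G - Q *m Gamma)).
  by apply: eZ_cont; apply: mxcontB => //; exact: mxcontM.
have m3_c : mxcont T (fun t => G^T *m (e_ t *: P t) - e_ t *: (Gamma^T *m Q)).
  by apply: mxcontB; [apply: mxcontM => //; exact: eZ_cont|exact: eZ_cont].
have m4_c : mxcont T (fun t => e_ t *: (Gamma^T *m Q *m Gamma)) by exact: eZ_cont.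
have m5_c : mxcont T (fun t => G^T *m (e_ t *: off t) + e_ t *: (Gamma^T *m Q *m eta)).
  by apply: mxcontD; [apply: mxcontM => //; exact: eZ_cont|exact: eZ_cont].
have [c2 c20 Hc2] := mxcont_frob_bounded m2_c.
have [c3 c30 Hc3] := mxcont_frob_bounded m3_c.
have [c4 c40 Hc4] := mxcont_frob_bounded m4_c.
pose p5 := pnorm Pr T (fun t _ => G^T *m (e_ t *: off t) + e_ t *: (Gamma^T *m Q *m eta)).
have p50 : 0 <= p5 by exact: pnorm_ge0.
(* A bound for the squared norm of [coupling], written as a part linear in xh_i, a part linear in
   the mean and a deterministic part; the factors 2 come from [pnormD_le]. *)
pose Ct := 2 * (2 * (c3 * Cl) + 2 * (c4 * Cl)) + 2 * p5.
have Ct0 : 0 <= Ct by rewrite /Ct !addr_ge0 ?mulr_ge0 ?addr_ge0 ?mulr_ge0.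
exists (eps^-1 * (c2 * Cl) + eps^-1 * Ct).
  by apply: addr_ge0; apply: mulr_ge0 => //; [exact: ltW|exact: mulr_ge0|exact: ltW].
move=> N i v X va sX.
have N0 : (0 < N)%N by case: N i {va sX X v} => // -[].
have N1 : 0 < N%:R :> K by rewrite ltr0n.
have N2 : 1 <= N%:R :> K by rewrite ler1n.
have [avg_sq xh_sq pe [pA px]] := Hcl N _ N0 (@xh_closed_loop N).
have v_sq : sqproc Pr T v by have [mv _ iv] := va; exact: sqprocP.
have z_sq : sqproc Pr T (dctrl i (uh (N := N)) v) by apply: sqprocB => //; exact: uh_sqproc.
have [dy_sq dx_sq pdy pdx] := dev_estimates W_bm T0 (@xh_states N) sX N0 z_sq.
set pz := pnorm Pr T (dctrl i (uh (N := N)) v) in pdx pdy *.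
have pz0 : 0 <= pz by exact: pnorm_ge0.
have se : sqproc Pr T (fun t w => avg (xh (N := N)) t w - xbar t).
  by apply: sqprocB => //; exact: sqproc_det.
have mE : mean_gap N = fun t w => (e_ t *: (P t *m G - Q *m Gamma)) *m
    (avg (xh (N := N)) t w - xbar t).
  by apply/funext => t; apply/funext => w; rewrite /mean_gap scalemxAl.
have m_sq : sqproc Pr T (mean_gap N) by rewrite mE; exact: sqproc_mulmx.
have pm : pnorm Pr T (mean_gap N) <= c2 * (Cl / N%:R).
  by rewrite mE; apply: le_trans (pnorm_mulmx_le m2_c Hc2 se) _; rewrite ler_wpM2l.
have tE : coupling i = fun t w =>
    ((G^T *m (e_ t *: P t) - e_ t *: (Gamma^T *m Q)) *m xh i t w
     + (e_ t *: (Gamma^T *m Q *m Gamma)) *m avg (xh (N := N)) t w)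
    + (G^T *m (e_ t *: off t) + e_ t *: (Gamma^T *m Q *m eta)).
  apply/funext => t; apply/funext => w; rewrite /coupling.
  rewrite !(mulmxDl, mulmxDr, mulNmx, mulmxN, scalerDr, scalerN) -!mulmxA.
  do ?rewrite -scalemxAl; do ?rewrite -scalemxAr; do ?rewrite -mulmxA.
  by mx_abelian.
have s3 := sqproc_mulmx m3_c (xh_sq i); have s4 := sqproc_mulmx m4_c avg_sq.
have s5 : sqproc Pr T (fun t _ => G^T *m (e_ t *: off t) + e_ t *: (Gamma^T *m Q *m eta)).
  exact: sqproc_det.
have s34 := sqprocD s3 s4.
have t_sq : sqproc Pr T (coupling i) by rewrite tE; exact: sqprocD.
have pt : pnorm Pr T (coupling i) <= Ct.
  rewrite tE; apply: le_trans (pnormD_le s34 s5) _.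
  rewrite /Ct lerD2r; apply: ler_wpM2l => //; apply: le_trans (pnormD_le s3 s4) _.
  apply: lerD; apply: ler_wpM2l => //.
    by apply: le_trans (pnorm_mulmx_le m3_c Hc3 (xh_sq i)) _; rewrite ler_wpM2l.
  by apply: le_trans (pnorm_mulmx_le m4_c Hc4 avg_sq) _; rewrite ler_wpM2l.
have gap := gap_bound va sX xh_sq avg_sq eps0 m_sq t_sq Hk.
rewrite -/pz in gap.
rewrite leeBlDr//; move: gap; rewrite -leeBrDr// => /le_trans; apply.
rewrite -addeA leeD2l// -EFinB lee_fin.
have b1 : eps * pnorm Pr T (dstate (xh (N := N)) X i) <= eps * (Cd * pz).
  by rewrite ler_pM2l.
have b2 : eps^-1 * pnorm Pr T (mean_gap N) <= eps^-1 * (c2 * Cl) / N%:R.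
  by rewrite -!mulrA ler_pM2l.
have b3 : eps * N%:R ^+ 2 * pnorm Pr T (avg (dstate (xh (N := N)) X)) <= eps * (Cd * pz).
  by rewrite -mulrA ler_pM2l// mulrC -ler_pdivlMr// exprn_gt0.
(* The order 1 / N^2 is weakened to 1 / N, the order of the mean-field term. *)
have b4 : (eps * N%:R ^+ 2)^-1 * pnorm Pr T (coupling i) <= eps^-1 * Ct / N%:R.
  rewrite invfM -!mulrA ler_pM2l// mulrC; apply: ler_pM => //.
  - exact: pnorm_ge0.
  - by rewrite lef_pV2 ?posrE ?exprn_gt0// expr2 ler_peMr// ltW.
have b5 : 2 * (eps * (Cd * pz)) <= kap * pz.
  by rewrite -epsE; have := mulr_ge0 (ltW eps0) pz0; lra.
by rewrite mulrDl; lra.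
Qed.

End Equilibrium.

Theorem mainTheorem8
  (d : measure_display) (Omega : measurableType d) (K : realType)
  (Pr : probability Omega K) (n r : nat)
  (T rho : K) (A G Gamma Q : 'M[K]_n) (B : 'M[K]_(n, r)) (R : 'M[K]_r)
  (eta : 'cV[K]_n) (f sigma : K -> 'cV[K]_n)
  (W : nat -> K -> Omega -> K) (x0 : nat -> Omega -> 'cV[K]_n)
  (xbar0 : 'cV[K]_n) (C0 : K)
  (P Pbar : K -> 'M[K]_n) (shat xbar : K -> 'cV[K]_n)
  (xh : forall N : nat, 'I_N -> K -> Omega -> 'cV[K]_n)
  (uh : forall N : nat, 'I_N -> K -> Omega -> 'cV[K]_r)
  (T_gt0 : 0 < T) (rho_gt0 : 0 < rho)
  (Q_sym : mxsym Q) (Q_psd : mxpsd Q) (R_sym : mxsym R) (R_pos : mxposdef R)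
  (f_cont : {within `[0, +oo[, continuous f})
  (sigma_cont : {within `[0, +oo[, continuous sigma})
  (f_sigma_int : (\int[lebesgue_measure]_(t in `[0%R, +oo[)
      (expR (- (rho * t)) * (sqnorm (f t) + sqnorm (sigma t)))%:E < +oo)%E)
  (W_bm : forall i, brownian_motion Pr (W i))
  (W_indep : mutually_indep Pr (fun i => process_sigma (W i)))
  (x0_rv : forall i, random_vector (x0 i))
  (x0_indep : mutually_indep Pr (fun i => sigma_gen (coords (x0 i))))
  (x0_mean : forall i j, 'E_Pr[fun w => x0 i w j 0%R]%E = (xbar0 j 0)%:E)
  (x0_bound : forall i, (\int[Pr]_w (sqnorm (x0 i w))%:E < C0%:E)%E)
  (x0_W_indep : indep Pr
      (<<s \bigcup_i sigma_gen (coords (x0 i)) >>)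
      (<<s \bigcup_i process_sigma (W i) >>))
  (Pbar_ode : [/\ ode_regular T Pbar,
      forall t, 0 < t < T ->
        rho *: Pbar t = derive1 Pbar t + A^T *m Pbar t + Pbar t *m (A + G)
          - Pbar t *m B *m invmx R *m B^T *m Pbar t + Q - Q *m Gamma &
      Pbar T = 0])
  (P_ode : [/\ ode_regular T P,
      forall t, 0 < t < T ->
        rho *: P t = derive1 P t + A^T *m P t + P t *m A
          - P t *m B *m invmx R *m B^T *m P t + Q &
      P T = 0])
  (shat_ode : [/\ ode_regular T shat,
      forall t, 0 < t < T ->
        rho *: shat t = derive1 shat t
          + (A^T - Pbar t *m B *m invmx R *m B^T) *m shat t
          + Pbar t *m f t - Q *m eta &
      shat T = 0])
  (xbar_ode : [/\ ode_regular T xbar,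
      forall t, 0 < t < T ->
        derive1 xbar t = A *m xbar t
          - B *m invmx R *m B^T *m (Pbar t *m xbar t + shat t)
          + G *m xbar t + f t &
      xbar 0 = xbar0])
  (xh_sde : forall (N : nat) (i : 'I_N),
      sde_solution Pr T
        (fun t w =>
           (A - B *m invmx R *m B^T *m P t) *m xh N i t w
           - B *m invmx R *m B^T *m ((Pbar t - P t) *m xbar t + shat t)
           + G *m avg (xh N) t w + f t)
        sigma (W i) (x0 i) (xh N i))
  (uh_def : forall (N : nat) (i : 'I_N) (t : K) (w : Omega),
      uh N i t w = - (invmx R *m B^T *m
        (P t *m xh N i t w + (Pbar t - P t) *m xbar t + shat t))) :
  exists eps : nat -> K,
    eps =O_\oo (fun N : nat => (Num.sqrt (N%:R : K))^-1) /\
    forall (N : nat) (i : 'I_N),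
      (ereal_inf [set J | exists v X,
         [/\ L2_adapted Pr T (filtration N x0 W) v,
             states Pr T A B G f sigma x0 W (deviate (uh N) i v) X &
             J = cost Pr T rho Gamma Q R eta i (deviate (uh N) i v) X]]
       >= cost Pr T rho Gamma Q R eta i (uh N) (xh N) - (eps N)%:E)%E.
Proof.
have T0 := ltW T_gt0.
have halfline (g : K -> 'cV[K]_n) : {within `[0, +oo[, continuous g} -> mxcont T g.
  move=> cg; apply: mxcont_within; apply: continuous_subspaceW cg => t /=.
  by rewrite !in_itv/= andbT => /andP[].
have [S S0 HS] := mxcont_frob_bounded (halfline _ sigma_cont).
have sigma_le t k : 0 <= t <= T -> sigma t k 0 ^+ 2 <= S.
  move=> tT; apply: le_trans (HS t tT); rewrite /mxfrob (bigD1 k)//= big_ord1 lerDl.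
  by apply: sumr_ge0 => l _; apply: sumr_ge0 => j _; exact: sqr_ge0.
have [C C_ge0 gap] := nash_gap T_gt0 Q_sym Q_psd R_sym R_pos (halfline _ f_cont) W_bm W_indep
  x0_rv x0_indep x0_mean x0_bound x0_W_indep Pbar_ode P_ode shat_ode xbar_ode xh_sde uh_def
  S0 sigma_le (ltW rho_gt0).
(* At N = 0 the quotient is 0 by convention, and there is no agent to check. *)
exists (fun N => C / N%:R); split; last first.
  move=> N i; apply: le_ereal_inf_tmp => _ [v [X [va sX ->]]]; exact: gap.
(* [C] may be 0, whereas the constant of the O must be positive. *)
apply/eqO_exP; exists (C + 1); first by rewrite ltr_wpDl.
near=> N; have N0 : (0 < N)%N by near: N; exact: nbhs_infty_gt.
have N1 : 1 <= N%:R :> K by rewrite ler1n.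
have s0 : 0 < Num.sqrt (N%:R : K) by rewrite sqrtr_gt0 ltr0n.
rewrite (ger0_norm (divr_ge0 C_ge0 (ler0n K N))) ger0_norm ?invr_ge0 ?sqrtr_ge0//.
apply: ler_pM => //; first by rewrite lerDl.
(* What remains is 1 / N <= 1 / sqrt N, which follows from sqrt N >= 1. *)
rewrite lef_pV2 ?posrE ?ltr0n// -[leRHS]sqr_sqrtr// expr2 ler_peMr ?sqrtr_ge0//.
by rewrite -[leLHS]sqrtr1 ler_wsqrtr.
Unshelve. all: by end_near.
Qed.
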